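(* Let $\Gamma=(\Pi,\Sigma)$ (vertex set $\Pi$, edge set $\Sigma$) be a simply laced Dynkin diagram of finite type, i.e. the diagram obtained by removing vertex $0$ from one of the affine diagrams $A_n^{(1)}$ ($n\ge2$), $D_n^{(1)}$ ($n\ge4$), $E_6^{(1)}$, $E_7^{(1)}$, $E_8^{(1)}$ (so $\Gamma$ is $A_n$, $D_n$, $E_6$, $E_7$ or $E_8$). Let $K$ be a field of characteristic unequal to $2$ and set $T:=(K^* )^\Pi$. Then the variety $X$ attached to $\Gamma$ and $K$ is, as a $T$-variety, isomorphic to the vector space $V:=K^\Sigma$ on which $T$ acts diagonally with character $-\alpha_e$ on the component corresponding to $e\in\Sigma$. For $f$ corresponding to any element in the dense $T$-orbit $(K^* )^\Sigma$ the Lie algebra $\mathcal{L}(f)$ is isomorphic to a fixed Lie algebra.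
   Context: Write $\sim$ for adjacency in $\Gamma$. $\mathcal{F}$ is the quotient of the free Lie algebra over $K$ on $\Pi$ modulo the relations $[x,y]=0$ for $x,y\in\Pi$, $x\not\sim y$. For $f=(f_x)_{x\in\Pi}\in(\mathcal{F}^* )^\Pi$ (with $\mathcal{F}^*$ the space of $K$-linear functions $\mathcal{F}\to K$), $\mathcal{I}(f)$ is the ideal of $\mathcal{F}$ generated by all $[x,[x,y]]-f_x(y)x$, $x\in\Pi$, $y\in\mathcal{F}$, and $\mathcal{L}(f):=\mathcal{F}/\mathcal{I}(f)$. $\mathcal{L}(0)$ is finite-dimensional, $\dim\mathcal{L}(f)\le\dim\mathcal{L}(0)$ for all $f$, and $X:=\{f\in(\mathcal{F}^* )^\Pi\mid\dim\mathcal{L}(f)=\dim\mathcal{L}(0)\}$. $X$ is (the set of $K$-points of) an affine variety over $K$: for any finite-dimensional subspace $U\subseteq\mathcal{F}$, homogeneous for the grading by degree in the generators, with $U+\mathcal{I}(0)=\mathcal{F}$, the map $X\to(U^* )^\Pi$, $f\mapsto(f_x|_U)_{x\in\Pi}$, is injective with image the $K$-points of a closed subvariety, and the resulting $K$-variety structure on $X$ is independent of $U$. Torus action: $t=(t_x)_{x\in\Pi}\in T$ acts on $\mathcal{F}$ by the unique automorphism with $x\mapsto t_xx$ for $x\in\Pi$, and on $X$ by $(tf)_x(y):=t_x^{-1}f_x(t^{-1}y)$ for $x\in\Pi$, $y\in\mathcal{F}$. Characters: $\mathbb{Z}^\Pi$ is identified with the character group of $T$ by letting $\mu$ denote the character $t\mapsto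 t^\mu=\prod_{x\in\Pi}t_x^{\mu_x}$. $\alpha_x$ is the standard basis vector of $\mathbb{Z}^\Pi$ at $x$, and $\alpha_e:=\alpha_x+\alpha_y$ for $e=\{x,y\}\in\Sigma$. *)

(* Defs.v *)
From HB Require Import structures.
From mathcomp Require Import mpoly.
From mathcomp Require Import all_boot all_order all_algebra.
From mathcomp Require Import boolp.

Set Implicit Arguments.
Unset Strict Implicit.
Unset Printing Implicit Defensive.

Import GRing.Theory.
Local Open Scope ring_scope.
Local Open Scope quotient_scope.

HB.mixin Record Lmodule_isLie (K : fieldType) L of GRing.Lmodule K L := {
  lie : L -> L -> L;
  lie_linearl : forall a x y z, lie (a *: x + y) z = a *: lie x z + lie y z;
  lie_linearr : forall a x y z, lie z (a *: x + y) = a *: lie z x + lie z y;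
  liexx : forall x, lie x x = 0;
  lie_jacobi : forall x y z,
    lie x (lie y z) + lie y (lie z x) + lie z (lie x y) = 0
}.

#[short(type="lieType")]
HB.structure Definition LieAlgebra (K : fieldType) :=
  { L of GRing.Lmodule K L & Lmodule_isLie K L }.

Definition lie_iso (K : fieldType) (A B : lieType K) : Prop :=
  exists h : {linear A -> B},
    bijective h /\ forall x y, h (lie x y) = lie (h x) (h y).

Section LieTheory.
Variables (K : fieldType) (L : lieType K).
Implicit Types x y z : L.

Lemma lieDl x y z : lie (x + y) z = lie x z + lie y z.
Proof. by rewrite -[x]scale1r lie_linearl !scale1r. Qed.

Lemma lieDr x y z : lie z (x + y) = lie z x + lie z y.
Proof. by rewrite -[x]scale1r lie_linearr !scale1r. Qed.

Lemma lie0l z : lie 0 z = 0.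
Proof. by apply: (addrI (lie 0 z)); rewrite -lieDl !addr0. Qed.

Lemma lie0r z : lie z 0 = 0.
Proof. by apply: (addrI (lie z 0)); rewrite -lieDr !addr0. Qed.

Lemma lieZl a x z : lie (a *: x) z = a *: lie x z.
Proof. by rewrite -[a *: x]addr0 lie_linearl lie0l addr0. Qed.

Lemma lieZr a x z : lie z (a *: x) = a *: lie z x.
Proof. by rewrite -[a *: x]addr0 lie_linearr lie0r addr0. Qed.

Lemma lieNl x z : lie (- x) z = - lie x z.
Proof. by rewrite -scaleN1r lieZl scaleN1r. Qed.

Lemma lieNr x z : lie z (- x) = - lie z x.
Proof. by rewrite -scaleN1r lieZr scaleN1r. Qed.

Lemma lieC x y : lie x y = - lie y x.
Proof.
apply/eqP; rewrite -addr_eq0; apply/eqP.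
by have := liexx (x + y); rewrite lieDl !lieDr !liexx add0r addr0.
Qed.

End LieTheory.

Section Quotient.
Variables (K : fieldType) (L : lieType K) (G : L -> Prop).

Inductive ideal_gen : L -> Prop :=
| ideal_gen_incl x of G x : ideal_gen x
| ideal_gen0 : ideal_gen 0
| ideal_gen_linear a x y of ideal_gen x & ideal_gen y : ideal_gen (a *: x + y)
| ideal_gen_lie x y of ideal_gen y : ideal_gen (lie x y).

Lemma ideal_genZ a x : ideal_gen x -> ideal_gen (a *: x).
Proof.
by move=> Ix; rewrite -[_ *: _]addr0; apply: ideal_gen_linear => //; apply: ideal_gen0.
Qed.

Lemma ideal_genN x : ideal_gen x -> ideal_gen (- x).
Proof. by rewrite -scaleN1r; apply: ideal_genZ. Qed.

Lemma ideal_genD x y : ideal_gen x -> ideal_gen y -> ideal_gen (x + y).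
Proof. by move=> Ix Iy; rewrite -[x]scale1r; apply: ideal_gen_linear. Qed.

Definition ideal_eq : rel L := fun x y => `[< ideal_gen (x - y) >].

Lemma ideal_eq_refl : reflexive ideal_eq.
Proof. by move=> x; apply/asboolP; rewrite subrr; apply: ideal_gen0. Qed.

Lemma ideal_eq_sym : symmetric ideal_eq.
Proof.
by move=> x y; apply/asboolP/asboolP => /ideal_genN; rewrite opprB.
Qed.

Lemma ideal_eq_trans : transitive ideal_eq.
Proof.
move=> y x z /asboolP Ixy /asboolP Iyz; apply/asboolP.
by rewrite -(subrKA y); apply: ideal_genD.
Qed.

Canonical ideal_eq_equiv :=
  EquivRel ideal_eq ideal_eq_refl ideal_eq_sym ideal_eq_trans.

Definition lie_quot := {eq_quot ideal_eq}.
HB.instance Definition _ := Choice.on lie_quot.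
HB.instance Definition _ := Quotient.on lie_quot.

Definition quot_pi (x : L) : lie_quot := \pi x.

Lemma quot_piP x y : quot_pi x = quot_pi y <-> ideal_gen (x - y).
Proof.
split; first by move/eqmodP/asboolP.
by move=> I; apply/eqmodP/asboolP.
Qed.

Lemma quot_repr (q : lie_quot) : quot_pi (repr q) = q.
Proof. exact: reprK. Qed.

Lemma quot_ind (P : lie_quot -> Prop) :
  (forall x, P (quot_pi x)) -> forall q, P q.
Proof. by move=> H q; rewrite -(quot_repr q). Qed.

Lemma repr_quot_pi x : ideal_gen (repr (quot_pi x) - x).
Proof. by apply/quot_piP; rewrite quot_repr. Qed.

Definition quot_add (p q : lie_quot) := quot_pi (repr p + repr q).
Definition quot_opp (p : lie_quot) := quot_pi (- repr p).
Definition quot_scale (a : K) (p : lie_quot) := quot_pi (a *: repr p).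
Definition quot_lie (p q : lie_quot) := quot_pi (lie (repr p) (repr q)).

Lemma quot_addE x y : quot_add (quot_pi x) (quot_pi y) = quot_pi (x + y).
Proof.
apply/quot_piP; rewrite opprD addrACA.
by apply: ideal_genD; apply: repr_quot_pi.
Qed.

Lemma quot_oppE x : quot_opp (quot_pi x) = quot_pi (- x).
Proof. by apply/quot_piP; rewrite -opprD; apply/ideal_genN/repr_quot_pi. Qed.

Lemma quot_scaleE a x : quot_scale a (quot_pi x) = quot_pi (a *: x).
Proof. by apply/quot_piP; rewrite -scalerBr; apply/ideal_genZ/repr_quot_pi. Qed.

Lemma quot_lieE x y : quot_lie (quot_pi x) (quot_pi y) = quot_pi (lie x y).
Proof.
apply/quot_piP; set x' := repr _; set y' := repr _.
have -> : lie x' y' - lie x y = lie x' (y' - y) + lie (- y) (x' - x).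
  by rewrite !(lieDl, lieDr, lieNl, lieNr) opprK (lieC y x') (lieC y x) opprK subrKA.
by apply: ideal_genD; apply/ideal_gen_lie/repr_quot_pi.
Qed.

Fact quot_addA : associative quot_add.
Proof.
by elim/quot_ind=> x; elim/quot_ind=> y; elim/quot_ind=> z; rewrite !quot_addE addrA.
Qed.

Fact quot_addC : commutative quot_add.
Proof. by elim/quot_ind=> x; elim/quot_ind=> y; rewrite !quot_addE addrC. Qed.

Fact quot_add0 : left_id (quot_pi 0) quot_add.
Proof. by elim/quot_ind=> x; rewrite quot_addE add0r. Qed.

Fact quot_addN : left_inverse (quot_pi 0) quot_opp quot_add.
Proof. by elim/quot_ind=> x; rewrite quot_oppE quot_addE addNr. Qed.

HB.instance Definition _ :=
  GRing.isZmodule.Build lie_quot quot_addA quot_addC quot_add0 quot_addN.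

Fact quot_scaleA a b q : quot_scale a (quot_scale b q) = quot_scale (a * b) q.
Proof. by elim/quot_ind: q => x; rewrite !quot_scaleE scalerA. Qed.

Fact quot_scale1 : left_id 1 quot_scale.
Proof. by elim/quot_ind=> x; rewrite quot_scaleE scale1r. Qed.

Fact quot_scaleDr : right_distributive quot_scale +%R.
Proof.
move=> a; elim/quot_ind=> x; elim/quot_ind=> y.
by rewrite /GRing.add /= !(quot_addE, quot_scaleE) scalerDr.
Qed.

Fact quot_scaleDl q : {morph quot_scale^~ q : a b / a + b}.
Proof.
move=> a b; elim/quot_ind: q => x.
by rewrite [in RHS]/GRing.add /= !(quot_addE, quot_scaleE) scalerDl.
Qed.

HB.instance Definition _ := GRing.Zmodule_isLmodule.Build K lie_quot
  quot_scaleA quot_scale1 quot_scaleDr quot_scaleDl.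

Lemma quot_piD x y : quot_pi (x + y) = quot_pi x + quot_pi y.
Proof. by rewrite -quot_addE. Qed.

Lemma quot_piZ a x : quot_pi (a *: x) = a *: quot_pi x.
Proof. by rewrite -quot_scaleE. Qed.

Fact quot_pi_linear : linear quot_pi.
Proof. by move=> a x y; rewrite quot_piD quot_piZ. Qed.

HB.instance Definition _ :=
  GRing.isLinear.Build K L lie_quot _ quot_pi quot_pi_linear.

Fact quot_lie_linearl a p q r :
  quot_lie (a *: p + q) r = a *: quot_lie p r + quot_lie q r.
Proof.
elim/quot_ind: p => x; elim/quot_ind: q => y; elim/quot_ind: r => z.
by rewrite -linearP !quot_lieE -linearP lie_linearl.
Qed.

Fact quot_lie_linearr a p q r :
  quot_lie r (a *: p + q) = a *: quot_lie r p + quot_lie r q.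
Proof.
elim/quot_ind: p => x; elim/quot_ind: q => y; elim/quot_ind: r => z.
by rewrite -linearP !quot_lieE -linearP lie_linearr.
Qed.

Fact quot_liexx q : quot_lie q q = 0.
Proof. by elim/quot_ind: q => x; rewrite quot_lieE liexx linear0. Qed.

Fact quot_jacobi p q r :
  quot_lie p (quot_lie q r) + quot_lie q (quot_lie r p)
  + quot_lie r (quot_lie p q) = 0.
Proof.
elim/quot_ind: p => x; elim/quot_ind: q => y; elim/quot_ind: r => z.
by rewrite !quot_lieE -!quot_piD lie_jacobi linear0.
Qed.

HB.instance Definition _ := Lmodule_isLie.Build K lie_quot
  quot_lie_linearl quot_lie_linearr quot_liexx quot_jacobi.

Lemma quot_pi_lie x y : quot_pi (lie x y) = lie (quot_pi x) (quot_pi y).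
Proof. by rewrite -quot_lieE. Qed.

End Quotient.

(* The free Lie algebra on [P] is [lterm] modulo [lterm_eq], the least congruence
   that forces the laws of a Lie algebra over [K]. *)

Section Free.
Variables (K : fieldType) (P : Type).

Inductive lterm :=
| TGen of P
| TZero
| TAdd of lterm & lterm
| TScale of K & lterm
| TLie of lterm & lterm.

HB.instance Definition _ := gen_eqMixin lterm.
HB.instance Definition _ := gen_choiceMixin lterm.

Inductive lterm_eq : lterm -> lterm -> Prop :=
| lteq_refl s : lterm_eq s s
| lteq_sym s t of lterm_eq s t : lterm_eq t s
| lteq_trans s t u of lterm_eq s t & lterm_eq t u : lterm_eq s u
| lteq_add s s' t t' of lterm_eq s s' & lterm_eq t t' :
    lterm_eq (TAdd s t) (TAdd s' t')
| lteq_scale a s s' of lterm_eq s s' : lterm_eq (TScale a s) (TScale a s')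
| lteq_lie s s' t t' of lterm_eq s s' & lterm_eq t t' :
    lterm_eq (TLie s t) (TLie s' t')
| lteq_addA s t u : lterm_eq (TAdd s (TAdd t u)) (TAdd (TAdd s t) u)
| lteq_addC s t : lterm_eq (TAdd s t) (TAdd t s)
| lteq_add0 s : lterm_eq (TAdd TZero s) s
| lteq_addN s : lterm_eq (TAdd (TScale (- 1) s) s) TZero
| lteq_scaleA a b s : lterm_eq (TScale a (TScale b s)) (TScale (a * b) s)
| lteq_scale1 s : lterm_eq (TScale 1 s) s
| lteq_scaleDr a s t :
    lterm_eq (TScale a (TAdd s t)) (TAdd (TScale a s) (TScale a t))
| lteq_scaleDl a b s :
    lterm_eq (TScale (a + b) s) (TAdd (TScale a s) (TScale b s))
| lteq_lie_linearl a s t u :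
    lterm_eq (TLie (TAdd (TScale a s) t) u) (TAdd (TScale a (TLie s u)) (TLie t u))
| lteq_lie_linearr a s t u :
    lterm_eq (TLie u (TAdd (TScale a s) t)) (TAdd (TScale a (TLie u s)) (TLie u t))
| lteq_liexx s : lterm_eq (TLie s s) TZero
| lteq_jacobi s t u :
    lterm_eq
      (TAdd (TAdd (TLie s (TLie t u)) (TLie t (TLie u s))) (TLie u (TLie s t)))
      TZero.

Definition lterm_eqb : rel lterm := fun s t => `[< lterm_eq s t >].

Lemma lterm_eqb_refl : reflexive lterm_eqb.
Proof. by move=> s; apply/asboolP/lteq_refl. Qed.

Lemma lterm_eqb_sym : symmetric lterm_eqb.
Proof. by move=> s t; apply/asboolP/asboolP; apply: lteq_sym. Qed.

Lemma lterm_eqb_trans : transitive lterm_eqb.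
Proof.
move=> t s u /asboolP st /asboolP tu; apply/asboolP.
exact: lteq_trans st tu.
Qed.

Canonical lterm_equiv :=
  EquivRel lterm_eqb lterm_eqb_refl lterm_eqb_sym lterm_eqb_trans.

Definition free_lie := {eq_quot lterm_eqb}.
HB.instance Definition _ := Choice.on free_lie.
HB.instance Definition _ := Quotient.on free_lie.

Definition free_pi (s : lterm) : free_lie := \pi s.

Lemma free_piP s t : free_pi s = free_pi t <-> lterm_eq s t.
Proof. by split=> [/eqmodP/asboolP | st] //; apply/eqmodP/asboolP. Qed.

Lemma free_repr (q : free_lie) : free_pi (repr q) = q.
Proof. exact: reprK. Qed.

Lemma free_ind (Q : free_lie -> Prop) :
  (forall s, Q (free_pi s)) -> forall q, Q q.
Proof. by move=> H q; rewrite -(free_repr q). Qed.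

Lemma repr_free_pi s : lterm_eq (repr (free_pi s)) s.
Proof. by apply/free_piP; rewrite free_repr. Qed.

Definition free_add (p q : free_lie) := free_pi (TAdd (repr p) (repr q)).
Definition free_scale (a : K) (p : free_lie) := free_pi (TScale a (repr p)).
Definition free_opp (p : free_lie) := free_scale (- 1) p.
Definition free_bracket (p q : free_lie) := free_pi (TLie (repr p) (repr q)).

Lemma free_addE s t : free_add (free_pi s) (free_pi t) = free_pi (TAdd s t).
Proof. by apply/free_piP; apply: lteq_add; apply: repr_free_pi. Qed.

Lemma free_scaleE a s : free_scale a (free_pi s) = free_pi (TScale a s).
Proof. by apply/free_piP; apply: lteq_scale; apply: repr_free_pi. Qed.

Lemma free_bracketE s t :
  free_bracket (free_pi s) (free_pi t) = free_pi (TLie s t).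
Proof. by apply/free_piP; apply: lteq_lie; apply: repr_free_pi. Qed.

Let freeE := (free_addE, free_scaleE, free_bracketE).

Fact free_addA : associative free_add.
Proof.
elim/free_ind=> s; elim/free_ind=> t; elim/free_ind=> u; rewrite !freeE.
exact/free_piP/lteq_addA.
Qed.

Fact free_addC : commutative free_add.
Proof.
by elim/free_ind=> s; elim/free_ind=> t; rewrite !freeE; apply/free_piP/lteq_addC.
Qed.

Fact free_add0 : left_id (free_pi TZero) free_add.
Proof. by elim/free_ind=> s; rewrite freeE; apply/free_piP/lteq_add0. Qed.

Fact free_addN : left_inverse (free_pi TZero) free_opp free_add.
Proof.
by elim/free_ind=> s; rewrite /free_opp !freeE; apply/free_piP/lteq_addN.
Qed.

HB.instance Definition _ :=
  GRing.isZmodule.Build free_lie free_addA free_addC free_add0 free_addN.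

Fact free_scaleA a b q : free_scale a (free_scale b q) = free_scale (a * b) q.
Proof. by elim/free_ind: q => s; rewrite !freeE; apply/free_piP/lteq_scaleA. Qed.

Fact free_scale1 : left_id 1 free_scale.
Proof. by elim/free_ind=> s; rewrite freeE; apply/free_piP/lteq_scale1. Qed.

Fact free_scaleDr : right_distributive free_scale +%R.
Proof.
move=> a; elim/free_ind=> s; elim/free_ind=> t.
by rewrite /GRing.add /= !freeE; apply/free_piP/lteq_scaleDr.
Qed.

Fact free_scaleDl q : {morph free_scale^~ q : a b / a + b}.
Proof.
move=> a b; elim/free_ind: q => s.
by rewrite [in RHS]/GRing.add /= !freeE; apply/free_piP/lteq_scaleDl.
Qed.

HB.instance Definition _ := GRing.Zmodule_isLmodule.Build K free_lie
  free_scaleA free_scale1 free_scaleDr free_scaleDl.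

Lemma free_piD s t : free_pi (TAdd s t) = free_pi s + free_pi t.
Proof. by rewrite -free_addE. Qed.

Lemma free_piZ a s : free_pi (TScale a s) = a *: free_pi s.
Proof. by rewrite -free_scaleE. Qed.

Lemma free_pi0 : free_pi TZero = 0.
Proof. by []. Qed.

Fact free_bracket_linearl a p q r :
  free_bracket (a *: p + q) r = a *: free_bracket p r + free_bracket q r.
Proof.
elim/free_ind: p => s; elim/free_ind: q => t; elim/free_ind: r => u.
transitivity (free_pi (TLie (TAdd (TScale a s) t) u)).
  by rewrite -free_bracketE free_piD free_piZ.
rewrite ((free_piP _ _).2 (lteq_lie_linearl _ _ _ _)).
by rewrite free_piD free_piZ -!free_bracketE.
Qed.

Fact free_bracket_linearr a p q r :
  free_bracket r (a *: p + q) = a *: free_bracket r p + free_bracket r q.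
Proof.
elim/free_ind: p => s; elim/free_ind: q => t; elim/free_ind: r => u.
transitivity (free_pi (TLie u (TAdd (TScale a s) t))).
  by rewrite -free_bracketE free_piD free_piZ.
rewrite ((free_piP _ _).2 (lteq_lie_linearr _ _ _ _)).
by rewrite free_piD free_piZ -!free_bracketE.
Qed.

Fact free_bracketxx q : free_bracket q q = 0.
Proof. by elim/free_ind: q => s; rewrite freeE; apply/free_piP/lteq_liexx. Qed.

Fact free_jacobi p q r :
  free_bracket p (free_bracket q r) + free_bracket q (free_bracket r p)
  + free_bracket r (free_bracket p q) = 0.
Proof.
elim/free_ind: p => s; elim/free_ind: q => t; elim/free_ind: r => u.
by rewrite !free_bracketE -!free_piD; apply/free_piP/lteq_jacobi.
Qed.

HB.instance Definition _ := Lmodule_isLie.Build K free_lie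
  free_bracket_linearl free_bracket_linearr free_bracketxx free_jacobi.

Lemma free_pi_lie s t : free_pi (TLie s t) = lie (free_pi s) (free_pi t).
Proof. by rewrite -free_bracketE. Qed.

Definition free_gen (x : P) : free_lie := free_pi (TGen x).

Section Lift.
Variables (K' : fieldType) (s : {rmorphism K -> K'}) (M : lieType K').
Variable g : P -> M.

Fixpoint lterm_eval (t : lterm) : M :=
  match t with
  | TGen x => g x
  | TZero => 0
  | TAdd t1 t2 => lterm_eval t1 + lterm_eval t2
  | TScale a t1 => s a *: lterm_eval t1
  | TLie t1 t2 => lie (lterm_eval t1) (lterm_eval t2)
  end.

Lemma lterm_eval_eq t u : lterm_eq t u -> lterm_eval t = lterm_eval u.
Proof.
elim=> //= [t1 t2 u1 _ -> _ -> | t1 t2 u1 u2 _ -> _ -> | a t1 t2 _ ->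
  | t1 t2 u1 u2 _ -> _ -> | t1 t2 t3 | t1 t2 | t1 | t1 | a b t1 | t1
  | a t1 t2 | a b t1 | a t1 t2 t3 | a t1 t2 t3 | t1 | t1 t2 t3] //.
- by rewrite addrA.
- by rewrite addrC.
- by rewrite add0r.
- by rewrite rmorphN1 scaleN1r addNr.
- by rewrite scalerA rmorphM.
- by rewrite rmorph1 scale1r.
- by rewrite scalerDr.
- by rewrite rmorphD scalerDl.
- by rewrite lie_linearl.
- by rewrite lie_linearr.
- by rewrite liexx.
- by rewrite lie_jacobi.
Qed.

Definition free_lift (q : free_lie) : M := lterm_eval (repr q).

Lemma free_liftE t : free_lift (free_pi t) = lterm_eval t.
Proof. exact/lterm_eval_eq/repr_free_pi. Qed.

Lemma free_lift_gen x : free_lift (free_gen x) = g x.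
Proof. exact: free_liftE. Qed.

Lemma free_lift_linear a p q :
  free_lift (a *: p + q) = s a *: free_lift p + free_lift q.
Proof.
elim/free_ind: p => t; elim/free_ind: q => u.
by rewrite -free_piZ -free_piD !free_liftE.
Qed.

Lemma free_lift_lie p q : free_lift (lie p q) = lie (free_lift p) (free_lift q).
Proof.
by elim/free_ind: p => t; elim/free_ind: q => u; rewrite -free_pi_lie !free_liftE.
Qed.

Lemma free_lift_ideal (G : free_lie -> Prop) :
  (forall q, G q -> free_lift q = 0) ->
  forall q, ideal_gen G q -> free_lift q = 0.
Proof.
move=> G0 q; elim=> {q} [q /G0 // | | a p q _ p0 _ q0 | p q _ q0].
- by rewrite -free_pi0 free_liftE.
- by rewrite free_lift_linear p0 q0 scaler0 addr0.
- by rewrite free_lift_lie q0 lie0r.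
Qed.

End Lift.
End Free.

Section Families.
Variables (K : fieldType) (V : lmodType K) (n : nat) (b : 'I_n -> V).

Definition spanned (v : V) : Prop := exists c : 'I_n -> K, v = \sum_i c i *: b i.

Definition lin_indep : Prop :=
  forall c : 'I_n -> K, \sum_i c i *: b i = 0 -> forall i, c i = 0.

End Families.

Definition has_dim (K : fieldType) (V : lmodType K) (n : nat) : Prop :=
  exists b : 'I_n -> V, lin_indep b /\ forall v, spanned b v.

Section Graph.
Variables (P : finType) (adj : rel P).

Section OverField.
Variable K : fieldType.

Inductive nonedge_rel : free_lie K P -> Prop :=
| NonedgeRel x y of ~~ adj x y : nonedge_rel (lie (free_gen K x) (free_gen K y)).

Definition liF : lieType K := lie_quot nonedge_rel.

Definition gen (x : P) : liF := quot_pi nonedge_rel (free_gen K x).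

Definition point := P -> {scalar liF}.

Definition point0 : point := fun=> \0.

Inductive extremal_rel (f : point) : liF -> Prop :=
| ExtremalRel x y :
    extremal_rel f (lie (gen x) (lie (gen x) y) - f x y *: gen x).

Definition idealI (f : point) : liF -> Prop := ideal_gen (extremal_rel f).

Definition liL (f : point) : lieType K := lie_quot (extremal_rel f).

(* dim L(f) = dim L(0), this dimension being finite. *)
Definition inX (f : point) : Prop :=
  exists n, has_dim (liL point0) n /\ has_dim (liL f) n.

(* [homogeneous d] is the component of degree [d] of F. *)
Inductive homogeneous : nat -> liF -> Prop :=
| homog_gen x : homogeneous 1 (gen x)
| homog_lie d e y z of homogeneous d y & homogeneous e z : homogeneous (d + e) (lie y z)
| homog0 d : homogeneous d 0
| homog_linear d a y z of homogeneous d y & homogeneous d z : homogeneous d (a *: y + z).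

Definition homogeneous_sub (U : liF -> Prop) : Prop :=
  forall y, U y -> exists n (z : nat -> liF),
    (forall d, homogeneous d (z d) /\ U (z d)) /\ y = \sum_(d < n) z d.

(* [u] is a basis of a graded finite-dimensional subspace U with U + I(0) = F. *)
Definition admissible (m : nat) (u : 'I_m -> liF) : Prop :=
  [/\ lin_indep u, homogeneous_sub (spanned u)
    & forall y, exists v z, [/\ spanned u v, idealI point0 z & y = v + z]].

End OverField.

Section MapF.
Variables (K K' : fieldType) (s : {rmorphism K -> K'}) (M : lieType K').
Variable g : P -> M.
Hypothesis g_comm : forall x y, ~~ adj x y -> lie (g x) (g y) = 0.

Definition liF_lift (y : liF K) : M := free_lift s g (repr y).

Lemma liF_liftE (y : free_lie K P) :
  liF_lift (quot_pi (nonedge_rel (K:=K)) y) = free_lift s g y.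
Proof.
have := repr_quot_pi (nonedge_rel (K:=K)) y; rewrite /liF_lift.
set z := repr _ => /(free_lift_ideal (s := s) (g := g)) zy0.
rewrite -[z](subrK y) -[z - y]scale1r free_lift_linear zy0 ?scaler0 ?add0r //.
by move=> _ [a b nab]; rewrite free_lift_lie !free_lift_gen g_comm.
Qed.

Lemma liF_lift_gen x : liF_lift (gen K x) = g x.
Proof. by rewrite liF_liftE free_lift_gen. Qed.

Lemma liF_lift_linear a y z :
  liF_lift (a *: y + z) = s a *: liF_lift y + liF_lift z.
Proof.
elim/quot_ind: y => y; elim/quot_ind: z => z.
by rewrite -linearP !liF_liftE free_lift_linear.
Qed.

Lemma liF_lift_lie y z : liF_lift (lie y z) = lie (liF_lift y) (liF_lift z).
Proof.
elim/quot_ind: y => y; elim/quot_ind: z => z.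
by rewrite -quot_pi_lie !liF_liftE free_lift_lie.
Qed.

End MapF.

Lemma gen_comm (K : fieldType) (x y : P) :
  ~~ adj x y -> lie (gen K x) (gen K y) = 0.
Proof.
move=> nxy; rewrite /gen -quot_pi_lie -(linear0 (quot_pi _)).
by apply/quot_piP; rewrite subr0; apply: ideal_gen_incl.
Qed.

(* The semilinear map from F over [K] to F over [K'] that fixes the generators. *)
Definition liF_ext (K K' : fieldType) (s : {rmorphism K -> K'}) :
  liF K -> liF K' := liF_lift s (gen K').

Lemma liF_ext_gen (K K' : fieldType) (s : {rmorphism K -> K'}) x :
  liF_ext s (gen K x) = gen K' x.
Proof. by apply: liF_lift_gen; apply: gen_comm. Qed.

Lemma liF_ext_linear (K K' : fieldType) (s : {rmorphism K -> K'}) a y z :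
  liF_ext s (a *: y + z) = s a *: liF_ext s y + liF_ext s z.
Proof. by apply: liF_lift_linear; apply: gen_comm. Qed.

Lemma liF_ext_lie (K K' : fieldType) (s : {rmorphism K -> K'}) y z :
  liF_ext s (lie y z) = lie (liF_ext s y) (liF_ext s z).
Proof. by apply: liF_lift_lie; apply: gen_comm. Qed.

Section Torus.
Variable K : fieldType.

Definition in_torus (t : P -> K) : Prop := forall x, t x != 0.

Definition torus_inv (t : P -> K) : P -> K := fun x => (t x)^-1.

Definition torusF (t : P -> K) : liF K -> liF K :=
  liF_lift idfun (fun x => t x *: gen K x).

Lemma torusF_comm t x y :
  ~~ adj x y -> lie (t x *: gen K x) (t y *: gen K y) = 0.
Proof. by move=> nxy; rewrite lieZl lieZr gen_comm // !scaler0. Qed.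

Lemma torusF_gen t x : torusF t (gen K x) = t x *: gen K x.
Proof. by apply: liF_lift_gen; apply: torusF_comm. Qed.

Fact torusF_linear t : linear (torusF t).
Proof. by move=> a y z; apply: liF_lift_linear; apply: torusF_comm. Qed.

HB.instance Definition _ t :=
  GRing.isLinear.Build K (liF K) (liF K) _ (torusF t) (torusF_linear t).

Lemma torusF_lie t y z : torusF t (lie y z) = lie (torusF t y) (torusF t z).
Proof. by apply: liF_lift_lie; apply: torusF_comm. Qed.

Definition torus_fun (t : P -> K) (f : point K) (x : P) (y : liF K) : K :=
  (t x)^-1 * f x (torusF (torus_inv t) y).

Fact torus_fun_scalar t f x : scalar (torus_fun t f x).
Proof. by move=> a y z; rewrite /torus_fun !linearP /= mulrDr mulrCA. Qed.

HB.instance Definition _ t f x :=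
  GRing.isLinear.Build K (liF K) K _ (torus_fun t f x) (torus_fun_scalar t f x).

Definition torusX (t : P -> K) (f : point K) : point K := torus_fun t f.

Definition character (t : P -> K) (mu : {ffun P -> int}) : K :=
  \prod_x t x ^ mu x.

End Torus.

Definition is_edge (e : {set P}) : bool :=
  [exists x, exists y, adj x y && (e == [set x; y])].

Definition edge : finType := {e : {set P} | is_edge e}.

Definition alpha (x : P) : {ffun P -> int} := [ffun y => (y == x)%:R].

Definition alpha_edge (e : edge) : {ffun P -> int} := \sum_(x in val e) alpha x.

Definition torusV (K : fieldType) (t : P -> K) (v : edge -> K) : edge -> K :=
  fun e => character t (- alpha_edge e) * v e.

Definition in_open_torus (K : fieldType) (v : edge -> K) : Prop :=
  forall e, v e != 0.

Definition poly_eval (K K' : fieldType) (s : {rmorphism K -> K'}) (I : finType)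
    (p : {mpoly K[#|I|]}) (v : I -> K') : K' :=
  (map_mpoly s p).@[fun k => v (enum_val k)].

(* For f over [K'], the coordinates of the functionals f_x restricted to the
   span of [u] with scalars extended to [K']. *)
Definition restr (K K' : fieldType) (s : {rmorphism K -> K'}) (m : nat)
    (u : 'I_m -> liF K) (f : point K') : P * 'I_m -> K' :=
  fun xi => f xi.1 (liF_ext s (u xi.2)).

(* Maps X(K') -> V(K') for all extensions K' of K; only the values on points of
   X(K') matter below. *)
Definition map_family (K : fieldType) :=
  forall K' : fieldType, {rmorphism K -> K'} -> point K' -> edge -> K'.

(* A variety over K is handled through its points over all extensions K' of K, as
   K-points alone do not see morphisms when K is finite; the polynomials have
   coefficients in K and do not depend on K'. X carries the structure of its
   image under [restr s u], for any admissible [u]. The first clause is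
   bijectivity, the second regularity of the map, the third regularity of its
   inverse. *)
Definition variety_iso (K : fieldType) (phi : map_family K) : Prop :=
  [/\ forall (K' : fieldType) (s : {rmorphism K -> K'}),
        (forall f g, inX f -> inX g -> phi K' s f =1 phi K' s g ->
           forall x, f x =1 g x)
        /\ (forall v : edge -> K', exists2 f, inX f & phi K' s f =1 v),
      forall (m : nat) (u : 'I_m -> liF K), admissible u ->
        exists p : edge -> {mpoly K[#|{: P * 'I_m}|]},
        forall (K' : fieldType) (s : {rmorphism K -> K'}) f, inX f ->
        forall e, phi K' s f e = poly_eval s (p e) (restr s u f)
    & forall (m : nat) (u : 'I_m -> liF K), admissible u ->
        exists q : P * 'I_m -> {mpoly K[#|edge|]},
        forall (K' : fieldType) (s : {rmorphism K -> K'}) f, inX f ->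
        forall xi, restr s u f xi = poly_eval s (q xi) (phi K' s f)].

Definition torus_equivariant (K : fieldType) (phi : map_family K) : Prop :=
  forall (K' : fieldType) (s : {rmorphism K -> K'}) t f,
    in_torus t -> inX f ->
    inX (torusX t f) /\ phi K' s (torusX t f) =1 torusV t (phi K' s f).

Definition open_torus_is_orbit (K : fieldType) : Prop :=
  forall (K' : fieldType) (s : {rmorphism K -> K'}) (v w : edge -> K'),
    in_open_torus v ->
    (in_open_torus w <-> exists2 t, in_torus t & w =1 torusV t v).

Definition open_torus_dense (K : fieldType) : Prop :=
  forall p : {mpoly K[#|edge|]},
    (forall (K' : fieldType) (s : {rmorphism K -> K'}) (v : edge -> K'),
       in_open_torus v -> poly_eval s p v = 0) ->
    p = 0.

End Graph.

Inductive dynkin := DynA of nat | DynD of nat | DynE of nat.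

Definition dynkin_valid (D : dynkin) : bool :=
  match D with
  | DynA n => (2 <= n)%N
  | DynD n => (4 <= n)%N
  | DynE n => (6 <= n <= 8)%N
  end.

Definition dynkin_rank (D : dynkin) : nat :=
  match D with DynA n | DynD n | DynE n => n end.

(* Vertices below [l] form a chain; vertices from [l] on are joined to [b]. *)
Definition chain_with_branch (l b i j : nat) : bool :=
  let e i j := ((j == i.+1) && (j < l) || (i == b) && (l <= j))%N in
  e i j || e j i.

Definition dynkin_adj (D : dynkin) (i j : nat) : bool :=
  match D with
  | DynA n => chain_with_branch n 0 i j
  | DynD n => chain_with_branch n.-1 (n - 3) i j
  | DynE n => chain_with_branch n.-1 2 i j
  end.

Definition simply_laced_finite (P : finType) (adj : rel P) : Prop :=
  exists D, dynkin_valid D /\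
  exists2 h : P -> 'I_(dynkin_rank D),
    bijective h & forall x y, adj x y = dynkin_adj D (h x) (h y).

(* Main.v *)
From HB Require Import structures.
Require Import Defs.
From mathcomp Require Import mpoly.
From mathcomp Require Import all_boot all_order all_algebra.
From mathcomp Require Import boolp.
From mathcomp Require Import zify ring lra.

(** A point of X is determined by its edge values f_x(y), one for each edge {x,y},
    and every vector of edge values occurs. T acts on the edge value of e with
    weight -alpha_e, so X is K^Sigma as a T-variety. The diagram is a tree, hence T
    is transitive on vectors of nonzero edge values, and L(f) does not change
    along an orbit up to isomorphism.

    Upper bound and uniqueness. For each positive root b there is a Lie monomial
    of weight b in the generators. By the identities of Premet for extremal
    elements, which require 2 to be invertible, bracketing such a monomial with a
    generator gives a combination of root monomials of no larger degree whenever
    the sum of the two weights is not a root ([drops_step]). Hence the root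
    monomials span L(f) for every f ([liL_span]). If the dimension is the number
    of positive roots, the generators and the brackets along edges do not vanish,
    and the functionals f_x behave like an invariant symmetric bilinear form
    ([full_dim_form_like]). For two such points with the same edge values, an
    induction on the degree in the quotient of F by the intersection of the two
    ideals shows that they coincide ([form_like_unique]).

    Existence. Colour the vertices by the parity of the distance to the branch
    vertex. In the Chevalley algebra of the diagram keep the simple root vector
    e_a at each coloured vertex a, and at each uncoloured vertex i replace e_i by
    its conjugate under the exponentials of multiples of e_-(a+i), where a runs
    through the at most two neighbours of i. Conjugates of root vectors are
    extremal ([model_extremal]), nonadjacent generators still commute
    ([model_comm]), and the parameters are arbitrary edge values
    ([model_form_edge]). The leading terms for the height filtration are
    those of the monomials in the e_i, so the root monomials stay independent
    ([model_indep]), and L(f) has the full dimension. This also gives the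
    dimension of L(0), because the undeformed point is the zero point by
    uniqueness.

    Everything in this construction is polynomial in the edge values with
    coefficients in K, which gives the regularity of the inverse
    ([polynomial_model_point]). In the other direction an edge value is a linear
    coordinate, because the generators lie in every admissible subspace
    ([admissible_gen]). *)

Set Implicit Arguments.
Unset Strict Implicit.
Unset Printing Implicit Defensive.

Import Order.TTheory GRing.Theory Num.Theory.
Local Open Scope ring_scope.

(** * Dimension *)

Section LinearAlgebra.
Variables (K : fieldType) (V : lmodType K).

Lemma spanned_comb n (b : 'I_n -> V) m (a : 'I_m -> V) :
  (forall i, spanned b (a i)) ->
  exists C : 'M[K]_(m, n), forall c : 'rV[K]_m,
    \sum_i c 0 i *: a i = \sum_j (c *m C) 0 j *: b j.
Proof.
move=> /choice[C aC]; exists (\matrix_(i, j) C i j) => c.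
under eq_bigr do rewrite aC scaler_sumr.
rewrite exchange_big; apply: eq_bigr => j _.
by rewrite mxE scaler_suml; apply: eq_bigr => i _; rewrite mxE scalerA.
Qed.

Lemma indep_leq_span n (b : 'I_n -> V) m (a : 'I_m -> V) :
  lin_indep a -> (forall i, spanned b (a i)) -> (m <= n)%N.
Proof.
move=> a_indep /spanned_comb[C aC]; apply: contraT; rewrite -ltnNge => lt_nm.
have rkC : (0 < \rank (kermx C))%N.
  by rewrite mxrank_ker subn_gt0 (leq_ltn_trans (rank_leq_col C)).
move: rkC; rewrite lt0n mxrank_eq0 => /rowV0Pn[c /sub_kermxP cC0 /eqP[]].
apply/rowP => i; rewrite [RHS]mxE; apply: a_indep.
by rewrite aC cC0 big1 // => j _; rewrite mxE scale0r.
Qed.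

Lemma has_dim_uniq m n : has_dim V m -> has_dim V n -> m = n.
Proof.
move=> [a [a_indep a_span]] [b [b_indep b_span]]; apply/eqP.
by rewrite eqn_leq (indep_leq_span a_indep (fun i => b_span (a i)))
  (indep_leq_span b_indep (fun i => a_span (b i))).
Qed.

(** The coefficient matrices that express a basis by the family and the family by
    the basis are square, so a one-sided inverse is two-sided. *)
Lemma span_has_dim_indep n (b : 'I_n -> V) :
  has_dim V n -> (forall v, spanned b v) -> lin_indep b.
Proof.
move=> [a [a_indep a_span]] b_span c bc0.
have [C aC] := spanned_comb (fun i => b_span (a i)).
have [D bD] := spanned_comb (fun i => a_span (b i)).
have : (\row_i c i) *m D = 0.
  apply/rowP => i; rewrite [RHS]mxE; apply: (a_indep (fun i => _ 0 i)).
  by rewrite -bD -[RHS]bc0; apply: eq_bigr => j _; rewrite mxE.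
have CD1 : C *m D = 1%:M.
  apply/row_matrixP => i; apply/rowP => j; rewrite !rowE.
  pose e := delta_mx 0 i *m (C *m D) - delta_mx 0 i *m 1%:M : 'rV[K]_n.
  suff: e 0 j = 0 by rewrite mxE [X in _ + X]mxE => /eqP; rewrite subr_eq0 => /eqP.
  apply: (a_indep (fun j => e 0 j)).
  under eq_bigr do rewrite mxE [X in _ + X]mxE scalerBl.
  by rewrite sumrB /= mulmxA -bD -aC mulmx1 subrr.
move=> cD0 i; have := congr1 (fun M => (M *m C) 0 i) cD0.
by rewrite -mulmxA (mulmx1C CD1) mulmx1 mul0mx !mxE.
Qed.

End LinearAlgebra.

Lemma has_dim_bij (K : fieldType) (V W : lmodType K) (h : {linear V -> W}) n :
  bijective h -> has_dim V n -> has_dim W n.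
Proof.
move=> [g hK gK] [b [b_indep b_span]]; exists (h \o b); split=> [c|w].
  move=> hc0; apply: b_indep; apply: (can_inj hK).
  by rewrite linear_sum linear0 -[RHS]hc0; apply: eq_bigr => i _; rewrite linearZ.
have [c gw] := b_span (g w); exists c.
by rewrite -[LHS]gK gw linear_sum; apply: eq_bigr => i _; rewrite linearZ.
Qed.

(** * Deciding linear identities *)

Section LinearExpressions.
Variables (K : fieldType) (V : lmodType K).

Inductive lexp :=
| LAtom of nat
| LZero
| LAdd of lexp & lexp
| LOpp of lexp
| LScale of K & lexp
| LMuln of lexp & nat.

Fixpoint leval (env : seq V) (e : lexp) : V :=
  match e with
  | LAtom n => nth 0 env n
  | LZero => 0
  | LAdd e1 e2 => leval env e1 + leval env e2
  | LOpp e1 => - leval env e1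
  | LScale c e1 => c *: leval env e1
  | LMuln e1 n => leval env e1 *+ n
  end.

Fixpoint lcoef (e : lexp) (i : nat) : K :=
  match e with
  | LAtom n => if i == n then 1 else 0
  | LZero => 0
  | LAdd e1 e2 => lcoef e1 i + lcoef e2 i
  | LOpp e1 => - lcoef e1 i
  | LScale c e1 => c * lcoef e1 i
  | LMuln e1 n => lcoef e1 i *+ n
  end.

Lemma levalE env e :
  leval env e = \sum_(i < size env) lcoef e i *: nth 0 env i.
Proof.
elim: e => /= [n||e1 -> e2 ->|e1 ->|c e1 ->|e1 -> n].
- have [lt_n|ge_n] := ltnP n (size env).
    rewrite (bigD1 (Ordinal lt_n)) //= eqxx scale1r big1 ?addr0 // => i ne_in.
    by rewrite -val_eqE /= in ne_in; rewrite (negPf ne_in) scale0r.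
  rewrite nth_default // big1 // => i _.
  by rewrite ltn_eqF ?scale0r // (leq_trans (ltn_ord i)).
- by rewrite big1 // => i _; rewrite scale0r.
- by rewrite -big_split; apply: eq_bigr => i _; rewrite scalerDl.
- by rewrite -sumrN; apply: eq_bigr => i _; rewrite scaleNr.
- by rewrite scaler_sumr; apply: eq_bigr => i _; rewrite scalerA.
- by rewrite -sumrMnl; apply: eq_bigr => i _; rewrite scalerMnl.
Qed.

Fixpoint lcoef_agree (e1 e2 : lexp) (k : nat) : Prop :=
  if k is k'.+1 then lcoef e1 k' = lcoef e2 k' /\ lcoef_agree e1 e2 k' else True.

Lemma leval_agree env e1 e2 :
  lcoef_agree e1 e2 (size env) -> leval env e1 = leval env e2.
Proof.
rewrite !levalE => eq12; apply: eq_bigr => i _; congr (_ *: _).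
elim: (size env) (nat_of_ord i) (ltn_ord i) eq12 => //= n IHn j.
by rewrite ltnS leq_eqVlt => /predU1P[-> | /IHn IH] [].
Qed.

End LinearExpressions.

Ltac lmod_insert a l :=
  lazymatch l with
  | nil => constr:(cons a nil)
  | cons a _ => l
  | cons ?b ?t => let t' := lmod_insert a t in constr:(cons b t')
  end.

Ltac lmod_atoms e l :=
  lazymatch e with
  | (?a + ?b)%R => let l' := lmod_atoms a l in lmod_atoms b l'
  | (- ?a)%R => lmod_atoms a l
  | (_ *: ?a)%R => lmod_atoms a l
  | (?a *+ _)%R => lmod_atoms a l
  | 0%R => l
  | _ => lmod_insert e l
  end.

Ltac lmod_index a l :=
  lazymatch l with
  | cons a _ => constr:(0%N)
  | cons _ ?t => let n := lmod_index a t in constr:(S n)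
  end.

Ltac lmod_reify K e l :=
  lazymatch e with
  | (?a + ?b)%R =>
    let a' := lmod_reify K a l in let b' := lmod_reify K b l in
    constr:(LAdd a' b')
  | (- ?a)%R => let a' := lmod_reify K a l in constr:(LOpp a')
  | (?c *: ?a)%R => let a' := lmod_reify K a l in constr:(@LScale K c a')
  | (?a *+ ?n)%R => let a' := lmod_reify K a l in constr:(LMuln a' n)
  | 0%R => constr:(LZero K)
  | _ => let n := lmod_index e l in constr:(LAtom K n)
  end.

(** Proves an equation between linear combinations by comparing coefficients
    with [ring]; vectors that are not sums, opposites or multiples are atoms. *)
Ltac lmod_over K :=
  lazymatch goal with
  | |- @eq ?T ?a ?b =>
    let l1 := lmod_atoms a (@nil T) in let l := lmod_atoms b l1 in
    let a' := lmod_reify K a l in let b' := lmod_reify K b l in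
    refine (@leval_agree K _ l a' b' _);
    cbn [size lcoef_agree lcoef];
    repeat (split; first try (simpl; ring)); try exact I
  end.

(** * Extremal elements *)

Section LieIdentities.
Variables (K : fieldType) (L : lieType K).
Implicit Types x y z : L.

Lemma lie_leibniz x y z : lie x (lie y z) = lie (lie x y) z + lie y (lie x z).
Proof.
apply/eqP; rewrite -subr_eq0; apply/eqP; rewrite -(lie_jacobi x y z).
by rewrite (lieC (lie x y)) (lieC x z) lieNr; lmod_over K.
Qed.

Lemma lie_comm x y z : lie x y = 0 -> lie x (lie y z) = lie y (lie x z).
Proof. by move=> xy0; rewrite lie_leibniz xy0 lie0l add0r. Qed.

(** The two identities of Premet: apply ad x twice to [y,z] by the Leibniz rule
    and replace each ad x ad x w by a multiple of x. They are stated with the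
    scalars of y, z and [y,z] only, because in the inductions below x is known to
    be extremal on just part of the algebra. *)
Section Premet.
Variables (x y z : L) (a b c : K).
Hypotheses (xxy : lie x (lie x y) = a *: x) (xxz : lie x (lie x z) = b *: x).
Hypothesis xxyz : lie x (lie x (lie y z)) = c *: x.

Lemma premet_bracket :
  2%:R *: lie (lie x y) (lie x z) = c *: x + b *: lie x y - a *: lie x z.
Proof.
rewrite -xxyz (lie_leibniz x y z) lieDr (lie_leibniz x (lie x y)) xxy.
rewrite (lie_leibniz x y (lie x z)) xxz.
by rewrite lieZl lieZr (lieC y x); lmod_over K.
Qed.

Lemma premet_nested :
  2%:R *: lie x (lie y (lie x z)) = c *: x - b *: lie x y - a *: lie x z.
Proof.
rewrite (lie_leibniz x y (lie x z)) xxz scalerDr premet_bracket lieZr (lieC y x).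
by lmod_over K.
Qed.

End Premet.
End LieIdentities.

(** * Root lattice of a bipartite graph *)

(** Orienting the edges out of the coloured vertices makes the Tits form bilinear
    without dividing by two. The symmetrized form is the Cartan pairing, and the
    parity of this form gives the signs in the Chevalley algebra. *)
Definition euler_form (P : finType) (adj : rel P) (col : pred P)
    (b c : {ffun P -> int}) : int :=
  \sum_x b x * c x - \sum_x \sum_(y | adj x y && col x) b x * c y.

(** The properties of a finite type diagram on which everything rests. The colour
    classes have different roles: generators at coloured vertices are left alone
    and those at uncoloured vertices are deformed, and the deformed ones commute
    as they should only if no uncoloured vertex is a branch vertex. *)
Record rootData (P : finType) (adj : rel P) := RootData {
  colored : pred P;
  adjC : symmetric adj;
  adj_col : forall x y, adj x y -> colored x != colored y;
  posdef : forall b, b != 0 -> 0 < euler_form adj colored b b;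
  uncolored_deg : forall x, ~~ colored x -> (#|[pred y | adj y x]| <= 2)%N
}.

Section RootLattice.
Variables (P : finType) (adj : rel P) (R : rootData adj).
Notation Q := {ffun P -> int}.
Notation col := (colored R).
Implicit Types (b c d : Q) (i j x y : P).

Definition euler b c : int := euler_form adj col b c.

Definition pairing b c : int := euler b c + euler c b.

Definition height b : int := \sum_x b x.

Definition is_root b : bool := euler b b == 1.

Definition posroot b : bool := is_root b && [forall x, 0 <= b x].

Lemma eulerDl b c d : euler (b + c) d = euler b d + euler c d.
Proof.
rewrite /euler /euler_form addrACA -opprD -!big_split; congr (_ - _).
  by apply: eq_bigr => x _; rewrite ffunE mulrDl.
apply: eq_bigr => x _; rewrite -big_split.
by apply: eq_bigr => y _; rewrite ffunE mulrDl.
Qed.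

Lemma eulerDr b c d : euler d (b + c) = euler d b + euler d c.
Proof.
rewrite /euler /euler_form addrACA -opprD -!big_split; congr (_ - _).
  by apply: eq_bigr => x _; rewrite ffunE mulrDr.
apply: eq_bigr => x _; rewrite -big_split.
by apply: eq_bigr => y _; rewrite ffunE mulrDr.
Qed.

Lemma euler0l b : euler 0 b = 0.
Proof. by apply: (addrI (euler 0 b)); rewrite -eulerDl !addr0. Qed.

Lemma euler0r b : euler b 0 = 0.
Proof. by apply: (addrI (euler b 0)); rewrite -eulerDr !addr0. Qed.

Lemma eulerNl b c : euler (- b) c = - euler b c.
Proof. by apply/eqP; rewrite -addr_eq0 -eulerDl addNr euler0l. Qed.

Lemma eulerNr b c : euler c (- b) = - euler c b.
Proof. by apply/eqP; rewrite -addr_eq0 -eulerDr addNr euler0r. Qed.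

Definition eulerE := (eulerDl, eulerDr, eulerNl, eulerNr).

Lemma pairingC b c : pairing b c = pairing c b.
Proof. exact: addrC. Qed.

Lemma pairingDl b c d : pairing (b + c) d = pairing b d + pairing c d.
Proof. by rewrite /pairing !eulerE; ring. Qed.

Lemma pairingDr b c d : pairing d (b + c) = pairing d b + pairing d c.
Proof. by rewrite /pairing !eulerE; ring. Qed.

Lemma pairingNl b c : pairing (- b) c = - pairing b c.
Proof. by rewrite /pairing !eulerE; ring. Qed.

Lemma pairingNr b c : pairing c (- b) = - pairing c b.
Proof. by rewrite /pairing !eulerE; ring. Qed.

Lemma pairingbb b : pairing b b = euler b b *+ 2.
Proof. by rewrite mulr2n. Qed.

Lemma eulerD_diag b c : euler (b + c) (b + c) = euler b b + euler c c + pairing b c.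
Proof. by rewrite /pairing !eulerE; ring. Qed.

Lemma eulerB_diag b c : euler (b - c) (b - c) = euler b b + euler c c - pairing b c.
Proof. by rewrite /pairing !eulerE; ring. Qed.

Lemma heightD b c : height (b + c) = height b + height c.
Proof. by rewrite /height -big_split; apply: eq_bigr => x _; rewrite ffunE. Qed.

Lemma heightN b : height (- b) = - height b.
Proof. by rewrite /height -sumrN; apply: eq_bigr => x _; rewrite ffunE. Qed.

Lemma height_alpha i : height (alpha i) = 1.
Proof.
rewrite /height (bigD1 i) //= ffunE eqxx big1 ?addr0 // => x ne_xi.
by rewrite ffunE (negPf ne_xi).
Qed.

Lemma euler_alpha i j :
  euler (alpha i) (alpha j) = (i == j)%:R - (adj i j && col i)%:R.
Proof.
rewrite /euler /euler_form; congr (_ - _).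
  rewrite (bigD1 i) //= !ffunE eqxx mul1r big1 ?addr0 // => x ne_xi.
  by rewrite !ffunE (negPf ne_xi) mul0r.
rewrite (bigD1 i) //= [X in _ + X]big1 ?addr0 => [|x ne_xi]; last first.
  by rewrite big1 // => y _; rewrite !ffunE (negPf ne_xi) mul0r.
have [aij|naij] := boolP (adj i j && col i).
  rewrite (bigD1 j) //= !ffunE !eqxx big1 ?addr0 // => y /andP[_ ne_yj].
  by rewrite !ffunE (negPf ne_yj) mulr0.
rewrite big1 // => y ay; rewrite !ffunE.
by have [eq_yj|] := eqVneq y j; [rewrite -eq_yj ay in naij | rewrite mulr0].
Qed.

Lemma adj_irr x : adj x x = false.
Proof. by apply/negP => /(adj_col R); rewrite eqxx. Qed.

Lemma pairing_sum b c :
  pairing b c = \sum_y c y * (b y *+ 2 - \sum_(x | adj x y) b x).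
Proof.
under [RHS]eq_bigr do rewrite mulrBr.
rewrite sumrB /pairing /euler /euler_form addrACA -opprD; congr (_ - _).
  by rewrite -big_split; apply: eq_bigr => y _; rewrite mulr2n mulrDr mulrC.
under [RHS]eq_bigr do rewrite (bigID col) /= mulrDr.
rewrite big_split; congr (_ + _).
  rewrite (exchange_big_dep predT) //=; apply: eq_bigr => y _; rewrite mulr_sumr.
  by apply: eq_bigr => x _; rewrite mulrC.
apply: eq_bigr => y _; rewrite mulr_sumr; apply: eq_bigl => x.
have [ayx|] := boolP (adj y x); last by rewrite (adjC R) => /negPf->.
by rewrite (adjC R) ayx /=; move/(adj_col R): ayx; case: (col x) (col y) => [] [].
Qed.

Lemma pairing_alpha b j :
  pairing b (alpha j) = b j *+ 2 - \sum_(x | adj x j) b x.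
Proof.
rewrite pairing_sum (bigD1 j) //= ffunE eqxx mul1r [X in _ + X]big1 ?addr0 // => x ne_xj.
by rewrite ffunE (negPf ne_xj) mul0r.
Qed.

Lemma pairing_expand b c : pairing b c = \sum_y c y * pairing b (alpha y).
Proof. by rewrite pairing_sum; under [RHS]eq_bigr do rewrite pairing_alpha. Qed.

Lemma pairing_alphas i j :
  pairing (alpha i) (alpha j) = (i == j)%:R *+ 2 - (adj i j)%:R.
Proof.
rewrite /pairing !euler_alpha (eq_sym j) (adjC R j).
have [/(adj_col R)|_] := boolP (adj i j); last by rewrite !subr0.
by case: (eqVneq i j) => [->|_]; [rewrite eqxx | case: (col i) (col j) => [] []].
Qed.

Lemma euler_ge0 b : 0 <= euler b b.
Proof. by have [->|/(posdef R)/ltW//] := eqVneq b 0; rewrite euler0l. Qed.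

Lemma euler_eq0 b : (euler b b == 0) = (b == 0).
Proof.
have [->|/(posdef R)] := eqVneq b 0; first by rewrite euler0l eqxx.
by case: ltgtP.
Qed.

Lemma is_root_alpha i : is_root (alpha i).
Proof. by rewrite /is_root euler_alpha eqxx adj_irr subr0. Qed.

Lemma is_rootN b : is_root (- b) = is_root b.
Proof. by rewrite /is_root !eulerE opprK. Qed.

Lemma root_neq0 b : is_root b -> b != 0.
Proof. by rewrite -euler_eq0 => /eqP->. Qed.

Lemma pairing_root b : is_root b -> pairing b b = 2.
Proof. by rewrite pairingbb => /eqP->. Qed.

(** Cauchy-Schwarz, read off from the norms of the sum and the difference. *)
Lemma pairing_rootsP b c : is_root b -> is_root c ->
  [/\ -2 <= pairing b c <= 2, (pairing b c == 2) = (b == c)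
    & (pairing b c == -2) = (b == - c)].
Proof.
move=> /eqP rb /eqP rc.
have := euler_ge0 (b - c); have := euler_ge0 (b + c).
have := euler_eq0 (b - c); have := euler_eq0 (b + c).
rewrite eulerB_diag eulerD_diag rb rc (subr_eq0 b) (addr_eq0 b) => <- <-.
move: (pairing b c) => p p1 p2; split; lia.
Qed.

Lemma is_rootD b c : is_root b -> is_root c ->
  is_root (b + c) = (pairing b c == -1).
Proof.
by move=> /eqP rb /eqP rc; rewrite /is_root eulerD_diag rb rc; lia.
Qed.

Lemma is_rootB b c : is_root b -> is_root c ->
  is_root (b - c) = (pairing b c == 1).
Proof.
by move=> /eqP rb /eqP rc; rewrite /is_root eulerB_diag rb rc; lia.
Qed.

Lemma posroot_root b : posroot b -> is_root b.
Proof. by case/andP. Qed.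

Lemma posroot_ge0 b x : posroot b -> 0 <= b x.
Proof. by case/andP => _ /forallP. Qed.

Lemma posroot_alpha i : posroot (alpha i).
Proof.
by rewrite /posroot is_root_alpha; apply/forallP => x; rewrite ffunE; case: eqP.
Qed.

Lemma alpha_inj : injective (@alpha P).
Proof. by move=> i j /ffunP/(_ i); rewrite !ffunE eqxx; case: eqP. Qed.

(** A coordinate of b that vanished at i would force the pairing with the simple
    root at i to be nonpositive, so b stays nonnegative. *)
Lemma posrootB b i : posroot b -> pairing b (alpha i) = 1 -> posroot (b - alpha i).
Proof.
move=> pb pbi; have rb := posroot_root pb.
rewrite /posroot is_rootB ?is_root_alpha // pbi eqxx /=.
apply/forallP => x; rewrite !ffunE; have := posroot_ge0 x pb.
have [->|_] := eqVneq x i; last by rewrite subr0.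
have : 0 <= \sum_(x | adj x i) b x by apply: sumr_ge0 => y _; apply: posroot_ge0.
rewrite pairing_alpha mulr2n in pbi; move: (\sum_(x | _) _) pbi => u.
by move: (b i) => v; rewrite /=; lia.
Qed.

Lemma posrootD b i :
  posroot b -> pairing b (alpha i) = -1 -> posroot (b + alpha i).
Proof.
move=> pb pbi; have rb := posroot_root pb.
rewrite /posroot is_rootD ?is_root_alpha // pbi eqxx /=.
apply/forallP => x; rewrite !ffunE; have := posroot_ge0 x pb.
by case: (x == i) => /= xge0; lia.
Qed.

Lemma height_gt0 b : posroot b -> 0 < height b.
Proof.
move=> pb; rewrite lt_def sumr_ge0 => [|x _]; last exact: posroot_ge0.
rewrite andbT; apply: contraNneq (root_neq0 (posroot_root pb)) => hb0.
apply/eqP/ffunP => x; rewrite [RHS]ffunE; apply/eqP.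
move/eqP: hb0; rewrite psumr_eq0 => [/allP/(_ x)/=|y _]; last exact: posroot_ge0.
by apply; apply: mem_index_enum.
Qed.

Lemma pairing_posrootP b i : posroot b -> b != alpha i ->
  -1 <= pairing b (alpha i) <= 1.
Proof.
move=> pb ne_bi.
have [/andP[ge le] eq2 eqN2] := pairing_rootsP (posroot_root pb) (is_root_alpha i).
have : pairing b (alpha i) != 2 by rewrite eq2.
have : pairing b (alpha i) != -2.
  rewrite eqN2; apply/eqP => bN.
  by have := height_gt0 pb; rewrite bN heightN height_alpha.
by move: ge le; lia.
Qed.

(** Otherwise b pairs nonpositively with all simple roots, hence with itself. *)
Lemma posroot_descent b : posroot b -> (forall i, b != alpha i) ->
  exists j, pairing b (alpha j) = 1.
Proof.
move=> pb nsb; apply: contrapT => none.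
have : pairing b b <= 0.
  rewrite pairing_expand -oppr_ge0 -sumrN; apply: sumr_ge0 => x _.
  rewrite -mulrN mulr_ge0 ?(posroot_ge0 x pb) //.
  have /andP[_] := pairing_posrootP pb (nsb x).
  rewrite le_eqVlt => /predU1P[p1|]; last by lia.
  by case: none; exists x.
by rewrite pairing_root ?posroot_root.
Qed.

Lemma height1 b : posroot b -> height b = 1 -> exists i, b = alpha i.
Proof.
move=> pb hb; apply: contrapT => nsb.
have [i|j /(posrootB pb)/height_gt0] := posroot_descent pb.
  by apply/eqP => ?; case: nsb; exists i.
by rewrite heightD heightN hb height_alpha.
Qed.

Lemma height_pos b : posroot b -> exists k, height b = k.+1%:Z.
Proof. by move/height_gt0; case: (height b) => // [] [|k] // _; exists k. Qed.

(** If two roots are congruent modulo 2, their half sum and half difference lie in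
    the lattice and have norms that add up to that of a single root, so one of
    the two is zero. Hence a root is determined up to sign modulo 2. *)
Lemma finite_roots : exists s : seq Q, forall b, (b \in s) = is_root b.
Proof.
pose parity b : {ffun P -> bool} := [ffun x => odd `|b x|%N].
have parity_inj b c : is_root b -> is_root c -> parity b = parity c ->
    b = c \/ b = - c.
  move=> /eqP rb /eqP rc /ffunP eq_par.
  have /choice[h hP] x : exists n : int, b x = n *+ 2 + c x.
    exists ((b x - c x) %/ 2)%Z; have := eq_par x; rewrite !ffunE; lia.
  pose d : Q := [ffun x => h x].
  have bE : b = d + d + c.
    by apply/ffunP => x; rewrite !ffunE hP mulr2n.
  have := euler_ge0 d; have := euler_ge0 (d + c).
  have : euler d d + euler (d + c) (d + c) = 1.
    by move: rb; rewrite bE !eulerE rc; lia.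
  have := euler_eq0 d; have := euler_eq0 (d + c).
  move: (euler d d) (euler (d + c) (d + c)) => u v v0 u0 uv vge uge.
  (* u + v = 1 with u and v nonnegative integers. *)
  have [/eqP|/eqP] : u == 0 \/ v == 0 by lia.
    by move/eqP; rewrite u0 => /eqP d0; left; rewrite bE d0 !add0r.
  move/eqP; rewrite v0 addr_eq0 => /eqP dN; right.
  by rewrite bE dN addrNK.
pose pick_root k : seq Q :=
  if pselect (exists b, is_root b /\ parity b = k) is left ex
  then [:: projT1 (cid ex); - projT1 (cid ex)] else [::].
exists (flatten [seq pick_root k | k <- enum {ffun P -> bool}]) => b.
apply/flatten_mapP/idP => [[k _]|rb].
  rewrite /pick_root; case: pselect => // ex; case: cid => c [rc _] /=.
  by rewrite !inE => /orP[] /eqP->; rewrite ?is_rootN.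
exists (parity b); first by rewrite mem_enum.
rewrite /pick_root; case: pselect => [ex|[]]; last by exists b.
case: cid => c [rc /esym/(parity_inj _ _ rb rc)] /=.
by rewrite !inE => -[] ->; rewrite eqxx ?orbT.
Qed.

Definition root_seq : seq Q := projT1 (cid finite_roots).

Lemma mem_root_seq b : (b \in root_seq) = is_root b.
Proof. exact: (projT2 (cid finite_roots)). Qed.

End RootLattice.

(** * Spanning by root monomials *)

Section RootMonomials.
Variables (P : finType) (adj : rel P) (R : rootData adj) (K : fieldType).
Notation Q := {ffun P -> int}.
Notation pairing := (pairing R).
Notation posroot := (posroot R).
Implicit Types (b c : Q) (i j : P) (k n : nat).

(** A Lie monomial of weight b for each positive root b, obtained by stripping
    simple roots; the recursion is on the height. The choice of simple root is
    immaterial up to a unit and lower terms, see [strips]. *)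
Fixpoint root_monomial_rec (A : lieType K) (x : P -> A) n b : A :=
  if n is n'.+1 then
    if [pick i | b == alpha i] is Some i then x i else
    if [pick j | pairing b (alpha j) == 1] is Some j
    then lie (x j) (root_monomial_rec x n' (b - alpha j)) else 0
  else 0.

Definition root_monomial (A : lieType K) (x : P -> A) b : A :=
  root_monomial_rec x `|height b|%N b.

Lemma root_monomial_alpha (A : lieType K) (x : P -> A) i :
  root_monomial x (alpha i) = x i.
Proof.
rewrite /root_monomial height_alpha /=.
by case: pickP => [j /eqP/alpha_inj-> | /(_ i)] //; rewrite eqxx.
Qed.

Lemma posroot_simpleP b : posroot b ->
  (exists i, b = alpha i) \/
  exists k j, [/\ pairing b (alpha j) = 1, posroot (b - alpha j),
    height b = k.+2%:Z, height (b - alpha j) = k.+1%:Z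
    & forall (A : lieType K) (x : P -> A),
      root_monomial x b = lie (x j) (root_monomial x (b - alpha j))].
Proof.
move=> pb; have [[i bi]|nsb] := pselect (exists i, b = alpha i).
  by left; exists i.
have nsb' i : b != alpha i by apply/eqP => bi; apply: nsb; exists i.
right; have [j0 pj0] := posroot_descent pb nsb'.
have [j pj] : {j | [pick j | pairing b (alpha j) == 1] = Some j}.
  by case: pickP => [j _ | /(_ j0)]; [exists j | rewrite pj0].
have pbj : pairing b (alpha j) = 1 by move: pj; case: pickP => // l /eqP ? [<-].
have pb' := posrootB pb pbj; have [k hk] := height_pos pb'.
have hb : height b = k.+2%:Z.
  by move: hk; rewrite heightD heightN height_alpha; lia.
exists k, j; split=> // A x; rewrite /root_monomial hb hk /= pj.
by case: pickP => // l; rewrite (negPf (nsb' l)).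
Qed.

Lemma pairing1_nonsimple b i j : pairing b (alpha i) = 1 -> b <> alpha j.
Proof.
move=> pb bj; move: pb; rewrite bj pairing_alphas.
by case: eqP => [->|_]; rewrite ?(adj_irr R) //; case: adj.
Qed.

Section Filtration.
Hypothesis char2 : (2%:R : K) != 0.
Variables (A : lieType K) (x : P -> A).
Hypothesis x_comm : forall i j, ~~ adj i j -> lie (x i) (x j) = 0.
Notation mon := (root_monomial x).

(** The span of the root monomials of height at most d. Once the generators are
    known to be extremal this is the image of the elements of degree at most d. *)
Inductive low (d : nat) : A -> Prop :=
| low0 : low d 0
| low_linear a y z of low d y & low d z : low d (a *: y + z)
| low_mon b of posroot b & height b <= d%:Z : low d (mon b).

Lemma lowZ d a y : low d y -> low d (a *: y).
Proof. by move=> ly; rewrite -[_ *: _]addr0; apply/low_linear/low0. Qed.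

Lemma lowD d y z : low d y -> low d z -> low d (y + z).
Proof. by move=> ly lz; rewrite -[y]scale1r; apply: low_linear. Qed.

Lemma lowN d y : low d y -> low d (- y).
Proof. by rewrite -scaleN1r; apply: lowZ. Qed.

Lemma lowB d y z : low d y -> low d z -> low d (y - z).
Proof. by move=> ly /lowN; apply: lowD. Qed.

Lemma low_le d e y : (d <= e)%N -> low d y -> low e y.
Proof.
move=> le_de; elim=> [|a {}y z _ ly _ lz|b pb hb]; first exact: low0.
  exact: low_linear.
by apply: low_mon => //; apply: le_trans hb _; rewrite lez_nat.
Qed.

Lemma low_gen d i : (0 < d)%N -> low d (x i).
Proof.
move=> d0; rewrite -(root_monomial_alpha x i).
by apply: low_mon; rewrite ?posroot_alpha ?height_alpha.
Qed.

(** Makes the arbitrary choice in [root_monomial_rec] harmless: the induction needs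
    to strip the simple root that suits it. *)
Definition strips k := forall b i, posroot b -> height b = k%:Z ->
  pairing b (alpha i) = 1 -> exists2 e : K, e != 0 &
    low k.-1 (mon b - e *: lie (x i) (mon (b - alpha i))).

(** When b plus the simple root is not a root, no root monomial has the weight of
    the bracket, and the extremal relations indeed push it to lower degree. *)
Definition drops k := forall b i, posroot b -> height b = k%:Z ->
  0 <= pairing b (alpha i) -> low k (lie (x i) (mon b)).

Definition extremal_upto k := forall i y, low k y ->
  exists a, lie (x i) (lie (x i) y) = a *: x i.

Lemma low_ad k i y :
  (forall m, (m <= k)%N -> drops m) -> (forall m, (m <= k.+1)%N -> strips m) ->
  low k y -> low k.+1 (lie (x i) y).
Proof.
move=> dr st; elim=> [|a {}y z _ ly _ lz|b pb hb]; first by rewrite lie0r; apply: low0.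
  by rewrite lie_linearr; apply: low_linear.
have [h hbh] := height_pos pb; rewrite hbh lez_nat in hb.
have [ge0|lt0] := lerP 0 (pairing b (alpha i)).
  by apply: (low_le (leqW hb)); apply: (dr h.+1) => //.
have ne_bi : b != alpha i.
  apply: contraTneq lt0 => ->; rewrite pairing_root ?is_root_alpha //.
have pbi : pairing b (alpha i) = -1.
  by have := pairing_posrootP pb ne_bi; lia.
have pc := posrootD pb pbi.
have hc : height (b + alpha i) = h.+2%:Z by rewrite heightD height_alpha hbh; lia.
have pci : pairing (b + alpha i) (alpha i) = 1.
  by rewrite pairingDl pbi (pairing_root (is_root_alpha R i)).
have [e e0] := st h.+2 hb _ i pc hc pci; rewrite addrK => lc.
have -> : lie (x i) (mon b)
    = e^-1 *: (mon (b + alpha i) - (mon (b + alpha i) - e *: lie (x i) (mon b))).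
  rewrite opprB [X in _ *: X]addrC subrK scalerA. by rewrite mulVf // scale1r.
apply/lowZ/lowB; last exact: low_le (leqW hb) lc.
by apply: low_mon => //; rewrite heightD height_alpha hbh; lia.
Qed.

(** Compare the two ways of stripping i and j. If i and j are not adjacent, both
    can be stripped and the generators commute; if they are adjacent, b is the
    sum of the two simple roots. *)
Lemma strips_step k : (forall m, (m < k)%N -> strips m /\ drops m) -> strips k.
Proof.
move=> IH b i pb hb pbi.
have [[l bl]|[n [j [pbj pbj' hn hn' monb]]]] := posroot_simpleP pb.
  by case: (pairing1_nonsimple pbi bl).
have kn : k = n.+2 by apply/eqP; rewrite -eqz_nat -hb hn.
subst k; have pbi' := posrootB pb pbi; rewrite monb /=.
have low_ad' l y : low n y -> low n.+1 (lie (x l) y).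
  by apply: low_ad => m lem; have [] := IH m ltac:(lia).
have [->|ne_ij] := eqVneq i j.
  by exists 1; rewrite ?oner_eq0 // scale1r subrr; apply: low0.
have [aij|naij] := boolP (adj i j).
  have /eqP : pairing (b - alpha j) (alpha i) = 2.
    by rewrite pairingDl pairingNl pbi pairing_alphas eq_sym (negPf ne_ij) (adjC R) aij.
  have [_ -> _] := pairing_rootsP (posroot_root pbj') (is_root_alpha R i).
  move/eqP => bE; exists (-1); first by rewrite oppr_eq0 oner_eq0.
  have -> : b - alpha i = alpha j by rewrite -bE opprB addrC subrK.
  by rewrite bE !root_monomial_alpha lieC scaleN1r subrr; apply: low0.
have a0 : pairing (alpha j) (alpha i) = 0.
  by rewrite pairing_alphas eq_sym (negPf ne_ij) (adjC R) (negPf naij).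
have hni : height (b - alpha i) = n.+1%:Z.
  by rewrite heightD heightN hb height_alpha; lia.
have [|e1 e10 l1] := (IH n.+1 (leqnn _)).1 _ i pbj' hn'.
  by rewrite pairingDl pairingNl pbi a0 subr0.
have [|e2 e20 l2] := (IH n.+1 (leqnn _)).1 _ j pbi' hni.
  by rewrite pairingDl pairingNl pbj pairingC a0 subr0.
rewrite /= in l1 l2; rewrite addrAC in l2.
exists (e1 / e2); first by rewrite mulf_neq0 ?invr_eq0.
set u := mon (b - alpha j) in l1 *; set v := mon (b - alpha i) in l2 *.
set w := mon _ in l1 l2.
have -> : lie (x j) u - (e1 / e2) *: lie (x i) v =
    lie (x j) (u - e1 *: lie (x i) w)
    - (e1 / e2) *: lie (x i) (v - e2 *: lie (x j) w).
  rewrite !(lieDr, lieNr, lieZr) (lie_comm w (x_comm naij)) scalerBr scalerA.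
  by rewrite divfK //; lmod_over K.
by apply: lowB; [|apply: lowZ]; apply: low_ad'.
Qed.

(** If b pairs to 1 with i, strip i and use that the generator is extremal. If it
    pairs to 0, strip some j: either i and j are not adjacent and one moves past
    j, or i can be stripped next, and the word i, j, i collapses by the second
    identity of Premet. This is where characteristic 2 is excluded. *)
Lemma drops_step k : (forall m, (m < k)%N -> strips m /\ drops m) -> strips k ->
  extremal_upto k.-1 -> drops k.
Proof.
move=> IH st ext b i pb hb pbi.
have pos_k : (0 < k)%N by have := height_gt0 pb; rewrite hb.
have kK := prednK pos_k.
have low_ad1 l y : low k.-1 y -> low k (lie (x l) y).
  move=> ly; rewrite -kK; apply: low_ad ly => m lem; last first.
    by move: lem; rewrite kK leq_eqVlt => /predU1P[->|/IH[]].
  by have [] := IH m ltac:(lia).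
have [eq_bi|ne_bi] := eqVneq b (alpha i).
  by rewrite eq_bi root_monomial_alpha liexx; apply: low0.
have /andP[_] := pairing_posrootP pb ne_bi.
have [pb1 _|ne1 le1] := eqVneq (pairing b (alpha i)) 1.
  have [e e0] := st b i pb hb pb1.
  set u := mon b; set v := mon (b - alpha i) => lu.
  have -> : u = e *: lie (x i) v + (u - e *: lie (x i) v) by lmod_over K.
  have [|c xxv] := ext i v.
    apply: low_mon; first exact: posrootB.
    by rewrite heightD heightN hb height_alpha; lia.
  rewrite lieDr lieZr xxv; apply: lowD; last exact: low_ad1.
  by do 2!apply: lowZ; apply: low_gen.
have {ne1 le1 pbi} pb0 : pairing b (alpha i) = 0.
  by move: ne1 le1 pbi; move: (pairing b _) => p; lia.
have [[l bl]|[n [j [pbj pbj' hn hn' monb]]]] := posroot_simpleP pb.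
  rewrite bl root_monomial_alpha x_comm; first exact: low0.
  move: pb0; rewrite bl pairing_alphas (adjC R).
  by case: eqP => [->|]; rewrite ?(adj_irr R) //; case: adj.
have {hn} kn : k = n.+2 by apply/eqP; rewrite -eqz_nat -hb hn.
subst k; rewrite monb /= in kK low_ad1 ext *.
have low_ad2 l y : low n y -> low n.+1 (lie (x l) y).
  by apply: low_ad => m lem; have [] := IH m ltac:(lia).
have ne_ij : i != j by apply: contra_eqN pb0 => /eqP->; rewrite pbj.
have [aij|naij] := boolP (adj i j); last first.
  rewrite (lie_comm _ (x_comm naij)); apply: low_ad1.
  apply: ((IH n.+1 (leqnn _)).2 _ _ pbj' hn').
  rewrite pairingDl pairingNl pb0 pairing_alphas eq_sym (negPf ne_ij) (adjC R).
  by rewrite (negPf naij).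
have pgi : pairing (b - alpha j) (alpha i) = 1.
  by rewrite pairingDl pairingNl pb0 pairing_alphas eq_sym (negPf ne_ij) (adjC R) aij.
have [e e0] := (IH n.+1 (leqnn _)).1 _ i pbj' hn' pgi.
have lg : low n (mon (b - alpha j - alpha i)).
  apply: low_mon; first exact: posrootB.
  by rewrite heightD heightN hn' height_alpha; lia.
move: lg; set u := mon (b - alpha j); set v := mon _ => lv lu.
have -> : u = e *: lie (x i) v + (u - e *: lie (x i) v) by lmod_over K.
rewrite !(lieDr (e *: _), lieZr); apply: lowD; last by apply/low_ad1/low_ad2.
have [|c1 c1E] := ext i (x j); first exact: low_gen.
have [|c2 c2E] := ext i v; first exact: low_le lv.
have [|c3 c3E] := ext i (lie (x j) v); first exact: low_ad2.
(* The monomial of b is now [x_i,[x_j,[x_i,v]]] up to lower terms. *)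
have := premet_nested c1E c2E c3E => /(congr1 ( *:%R 2%:R^-1)).
rewrite scalerA mulVf // scale1r => ->; do 2!apply: lowZ.
apply: lowB; last by exact: lowZ (low_le (leqnSn _) (low_ad2 _ _ lv)).
apply: lowB; apply: lowZ; first exact: low_gen.
by apply: low_ad1; apply: low_gen.
Qed.

Lemma strips_drops n : (forall m, (m < n)%N -> extremal_upto m) ->
  forall k, (k <= n)%N -> strips k /\ drops k.
Proof.
move=> ext; elim/ltn_ind => k IH le_kn.
have IH' m : (m < k)%N -> strips m /\ drops m.
  by move=> lt_jk; apply: IH => //; apply: ltnW; apply: leq_trans le_kn.
have st := strips_step IH'; split=> //.
have [k0 b i pb|k0] := posnP k; first by move=> hb; have := height_gt0 pb; rewrite hb k0.
have lt_k1 : (k.-1 < n)%N by lia.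
exact: drops_step IH' st (ext _ lt_k1).
Qed.

Section Generation.
Hypothesis gen_ind : forall S : A -> Prop, (forall i, S (x i)) -> S 0 ->
  (forall a y z, S y -> S z -> S (a *: y + z)) ->
  (forall y z, S y -> S z -> S (lie y z)) -> forall y, S y.

(** The elements y with ad y preserving S form a subalgebra containing the
    generators. *)
Lemma ad_closed_total (S : A -> Prop) : (forall i, S (x i)) -> S 0 ->
  (forall a y z, S y -> S z -> S (a *: y + z)) ->
  (forall i y, S y -> S (lie (x i) y)) -> forall y, S y.
Proof.
move=> Sx S0 Slin Sad.
have SadT y : forall z, S z -> S (lie y z).
  elim/gen_ind: y => [i||a y z Sy Sz u Su|y z Sy Sz u Su]; first exact: Sad.
  - by move=> z _; rewrite lie0l.
  - by rewrite lie_linearl; apply: Slin; [apply: Sy | apply: Sz].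
  have -> : lie (lie y z) u = -1 *: lie z (lie y u) + lie y (lie z u).
    by rewrite (lie_leibniz y z u); lmod_over K.
  by apply: Slin; [apply/Sz/Sy | apply/Sy/Sz].
by elim/gen_ind => // y z _ Sz; apply: SadT.
Qed.

Lemma low_total : (forall k, extremal_upto k) -> forall y, exists d, low d y.
Proof.
move=> ext; apply: ad_closed_total => [i||a y z [d ly] [e lz]|i y [d ly]].
- by exists 1%N; apply: low_gen.
- by exists 0%N; apply: low0.
- exists (maxn d e); apply: low_linear.
    by apply: low_le ly; apply: leq_maxl.
  by apply: low_le lz; apply: leq_maxr.
have sd k : strips k /\ drops k.
  by apply: (@strips_drops k) => // m _; apply: ext.
by exists d.+1; apply: low_ad => // m _; have [] := sd m.
Qed.

(** Two points of X are compared through the differences D of their extremal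
    forms, in a quotient where both extremal relations hold: where D vanishes the
    two relations agree, so the generators are extremal there. The zero family
    gives the bound on the dimension of L(f). *)
Section InvariantFamily.
Variable D : P -> A -> K.
Hypothesis D_linear : forall i a y z, D i (a *: y + z) = a * D i y + D i z.
Hypothesis D_adj : forall i j z, adj i j -> D i (lie (x j) z) = - D j (lie (x i) z).
Hypothesis D_nadj : forall i j z, ~~ adj i j -> D i (lie (x j) z) = 0.
Hypothesis D_gen : forall i j, D i (x j) = 0.
Hypothesis D_ext :
  forall i y, D i y = 0 -> exists a, lie (x i) (lie (x i) y) = a *: x i.

(** Induction on the degree. For b = alpha_j + c, invariance replaces D_i on the
    monomial of b by D_j on the bracket of the generator at i with the monomial
    of c, and that bracket does not go up in degree: c plus alpha_i is not a
    root, for otherwise b would pair to -2 with alpha_i. *)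
Lemma invariant_family_low k i y : low k y -> D i y = 0.
Proof.
have D0 l : D l 0 = 0.
  by have := D_linear l (-1) 0 0; rewrite scaler0 addr0 mulN1r addNr.
elim: k i y => [|k IH] i y.
  elim=> [|a {}y z _ Dy _ Dz|b pb]; rewrite ?D_linear ?D0 ?Dy ?Dz ?mulr0 ?addr0 //.
  by rewrite leNgt (height_gt0 pb).
elim=> [|a {}y z _ Dy _ Dz|b pb]; rewrite ?D_linear ?D0 ?Dy ?Dz ?mulr0 ?addr0 //.
rewrite le_eqVlt => /predU1P[hb|lt_hb]; last first.
  by apply: IH; apply: low_mon => //; lia.
have [[l bl]|[n [j [pbj pbj' hn hn' monb]]]] := posroot_simpleP pb.
  by rewrite bl root_monomial_alpha D_gen.
have {hn} kn : k = n.+1 by apply/eqP; rewrite -eqSS -eqz_nat -hb hn.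
rewrite monb; have [aij|naij] := boolP (adj i j); last exact: D_nadj.
rewrite D_adj // IH ?oppr0 //.
have [|_ dr] := @strips_drops k _ k (leqnn k).
  move=> m lt_mk l u lu; apply/D_ext/IH; exact: low_le (ltnW lt_mk) lu.
apply: dr => //; first by rewrite kn.
have ne_bi : b != alpha i.
  apply: contraTneq aij => bi; rewrite (adjC R).
  move: pbj; rewrite bi pairing_alphas (adjC R).
  by case: eqP => [->|_]; rewrite ?(adj_irr R) //; case: adj.
have := pairing_posrootP pb ne_bi.
have -> : pairing b (alpha i) = pairing (b - alpha j) (alpha i) - 1.
  rewrite pairingDl pairingNl pairing_alphas (adjC R j) aij.
  case: eqP => [eq_ji|_]; last by rewrite mul0rn; lia.
  by rewrite eq_ji (adj_irr R) in aij.
by lia.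
Qed.

Lemma invariant_family_zero : (forall y, exists d, low d y) /\ (forall i y, D i y = 0).
Proof.
have low_all : forall y, exists d, low d y.
  by apply: low_total => k i y ly; apply: D_ext; apply: invariant_family_low ly.
by split=> // i y; have [d] := low_all y; apply: invariant_family_low.
Qed.

End InvariantFamily.
End Generation.
End Filtration.
End RootMonomials.

(** * Lie algebras from structure constants *)

Section StructureConstants.
Variables (K : fieldType) (I : finType).
Notation V := {ffun I -> K^o}.
Implicit Types (u v w : V) (i j k : I).

Definition basis_vector i : V := [ffun j => (j == i)%:R].

Lemma ffun_expand u : u = \sum_i u i *: basis_vector i.
Proof.
apply/ffunP => j; rewrite sum_ffunE (bigD1 j) //= big1 => [|i ne_ij].
  by rewrite !ffunE eqxx addr0 [RHS]mulr1.
by rewrite !ffunE eq_sym (negPf ne_ij) scaler0.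
Qed.

Lemma ffun_basis_ind (S : V -> Prop) : S 0 ->
  (forall a u v, S u -> S v -> S (a *: u + v)) ->
  (forall i, S (basis_vector i)) -> forall u, S u.
Proof.
move=> S0 Slin Sb u; rewrite (ffun_expand u).
by elim/big_rec: _ => // i v _ Sv; apply: Slin.
Qed.

Variable B : I -> I -> V.

Definition sc_bracket u v : V := \sum_i \sum_j (u i * v j) *: B i j.

Lemma sc_bracket_linearl a u v w :
  sc_bracket (a *: u + v) w = a *: sc_bracket u w + sc_bracket v w.
Proof.
rewrite /sc_bracket scaler_sumr -big_split; apply: eq_bigr => i _ /=.
rewrite scaler_sumr -big_split; apply: eq_bigr => j _ /=.
by rewrite !ffunE mulrDl scalerDl scalerA; congr (_ *: _ + _); rewrite -mulrA.
Qed.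

Lemma sc_bracket_linearr a u v w :
  sc_bracket w (a *: u + v) = a *: sc_bracket w u + sc_bracket w v.
Proof.
rewrite /sc_bracket scaler_sumr -big_split; apply: eq_bigr => i _ /=.
rewrite scaler_sumr -big_split; apply: eq_bigr => j _ /=.
by rewrite !ffunE mulrDr scalerDl scalerA; congr (_ *: _ + _); apply: mulrCA.
Qed.

Lemma sc_bracket_basis i j :
  sc_bracket (basis_vector i) (basis_vector j) = B i j.
Proof.
rewrite /sc_bracket (bigD1 i) //= [X in _ + X]big1 ?addr0 => [|k ne_ki]; last first.
  by rewrite big1 // => l _; rewrite !ffunE (negPf ne_ki) mul0r scale0r.
rewrite (bigD1 j) //= [X in _ + X]big1 ?addr0 => [|k ne_kj].
  by rewrite !ffunE !eqxx mul1r scale1r.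
by rewrite !ffunE (negPf ne_kj) mulr0 scale0r.
Qed.

Lemma sc_bracket0l u : sc_bracket 0 u = 0.
Proof. by have := sc_bracket_linearl (-1) 0 0 u; rewrite scaler0 addr0 scaleN1r addNr. Qed.

Lemma sc_bracket0r u : sc_bracket u 0 = 0.
Proof. by have := sc_bracket_linearr (-1) 0 0 u; rewrite scaler0 addr0 scaleN1r addNr. Qed.

Hypothesis B_alt : forall i, B i i = 0.
Hypothesis B_anti : forall i j, B i j = - B j i.

Lemma sc_bracket_anti u v : sc_bracket u v = - sc_bracket v u.
Proof.
elim/ffun_basis_ind: u => [|a u u' IH IH'|i].
- by rewrite sc_bracket0l sc_bracket0r oppr0.
- by rewrite sc_bracket_linearl sc_bracket_linearr IH IH' scalerN opprD.
elim/ffun_basis_ind: v => [|a u u' IH IH'|j].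
- by rewrite sc_bracket0l sc_bracket0r oppr0.
- by rewrite sc_bracket_linearl sc_bracket_linearr IH IH' scalerN opprD.
by rewrite !sc_bracket_basis.
Qed.

Lemma sc_bracketuu u : sc_bracket u u = 0.
Proof.
elim/ffun_basis_ind: u => [|a u v IHu IHv|i].
- by rewrite sc_bracket0l.
- rewrite sc_bracket_linearl !sc_bracket_linearr IHu IHv (sc_bracket_anti v u).
  by rewrite scaler0 add0r addr0 scalerN subrr.
by rewrite sc_bracket_basis.
Qed.

Definition jacobiator u v w :=
  sc_bracket u (sc_bracket v w) + sc_bracket v (sc_bracket w u)
  + sc_bracket w (sc_bracket u v).

Lemma jacobiator_rot u v w : jacobiator u v w = jacobiator v w u.
Proof. by rewrite /jacobiator -addrA addrC. Qed.

Lemma sc_bracketNr u v : sc_bracket u (- v) = - sc_bracket u v.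
Proof.
by have := sc_bracket_linearr (-1) v 0 u; rewrite sc_bracket0r !addr0 !scaleN1r.
Qed.

Lemma sc_jacobi :
  (forall i j k, jacobiator (basis_vector i) (basis_vector j) (basis_vector k) = 0) ->
  forall u v w, jacobiator u v w = 0.
Proof.
have lin a u u' v w : jacobiator (a *: u + u') v w
    = a *: jacobiator u v w + jacobiator u' v w.
  rewrite /jacobiator !(sc_bracket_linearl, sc_bracket_linearr).
  by lmod_over K.
have zero v w : jacobiator 0 v w = 0.
  by rewrite /jacobiator !(sc_bracket0l, sc_bracket0r) !addr0.
move=> J0 u v w.
elim/ffun_basis_ind: u => // [a u u' IH IH'|i].
  by rewrite lin IH IH' scaler0 addr0.
rewrite jacobiator_rot; elim/ffun_basis_ind: v => // [a u u' IH IH'|j].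
  by rewrite lin IH IH' scaler0 addr0.
rewrite jacobiator_rot; elim/ffun_basis_ind: w => // a u u' IH IH'.
by rewrite lin IH IH' scaler0 addr0.
Qed.

End StructureConstants.

(** * The Chevalley algebra *)

Section Chevalley.
Variables (P : finType) (adj : rel P) (R : rootData adj) (K : fieldType).
Notation Q := {ffun P -> int}.
Notation pairing := (pairing R).
Notation euler := (euler R).
Notation is_root := (is_root R).
Notation index := (seq_sub (root_seq R) + P)%type.
Notation V := {ffun index -> K^o}.
Implicit Types (b c d : Q) (x y : P).

Definition cocycle b c : K := (-1) ^ euler b c.

(** Zero when b is not a root, which spares most case distinctions below. *)
Definition root_vector b : V :=
  [ffun k => if k is inl r then (ssval r == b)%:R else 0].

Definition coroot b : V := [ffun k => if k is inr x then (b x)%:~R else 0].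

(** Frenkel-Kac signs: [e_b, e_c] is the cocycle times e_(b+c), and [e_b, e_-b] is
    minus the coroot. *)
Definition chevalley_table (i j : index) : V :=
  match i, j with
  | inl r, inl r' =>
      if ssval r + ssval r' == 0 then - coroot (ssval r)
      else cocycle (ssval r) (ssval r') *: root_vector (ssval r + ssval r')
  | inr x, inl r => (pairing (alpha x) (ssval r))%:~R *: root_vector (ssval r)
  | inl r, inr x => - ((pairing (alpha x) (ssval r))%:~R *: root_vector (ssval r))
  | inr _, inr _ => 0
  end.

Notation br := (sc_bracket chevalley_table).

Lemma opp1_neq0 : (-1 : K) != 0.
Proof. by rewrite oppr_eq0 oner_eq0. Qed.

Lemma cocycleDl b c d : cocycle (b + c) d = cocycle b d * cocycle c d.
Proof. by rewrite /cocycle eulerDl expfzDr ?opp1_neq0. Qed.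

Lemma cocycleDr b c d : cocycle d (b + c) = cocycle d b * cocycle d c.
Proof. by rewrite /cocycle eulerDr expfzDr ?opp1_neq0. Qed.

Lemma cocycle_sq b c : cocycle b c * cocycle b c = 1.
Proof. by rewrite -expfzMl mulrNN mulr1 exp1rz. Qed.

Lemma cocycle_neq0 b c : cocycle b c != 0.
Proof. by rewrite expfz_neq0 ?opp1_neq0. Qed.

Lemma cocycleNl b c : cocycle (- b) c = cocycle b c.
Proof.
apply: (mulIf (cocycle_neq0 b c)); rewrite cocycle_sq -cocycleDl addNr.
by rewrite /cocycle euler0l.
Qed.

Lemma cocycleNr b c : cocycle b (- c) = cocycle b c.
Proof.
apply: (mulIf (cocycle_neq0 b c)); rewrite cocycle_sq -cocycleDr addNr.
by rewrite /cocycle euler0r.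
Qed.

Lemma cocycle_root b : is_root b -> cocycle b b = -1.
Proof. by move=> /eqP rb; rewrite /cocycle rb. Qed.

Lemma cocycleC b c : cocycle b c = (-1) ^ pairing b c * cocycle c b.
Proof.
rewrite expfzDr ?opp1_neq0 // -/(cocycle b c) -/(cocycle c b) -mulrA.
by rewrite cocycle_sq mulr1.
Qed.

Lemma root_vector_nonroot b : ~~ is_root b -> root_vector b = 0.
Proof.
move=> nb; apply/ffunP => -[r|x]; rewrite !ffunE //.
have := ssvalP r; rewrite mem_root_seq.
by case: eqP => // ->; rewrite (negPf nb).
Qed.

Lemma root_vector_basis r : root_vector (ssval r) = basis_vector K (inl r).
Proof. by apply/ffunP => -[r'|x]; rewrite !ffunE. Qed.

Lemma coroot_basis x : coroot (alpha x) = basis_vector K (inr x).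
Proof.
apply/ffunP => -[r'|y]; rewrite !ffunE //=.
have -> : (inr y == inr x :> index) = (y == x) by [].
by case: (y == x).
Qed.

Lemma corootN b : coroot (- b) = - coroot b.
Proof. by apply/ffunP => -[r|x]; rewrite !ffunE ?oppr0 // mulrNz. Qed.

Lemma corootD b c : coroot (b + c) = coroot b + coroot c.
Proof. by apply/ffunP => -[r|x]; rewrite !ffunE ?addr0 // mulrzDr. Qed.

Lemma coroot_expand b : coroot b = \sum_x (b x)%:~R *: basis_vector K (inr x).
Proof.
apply/ffunP => -[r|x]; rewrite sum_ffunE.
  by rewrite big1 ?ffunE // => x _; rewrite !ffunE scaler0.
rewrite (bigD1 x) //= big1 => [|y ne_yx]; first by rewrite !ffunE eqxx addr0 [RHS]mulr1.
rewrite !ffunE; have -> : (inr x == inr y :> index) = (x == y) by [].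
by rewrite eq_sym (negPf ne_yx) scaler0.
Qed.

Lemma root_indexP b : is_root b -> exists r : seq_sub (root_seq R), b = ssval r.
Proof. by rewrite -mem_root_seq => rb; exists (SeqSub rb). Qed.

Lemma br_root b c : is_root b -> is_root c ->
  br (root_vector b) (root_vector c) =
  if b + c == 0 then - coroot b else cocycle b c *: root_vector (b + c).
Proof.
move=> /root_indexP[r ->] /root_indexP[r' ->].
by rewrite !root_vector_basis sc_bracket_basis.
Qed.

Lemma br_suml (J : Type) (s : seq J) (F : J -> V) u :
  br (\sum_(j <- s) F j) u = \sum_(j <- s) br (F j) u.
Proof.
apply: (big_morph (br^~ u)) => [v w|]; last exact: sc_bracket0l.
by rewrite -[v]scale1r sc_bracket_linearl !scale1r.
Qed.

Lemma brZl a u v : br (a *: u) v = a *: br u v.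
Proof. by rewrite -[a *: u]addr0 sc_bracket_linearl sc_bracket0l addr0. Qed.

Lemma brZr a u v : br v (a *: u) = a *: br v u.
Proof. by rewrite -[a *: u]addr0 sc_bracket_linearr sc_bracket0r addr0. Qed.

Lemma br_coroot_root d b :
  br (coroot d) (root_vector b) = (pairing d b)%:~R *: root_vector b.
Proof.
have [rb|nrb] := boolP (is_root b); last first.
  by rewrite root_vector_nonroot // sc_bracket0r scaler0.
have [r ->] := root_indexP rb; rewrite coroot_expand.
rewrite br_suml root_vector_basis pairingC (pairing_expand R _ d).
rewrite rmorph_sum scaler_suml; apply: eq_bigr => x _.
rewrite brZl sc_bracket_basis /= root_vector_basis scalerA.
by rewrite rmorphM pairingC.
Qed.

Lemma chevalley_alt i : chevalley_table i i = 0.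
Proof.
case: i => //= r; have := ssvalP r; rewrite mem_root_seq => rr.
have p2 := pairing_root rr.
case: eqP => [r0|_].
  move/eqP: r0; rewrite addr_eq0 => /eqP r0.
  by move: p2; rewrite {2}r0 pairingNr pairing_root.
rewrite root_vector_nonroot ?scaler0 //.
by rewrite (is_rootD rr rr) p2.
Qed.

Lemma chevalley_anti i j : chevalley_table i j = - chevalley_table j i.
Proof.
case: i j => [r|x] [r'|y] //=; rewrite ?opprK ?oppr0 //.
have := ssvalP r; have := ssvalP r'; rewrite !mem_root_seq => rr' rr.
rewrite [ssval r' + _]addrC; case: eqP => [|_].
  by move/eqP; rewrite addrC addr_eq0 => /eqP->; rewrite opprK corootN.
have [rD|nrD] := boolP (is_root (ssval r + ssval r')); last first.
  by rewrite root_vector_nonroot // !scaler0 oppr0.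
move: rD; rewrite (is_rootD rr rr') => /eqP p1.
by rewrite cocycleC p1 exprN1 invrN1 mulN1r scaleNr.
Qed.

Notation ev := root_vector.
Notation jac := (jacobiator chevalley_table).
Notation anti := (sc_bracket_anti chevalley_anti).

Lemma br_coroot_coroot b c : br (coroot b) (coroot c) = 0.
Proof.
rewrite (coroot_expand b) br_suml big1 // => x _; rewrite brZl anti.
rewrite (coroot_expand c) br_suml big1 ?oppr0 ?scaler0 // => y _.
by rewrite brZl sc_bracket_basis scaler0.
Qed.

Lemma br_root_coroot b c : br (ev b) (coroot c) = - ((pairing c b)%:~R *: ev b).
Proof. by rewrite anti br_coroot_root. Qed.

Lemma br_root_self b : br (ev b) (ev b) = 0.
Proof. exact: sc_bracketuu chevalley_alt chevalley_anti _. Qed.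

Lemma br_root_opp c : is_root c -> br (ev (- c)) (ev c) = coroot c.
Proof.
by move=> rc; rewrite br_root ?is_rootN // addNr eqxx corootN opprK.
Qed.

Lemma br_root3 b c d : is_root b -> is_root c -> is_root d -> c + d != 0 ->
  br (ev b) (br (ev c) (ev d)) =
  if is_root (c + d) then
    if b + (c + d) == 0 then - (cocycle c d *: coroot b)
    else (cocycle c d * (cocycle b c * cocycle b d)) *: ev (b + (c + d))
  else 0.
Proof.
move=> rb rc rd /negPf cd0; rewrite (br_root rc rd) cd0 brZr.
case: ifPn => [rcd|ncd]; last by rewrite (root_vector_nonroot ncd) sc_bracket0r scaler0.
rewrite (br_root rb rcd); case: eqP => _; first by rewrite scalerN.
by rewrite cocycleDr scalerA.
Qed.

Lemma jacobi_opposite b c : is_root b -> is_root c -> jac (ev b) (ev c) (ev (- c)) = 0.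
Proof.
move=> rb rc; have rNc : is_root (- c) by rewrite is_rootN.
have -> : jac (ev b) (ev c) (ev (- c)) = (pairing c b)%:~R *: ev b
    + br (ev c) (br (ev (- c)) (ev b)) + br (ev (- c)) (br (ev b) (ev c)).
  rewrite /jacobiator; congr (_ + _ + _).
  by rewrite br_root // subrr eqxx -corootN br_root_coroot pairingNl mulrNz scaleNr opprK.
have [eq_bc|ne_bc] := eqVneq b c.
  rewrite eq_bc br_root_self sc_bracket0r br_root_opp // br_root_coroot.
  by rewrite addr0 subrr.
have [eq_bNc|ne_bNc] := eqVneq b (- c).
  rewrite eq_bNc br_root_self sc_bracket0r br_root_opp // br_root_coroot.
  by rewrite addr0 subrr.
have [/andP[ge le] eq2 eqN2] := pairing_rootsP rb rc.
rewrite (negPf ne_bc) in eq2; rewrite (negPf ne_bNc) in eqN2.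
have e1 : - c + b != 0 by rewrite addrC subr_eq0.
have e2 : b + c != 0 by rewrite addr_eq0.
rewrite (br_root3 rc rNc rb e1) (br_root3 rNc rb rc e2).
rewrite [- c + b]addrC (is_rootB rb rc) (is_rootD rb rc) (pairingC R c b).
rewrite [c + _]addrC subrK [- c + _]addrC addrK (negPf (root_neq0 rb)).
rewrite !(cocycleNl, cocycleNr) (cocycle_root rc) (cocycleC b c) mulN1r !mulrN.
rewrite !mulr1 -mulrA !cocycle_sq mulr1.
move: ge le eq2 eqN2; move: (pairing b c) => p ge le eq2 eqN2.
have /or3P[] : [|| p == -1, p == 0 | p == 1] by move: ge le eq2 eqN2; lia.
- by move=> /eqP->; rewrite /= exprN1 invrN1; lmod_over K.
- by move=> /eqP->; rewrite /= scale0r !addr0.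
- by move=> /eqP->; rewrite /= addr0; lmod_over K.
Qed.

(** Once no two of the three roots are opposite, a nonzero term needs the sum to be
    zero or a root. In the second case the three pairings add up to -2 with none
    equal to -2, so exactly two are -1, and two terms survive with opposite
    signs. *)
Lemma jacobi_roots b c d : is_root b -> is_root c -> is_root d ->
  jac (ev b) (ev c) (ev d) = 0.
Proof.
move=> rb rc rd.
have [|cd0] := eqVneq (c + d) 0.
  by move/eqP; rewrite addrC addr_eq0 => /eqP->; apply: jacobi_opposite.
have [|bd0] := eqVneq (d + b) 0.
  move/eqP; rewrite addrC addr_eq0 => /eqP->; rewrite jacobiator_rot.
  by rewrite -[d in ev d]opprK jacobi_opposite ?is_rootN.
have [|bc0] := eqVneq (b + c) 0.
  move/eqP; rewrite addrC addr_eq0 => /eqP->.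
  by rewrite -jacobiator_rot jacobi_opposite.
rewrite /jacobiator (br_root3 rb rc rd cd0) (br_root3 rc rd rb bd0) (br_root3 rd rb rc bc0).
have -> : c + (d + b) = b + (c + d) by rewrite [RHS]addrC addrA.
have -> : d + (b + c) = b + (c + d) by rewrite addrC addrA.
have [/andP[p_ge p_le] _ pN2] := pairing_rootsP rb rc.
have [/andP[q_ge q_le] _ qN2] := pairing_rootsP rc rd.
have [/andP[r_ge r_le] _ rN2] := pairing_rootsP rd rb.
move: pN2 qN2 rN2; rewrite -!addr_eq0 (negPf cd0) (negPf bc0) (negPf bd0).
move=> pN2 qN2 rN2.
have [sum0|sumN0] := eqVneq (b + (c + d)) 0.
  have root_sum u v w : is_root w -> w + (u + v) = 0 -> is_root (u + v).
    by move=> rw /eqP; rewrite addrC addr_eq0 => /eqP->; rewrite is_rootN.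
  have rcd : is_root (c + d) by apply: root_sum rb sum0.
  have rdb : is_root (d + b) by apply: (root_sum _ _ c rc); rewrite -sum0 [RHS]addrC addrA.
  have rbc : is_root (b + c) by apply: (root_sum _ _ d rd); rewrite -sum0 addrC addrA.
  rewrite rcd rdb rbc; have dE : d = - (b + c).
    by apply/eqP; rewrite -addr_eq0 addrC -addrA sum0.
  move: rbc; rewrite (is_rootD rb rc) => /eqP pbc.
  rewrite dE !(cocycleNl, cocycleNr, cocycleDl, cocycleDr).
  rewrite (cocycle_root rb) (cocycle_root rc) (cocycleC b c) pbc exprN1 invrN1.
  by rewrite corootN corootD; lmod_over K.
have [rs|nrs] := boolP (is_root (b + (c + d))); last first.
  by rewrite (root_vector_nonroot nrs) !scaler0; do 3!case: ifP => _; rewrite !addr0.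
have {rs sumN0} sumN2 : pairing b c + pairing c d + pairing d b = -2.
  have /eqP := rs; rewrite !eulerD_diag pairingDr (pairingC R b d).
  by rewrite (eqP rb) (eqP rc) (eqP rd); lia.
rewrite (is_rootD rb rc) (is_rootD rc rd) (is_rootD rd rb).
rewrite (cocycleC d b) (cocycleC c b) (cocycleC d c) (pairingC R c b) (pairingC R d c).
move: p_ge p_le q_ge q_le r_ge r_le sumN2 pN2 qN2 rN2.
move: (pairing b c) (pairing c d) (pairing d b) => p q r *.
have /or3P[] : [|| [&& p == -1, q == -1 & r == 0], [&& p == -1, q == 0 & r == -1]
    | [&& p == 0, q == -1 & r == -1]] by lia.
all: by move=> /and3P[/eqP-> /eqP-> /eqP->]; rewrite /= ?expr0z ?expr0z ?exprN1 ?invrN1;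
  lmod_over K.
Qed.

Lemma chevalley_jacobi i j k :
  jac (basis_vector K i) (basis_vector K j) (basis_vector K k) = 0.
Proof.
have root_index (r : seq_sub (root_seq R)) : is_root (ssval r).
  by rewrite -mem_root_seq; apply: ssvalP.
have jac_hee x b c : is_root b -> is_root c ->
    jac (coroot (alpha x)) (ev b) (ev c) = 0.
  move=> rb rc; rewrite /jacobiator br_root_coroot br_coroot_root brZr.
  rewrite (anti (ev c)) -scaleNr brZr.
  rewrite (br_root rb rc); case: eqP => [/eqP|_].
    rewrite addrC addr_eq0 => /eqP->; rewrite pairingNr mulrNz.
    rewrite sc_bracketNr br_coroot_coroot.
    by lmod_over K.
  by rewrite brZr br_coroot_root pairingDr rmorphD /=; lmod_over K.
have jac_hhe x y b : jac (coroot (alpha x)) (coroot (alpha y)) (ev b) = 0.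
  rewrite /jacobiator br_coroot_coroot sc_bracket0r br_root_coroot br_coroot_root.
  by rewrite -scaleNr !brZr !br_coroot_root; lmod_over K.
have jac_hhh x y z : jac (coroot (alpha x)) (coroot (alpha y)) (coroot (alpha z)) = 0.
  by rewrite /jacobiator !br_coroot_coroot !sc_bracket0r !addr0.
case: i j k => [r|x] [r'|y] [r''|z]; rewrite -?root_vector_basis -?coroot_basis //.
- exact: jacobi_roots.
- by rewrite -jacobiator_rot jac_hee.
- by rewrite jacobiator_rot jac_hee.
- by rewrite jacobiator_rot jac_hhe.
- exact: jac_hee.
- by rewrite -jacobiator_rot jac_hhe.
Qed.

Definition chevalley : Type := V.
HB.instance Definition _ := GRing.Lmodule.on chevalley.
HB.instance Definition _ := Lmodule_isLie.Build K chevalley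
  (sc_bracket_linearl chevalley_table) (sc_bracket_linearr chevalley_table)
  (sc_bracketuu chevalley_alt chevalley_anti)
  (sc_jacobi chevalley_jacobi).

End Chevalley.

(** * Exponentials of extremal elements *)

(** Writing the form of the extremal e as 2 G removes the denominator from
    exp (s ad e), which is quadratic in s and an automorphism by the first
    identity of Premet. *)
Section Exponential.
Variables (K : fieldType) (L : lieType K) (e : L) (G : L -> K).
Hypothesis char2 : (2%:R : K) != 0.
Hypothesis G_linear : forall a y z, G (a *: y + z) = a * G y + G z.
Hypothesis eeG : forall y, lie e (lie e y) = (2%:R * G y) *: e.

Definition lie_exp (s : K) (y : L) : L :=
  y + s *: lie e y + (s ^+ 2 * G y) *: e.

Lemma lie_exp_linear s a y z :
  lie_exp s (a *: y + z) = a *: lie_exp s y + lie_exp s z.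
Proof. by rewrite /lie_exp lie_linearr G_linear; lmod_over K. Qed.

Lemma lie_expZ s a y : lie_exp s (a *: y) = a *: lie_exp s y.
Proof.
have exp0 : lie_exp s 0 = 0.
  by have := lie_exp_linear s (-1) 0 0; rewrite scaler0 addr0 scaleN1r addNr.
by rewrite -[a *: y]addr0 lie_exp_linear exp0 addr0.
Qed.

Lemma lie_exp_lie s y z : lie (lie_exp s y) (lie_exp s z) = lie_exp s (lie y z).
Proof.
have YZ : lie (lie e y) (lie e z)
    = G (lie y z) *: e + G z *: lie e y - G y *: lie e z.
  apply: (scalerI char2); rewrite (premet_bracket (eeG y) (eeG z) (eeG (lie y z))).
  by lmod_over K.
rewrite /lie_exp !(lieDl, lieDr, lieZl, lieZr) liexx YZ (lie_leibniz e y z).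
rewrite (lieC y e) (lieC (lie e y) e) !eeG.
by lmod_over K.
Qed.

Lemma exp_form_self : G e *: e = 0.
Proof.
apply: (scalerI char2); rewrite scalerA -eeG liexx lie0r scaler0 //.
Qed.

Lemma exp_form_lie y : G (lie e y) *: e = 0.
Proof.
by apply: (scalerI char2); rewrite scalerA -eeG (eeG y) lieZr liexx !scaler0.
Qed.

Lemma lie_expK s y : lie_exp s (lie_exp (- s) y) = y.
Proof.
have GE : G (lie_exp (- s) y) *: e = G y *: e.
  have -> : lie_exp (- s) y
      = (- s) *: lie e y + (((- s) ^+ 2 * G y) *: e + y).
    by rewrite /lie_exp; lmod_over K.
  rewrite !G_linear scalerDl scalerDl -!scalerA exp_form_lie exp_form_self.
  by rewrite !scaler0 !add0r.
rewrite {1}/lie_exp -scalerA GE /lie_exp !(lieDr, lieZr) liexx eeG.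
by lmod_over K.
Qed.

(** Automorphisms preserve extremality. *)
Lemma lie_exp_extremal s x :
  (forall y, exists a, lie x (lie x y) = a *: x) ->
  forall y, exists a, lie (lie_exp s x) (lie (lie_exp s x) y) = a *: lie_exp s x.
Proof.
move=> ext y; have [a xxy] := ext (lie_exp (- s) y); exists a.
by rewrite -[y in LHS](lie_expK s) !lie_exp_lie xxy lie_expZ.
Qed.

End Exponential.

(** * Deformed simple root vectors *)

Section Model.
Variables (P : finType) (adj : rel P) (R : rootData adj) (K : fieldType).
Notation Q := {ffun P -> int}.
Notation pairing := (pairing R).
Notation is_root := (is_root R).
Notation posroot := (posroot R).
Notation index := (seq_sub (root_seq R) + P)%type.
Notation g := (chevalley R K).
Notation cocycle := (cocycle R K).
Notation col := (colored R).
Implicit Types (b c d : Q) (i j a : P) (u v : g).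

(** Root vectors and coroots as elements of the Lie algebra rather than of its
    underlying coordinate space. *)
Definition ev b : g := root_vector R K b.
Definition cv b : g := coroot R K b.

Lemma lie_ev b c : is_root b -> is_root c ->
  lie (ev b) (ev c) = if b + c == 0 then - cv b else cocycle b c *: ev (b + c).
Proof. exact: br_root. Qed.

Lemma lie_ev_add b c : is_root b -> is_root c -> is_root (b + c) ->
  lie (ev b) (ev c) = cocycle b c *: ev (b + c).
Proof. by move=> rb rc /root_neq0/negPf bc; rewrite lie_ev // bc. Qed.

Lemma lie_ev_cv b c : lie (ev b) (cv c) = - ((pairing c b)%:~R *: ev b).
Proof. exact: br_root_coroot. Qed.

Lemma ev_nonroot b : ~~ is_root b -> ev b = 0.
Proof. exact: root_vector_nonroot. Qed.

Lemma lie_ev0 b c : is_root b -> is_root c -> 0 <= pairing b c ->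
  lie (ev b) (ev c) = 0.
Proof.
move=> rb rc p0; have [_ _ pN2] := pairing_rootsP rb rc.
rewrite lie_ev // addr_eq0 -pN2 ev_nonroot ?scaler0.
  by case: eqP => // p2; rewrite p2 in p0.
by rewrite (is_rootD rb rc); lia.
Qed.

Definition coef b u : K :=
  if insub b is Some r then u (inl (r : seq_sub (root_seq R))) else 0.

Lemma coef_linear b s u v : coef b (s *: u + v) = s * coef b u + coef b v.
Proof. by rewrite /coef; case: insubP => [r _ _|_]; rewrite ?ffunE ?mulr0 ?addr0. Qed.

Lemma coef0 b : coef b 0 = 0.
Proof. by rewrite /coef; case: insubP => // r _ _; rewrite ffunE. Qed.

Lemma coefZ b s u : coef b (s *: u) = s * coef b u.
Proof. by rewrite -[s *: u]addr0 coef_linear coef0 addr0. Qed.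

Lemma coefD b u v : coef b (u + v) = coef b u + coef b v.
Proof. by rewrite -[u]scale1r coef_linear mul1r scale1r. Qed.

Lemma coef_ev b c : is_root b -> coef b (ev c) = (b == c)%:R.
Proof.
rewrite -mem_root_seq => rb; rewrite /coef insubT /ev /root_vector.
by rewrite [LHS]ffunE.
Qed.

Lemma coef_cv b c : coef b (cv c) = 0.
Proof. by rewrite /coef; case: insubP => // r _ _; rewrite /cv /coroot [LHS]ffunE. Qed.

Lemma chevalley_ind (S : g -> Prop) : S 0 ->
  (forall s u v, S u -> S v -> S (s *: u + v)) ->
  (forall b, is_root b -> S (ev b)) -> (forall i, S (cv (alpha i))) ->
  forall u, S u.
Proof.
move=> S0 Slin Sev Scv; apply: ffun_basis_ind => // -[r|i].
  by rewrite -root_vector_basis; apply: Sev; rewrite -mem_root_seq; apply: ssvalP.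
by rewrite -(coroot_basis R K); apply: Scv.
Qed.

Lemma ev_extremal c u : is_root c ->
  lie (ev c) (lie (ev c) u) = (2%:R * coef (- c) u) *: ev c.
Proof.
move=> rc; have rNc : is_root (- c) by rewrite is_rootN.
elim/chevalley_ind: u => [|s u v IHu IHv|b rb|i].
- by rewrite !lie0r coef0 mulr0 scale0r.
- by rewrite !lie_linearr IHu IHv coef_linear; lmod_over K.
- rewrite coef_ev // lie_ev // addrC addr_eq0 (eq_sym b); case: eqP => [eq_cb|ne_cb].
    by rewrite lieNr lie_ev_cv pairing_root // opprK mulr1.
  rewrite lieZr mulr0 scale0r.
  have [rcb|ncb] := boolP (is_root (b + c)); last by rewrite (ev_nonroot ncb) lie0r scaler0.
  rewrite lie_ev0 ?scaler0 // pairingDr (pairing_root rc).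
  by have [/andP[]] := pairing_rootsP rc rb; lia.
rewrite coef_cv mulr0 scale0r lie_ev_cv lieNr lieZr lie_ev0 ?scaler0 ?oppr0 //.
by rewrite pairing_root.
Qed.

Section Generators.
Variable w : P -> P -> K.

(** The neighbours through which the generator at i is deformed. *)
Definition out i : seq P := if col i then [::] else enum [pred a | adj a i].

(** The correction by which the two exponentials of [edge_exp] fail to add up; it
    is the only one since an uncoloured vertex has at most two neighbours. *)
Definition pair_term i : g :=
  if out i is [:: a1; a2] then
    (cocycle (alpha a1 + alpha i) (alpha a2 + alpha i) * w a1 i * w a2 i)
      *: ev (- (alpha a1 + alpha a2 + alpha i))
  else 0.

Definition tail i : g := \sum_(a <- out i) w a i *: ev (- alpha a) + pair_term i.

(** The simple root vector e_i, moved by exp (s ad e_-(a+i)) for the neighbours a in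
    [out i]: this adds w_ai e_-a, which pairs with e_a, so that the edge value at
    {a,i} becomes proportional to w_ai. Being a conjugate of e_i it is extremal,
    and e_i remains its term of highest degree. *)
Definition model i : g := ev (alpha i) + tail i.

Lemma mem_out i a : (a \in out i) = ~~ col i && adj a i.
Proof. by rewrite /out; case: ifP => //= _; rewrite mem_enum inE. Qed.

Lemma size_out i : (size (out i) <= 2)%N.
Proof.
by rewrite /out; case: ifPn => // /uncolored_deg; rewrite cardE.
Qed.

Lemma uniq_out i : uniq (out i).
Proof. by rewrite /out; case: ifP => // _; apply: enum_uniq. Qed.

Lemma col_out i a : a \in out i -> col a.
Proof.
by rewrite mem_out => /andP[nc /(adj_col R)]; rewrite (negPf nc); case: (col a).
Qed.

Lemma root_edge i a : adj a i -> is_root (alpha a + alpha i).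
Proof.
move=> aai; rewrite is_rootD ?is_root_alpha // pairing_alphas aai.
by case: (eqVneq a i) aai => [-> | //]; rewrite (adj_irr R).
Qed.

Lemma pairing_col i j : col i -> col j ->
  pairing (alpha i) (alpha j) = (i == j)%:R *+ 2.
Proof.
move=> ci cj; rewrite pairing_alphas.
have [/(adj_col R)|_] := boolP (adj i j); last by rewrite subr0.
by rewrite ci cj.
Qed.

Lemma pairing_adj i j : adj i j -> pairing (alpha i) (alpha j) = -1.
Proof.
move=> aij; rewrite pairing_alphas aij.
by case: eqP => // eq_ij; rewrite eq_ij (adj_irr R) in aij.
Qed.

Lemma pairing_nadj i j : i != j -> ~~ adj i j -> pairing (alpha i) (alpha j) = 0.
Proof. by rewrite pairing_alphas => /negPf-> /negPf->. Qed.

Lemma out2P i a1 a2 : out i = [:: a1; a2] ->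
  [/\ adj a1 i, adj a2 i, col a1, col a2 & a1 != a2] /\
  forall a, adj a i = (a == a1) || (a == a2).
Proof.
move=> oi; have m a : (a \in out i) = (a == a1) || (a == a2).
  by rewrite oi !inE.
have m1 : a1 \in out i by rewrite m eqxx.
have m2 : a2 \in out i by rewrite m eqxx orbT.
have nci : ~~ col i by move: m1; rewrite mem_out => /andP[].
have me a : (a \in out i) = adj a i by rewrite mem_out nci.
split; last by move=> a; rewrite -me.
have := uniq_out i; rewrite oi /= inE andbT => ne12.
by split; rewrite -?me // ?(col_out m1) ?(col_out m2).
Qed.

Lemma root_pair i a1 a2 : out i = [:: a1; a2] ->
  is_root (alpha a1 + alpha a2 + alpha i).
Proof.
move=> /out2P[[a1i a2i c1 c2 /negPf ne12] _].
rewrite addrAC is_rootD ?is_root_alpha ?root_edge //.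
by rewrite pairingDl pairing_col // ne12 pairingC pairing_adj.
Qed.

Lemma tail_span (S : g -> Prop) i : S 0 ->
  (forall s u v, S u -> S v -> S (s *: u + v)) ->
  (forall a, a \in out i -> S (ev (- alpha a))) ->
  (forall a1 a2, out i = [:: a1; a2] ->
     S (ev (- (alpha a1 + alpha a2 + alpha i)))) ->
  S (tail i).
Proof.
move=> S0 Slin S1 S2; rewrite /tail.
have SZ s u : S u -> S (s *: u) by move=> Su; rewrite -[_ *: _]addr0; apply: Slin.
have SD u v : S u -> S v -> S (u + v).
  by move=> Su Sv; rewrite -[u]scale1r; apply: Slin.
apply: (SD).
  by rewrite big_seq; apply: (big_ind S S0 SD) => a ai; apply: SZ; apply: S1.
rewrite /pair_term; case E: (out i) => [|a1 [|a2 [|? ?]]] //.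
by apply/SZ/S2.
Qed.

Lemma model_span (S : g -> Prop) i : S 0 ->
  (forall s u v, S u -> S v -> S (s *: u + v)) -> S (ev (alpha i)) ->
  (forall a, a \in out i -> S (ev (- alpha a))) ->
  (forall a1 a2, out i = [:: a1; a2] ->
     S (ev (- (alpha a1 + alpha a2 + alpha i)))) ->
  S (model i).
Proof.
move=> S0 Slin Si S1 S2; rewrite /model -[ev _]scale1r.
by apply: (Slin) => //; apply: tail_span.
Qed.

(** All roots that occur in one of the two generators pair nonnegatively with all
    roots that occur in the other, so the root vectors commute. If an uncoloured
    vertex had a third neighbour, that neighbour could pair to -1 with a pair
    term. *)
Lemma model_comm i j : ~~ adj i j -> lie (model i) (model j) = 0.
Proof.
have [->|ne_ij nij] := eqVneq i j; first by rewrite liexx.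
have nji : ~~ adj j i by rewrite (adjC R).
have pij := pairing_nadj ne_ij nij.
have lin0 (v : g) : forall s u u', lie u v = 0 -> lie u' v = 0 -> lie (s *: u + u') v = 0.
  by move=> s u u' u0 u'0; rewrite lie_linearl u0 u'0 scaler0 addr0.
have lin0' (v : g) : forall s u u', lie v u = 0 -> lie v u' = 0 -> lie v (s *: u + u') = 0.
  by move=> s u u' u0 u'0; rewrite lie_linearr u0 u'0 scaler0 addr0.
have out_ne k l a : ~~ adj k l -> a \in out l -> k != a.
  by move=> nkl; rewrite mem_out => /andP[_ aal]; apply: contraNneq nkl => ->.
have root_out k a : a \in out k -> is_root (- alpha a).
  by rewrite is_rootN is_root_alpha.
have root_out2 k a1 a2 : out k = [:: a1; a2] ->
    is_root (- (alpha a1 + alpha a2 + alpha k)).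
  by rewrite is_rootN; apply: root_pair.
have p1 k l a : ~~ adj k l -> a \in out l -> pairing (alpha k) (alpha a) <= 0.
  by move=> nkl al; rewrite pairing_alphas (negPf (out_ne _ _ _ nkl al)); case: adj.
have p2 k l a1 a2 a : k != l -> ~~ adj k l -> out k = [:: a1; a2] -> a \in out l ->
    0 <= pairing (alpha a1 + alpha a2 + alpha k) (alpha a).
  move=> ne_kl nkl /out2P[[a1k a2k c1 c2 ne12] ak] al; have ca := col_out al.
  rewrite !pairingDl (pairing_col c1 ca) (pairing_col c2 ca) (pairingC R (alpha k)).
  rewrite pairing_alphas ak (eq_sym a1) (eq_sym a2).
  have -> : (a == k) = false.
    by apply/eqP => eq_ak; move: al; rewrite eq_ak mem_out (negPf nkl) andbF.
  case: eqP => [->|_]; last by case: eqP.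
  by rewrite (negPf ne12).
apply: model_span (lie0l _) (lin0 _) _ _ _ => [|a ai|a1 a2 oi].
- apply: model_span (lie0r _) (lin0' _) _ _ _ => [|a aj|a1 a2 oj].
  + by rewrite lie_ev0 ?is_root_alpha ?pij.
  + by rewrite lie_ev0 ?is_root_alpha ?(root_out j) // pairingNr oppr_ge0 (p1 _ j).
  + rewrite lie_ev0 ?is_root_alpha ?root_out2 // pairingNr !pairingDr pij addr0 oppr_ge0.
    have m1 : a1 \in out j by rewrite oj !inE eqxx.
    have m2 : a2 \in out j by rewrite oj !inE eqxx orbT.
    by have := p1 i j a1 nij m1; have := p1 i j a2 nij m2; lia.
- apply: model_span (lie0r _) (lin0' _) _ _ _ => [|a' aj|a1 a2 oj].
  + rewrite lie_ev0 ?is_root_alpha ?(root_out i) // pairingNl oppr_ge0 pairingC.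
    by rewrite (p1 _ i).
  + rewrite lie_ev0 ?(root_out i a) ?(root_out j a') // pairingNl pairingNr opprK.
    by rewrite pairing_col ?(col_out ai) ?(col_out aj) //; case: eqP.
  + rewrite lie_ev0 ?(root_out i a) ?root_out2 // pairingNl pairingNr opprK pairingC.
    by apply: (p2 j i) => //; rewrite eq_sym.
have roi := root_out2 _ _ _ oi.
apply: model_span (lie0r _) (lin0' _) _ _ _ => [|a' aj|b1 b2 oj].
- rewrite lie_ev0 ?is_root_alpha // pairingNl !pairingDl pij addr0 oppr_ge0.
  rewrite !(pairingC R _ (alpha j)).
  have m1 : a1 \in out i by rewrite oi !inE eqxx.
  have m2 : a2 \in out i by rewrite oi !inE eqxx orbT.
  by have := p1 j i a1 nji m1; have := p1 j i a2 nji m2; lia.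
- rewrite lie_ev0 ?(root_out j a') // pairingNl pairingNr opprK.
  by apply: (p2 i j).
rewrite lie_ev0 ?root_out2 // pairingNl pairingNr opprK.
have [[a1i a2i c1 c2 ne12] ai] := out2P oi.
have [[b1j b2j d1 d2 ne12'] bj] := out2P oj.
rewrite !(pairingDl, pairingDr) pij (pairingC R (alpha i)).
rewrite (pairing_col c1 d1) (pairing_col c1 d2) (pairing_col c2 d1).
rewrite (pairing_col c2 d2) (pairingC R (alpha i) (alpha b2)).
have neq k l a : ~~ adj l k -> adj a l -> (a == k) = false.
  by move=> nlk aal; apply: contraNF nlk => /eqP <-; rewrite (adjC R).
rewrite !pairing_alphas (neq j i) // (neq j i) // (neq i j) // (neq i j) //.
rewrite !bj !ai.
rewrite !(eq_sym b1) !(eq_sym b2).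
move: (a1 == b1) (a1 == b2) (a2 == b1) (a2 == b2) => [] [] [] [] //.
Qed.

(** The sign makes the coefficient of e_-a in the result equal to s. *)
Definition edge_exp a i (s : K) : g -> g :=
  lie_exp (ev (- (alpha a + alpha i))) (coef (alpha a + alpha i))
    (cocycle (alpha a + alpha i) (alpha i) * s).

Hypothesis char2 : (2%:R : K) != 0.

Lemma edge_exp_extremal a i s x : adj a i ->
  (forall u, exists t, lie x (lie x u) = t *: x) ->
  forall u, exists t,
    lie (edge_exp a i s x) (lie (edge_exp a i s x) u) = t *: edge_exp a i s x.
Proof.
move=> aai; apply: lie_exp_extremal => //; first exact: coef_linear.
by move=> u; rewrite ev_extremal ?is_rootN ?root_edge // opprK.
Qed.

Lemma edge_exp_simple a i s : adj a i ->
  edge_exp a i s (ev (alpha i)) = ev (alpha i) + s *: ev (- alpha a).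
Proof.
move=> aai; rewrite /edge_exp /lie_exp coef_ev ?root_edge //.
have sumE : - (alpha a + alpha i) + alpha i = - alpha a by rewrite opprD subrK.
rewrite lie_ev_add ?is_rootN ?root_edge ?is_root_alpha ?sumE ?is_rootN ?is_root_alpha //.
have -> : (alpha a + alpha i == alpha i) = false.
  by rewrite -subr_eq0 addrK (negPf (root_neq0 (is_root_alpha R a))).
rewrite mulr0 scale0r addr0 cocycleNl scalerA mulrAC cocycle_sq mul1r.
by [].
Qed.

Lemma model_extremal i u : exists t, lie (model i) (lie (model i) u) = t *: model i.
Proof.
have ext0 v : exists t, lie (ev (alpha i)) (lie (ev (alpha i)) v) = t *: ev (alpha i).
  by eexists; apply: ev_extremal; apply: is_root_alpha.
case E: (out i) (size_out i) => [|a1 [|a2 [|? ?]]] //= _.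
- by rewrite /model /tail /pair_term E big_nil !addr0.
- have a1i : adj a1 i.
    by have := mem_out i a1; rewrite E inE eqxx => /esym/andP[].
  have -> : model i = edge_exp a1 i (w a1 i) (ev (alpha i)).
    by rewrite edge_exp_simple // /model /tail /pair_term E big_cons big_nil !addr0.
  exact: edge_exp_extremal.
have [[a1i a2i c1 c2 ne12] _] := out2P E.
have -> : model i = edge_exp a1 i (w a1 i) (edge_exp a2 i (w a2 i) (ev (alpha i))).
  rewrite edge_exp_simple // [X in edge_exp _ _ _ X]addrC.
  have exp_simple := edge_exp_simple (w a1 i) a1i; rewrite /edge_exp in exp_simple.
  rewrite /edge_exp lie_exp_linear; last exact: coef_linear.
  rewrite exp_simple /lie_exp.
  have sumE : - (alpha a1 + alpha i) - alpha a2 = - (alpha a1 + alpha a2 + alpha i).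
    by rewrite -opprD addrAC.
  rewrite coef_ev ?root_edge // lie_ev_add ?is_rootN ?root_edge ?is_root_alpha //;
    last by rewrite sumE is_rootN (root_pair E).
  have -> : (alpha a1 + alpha i == - alpha a2) = false.
    by rewrite -addr_eq0 addrAC (negPf (root_neq0 (root_pair E))).
  rewrite sumE cocycleNl cocycleNr /model /tail /pair_term E !big_cons big_nil.
  by rewrite cocycleDr; lmod_over K.
by do 2!apply: edge_exp_extremal => //.
Qed.

Lemma coef_tail b i : 0 <= height b -> coef b (tail i) = 0.
Proof.
move=> hb; have coef_neg c : is_root c -> height c < 0 -> coef b (ev c) = 0.
  move=> rc hc; have [rb|nrb] := boolP (is_root b).
    rewrite coef_ev //; case: eqP => // eq_bc.
    by rewrite eq_bc leNgt hc in hb.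
  by rewrite /coef; case: insubP => // r; rewrite mem_root_seq (negPf nrb).
apply: (@tail_span (fun u => coef b u = 0)) => [|s u v u0 v0|a _|a1 a2 /root_pair rp].
- exact: coef0.
- by rewrite coef_linear u0 v0 mulr0 addr0.
- by apply: coef_neg; rewrite ?is_rootN ?is_root_alpha // heightN height_alpha.
- by apply: coef_neg; rewrite ?is_rootN // heightN !heightD !height_alpha.
Qed.

Lemma coef_model i : coef (alpha i) (model i) = 1.
Proof.
by rewrite /model coefD coef_tail ?height_alpha // coef_ev ?is_root_alpha // eqxx addr0.
Qed.

Definition model_form i u : K := coef (alpha i) (lie (model i) (lie (model i) u)).

Lemma model_form_linear i s u v :
  model_form i (s *: u + v) = s * model_form i u + model_form i v.
Proof. by rewrite /model_form !lie_linearr coef_linear. Qed.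

Lemma model_formE i u : lie (model i) (lie (model i) u) = model_form i u *: model i.
Proof.
have [s sE] := model_extremal i u.
by rewrite /model_form sE coefZ coef_model mulr1.
Qed.

Lemma model_colored i : col i -> model i = ev (alpha i).
Proof.
by move=> ci; rewrite /model /tail /pair_term /out ci big_nil !addr0.
Qed.

Lemma model_form_edge a i : adj a i -> col a ->
  model_form a (model i) = 2%:R * w a i.
Proof.
move=> aai ca; have nci : ~~ col i.
  by move: aai => /(adj_col R); rewrite ca; case: (col i).
have coefNa b : is_root b -> coef (- alpha a) (ev b) = (b == - alpha a)%:R.
  by move=> rb; rewrite coef_ev ?is_rootN ?is_root_alpha // eq_sym.
have ht_neq b c : height b <> height c -> (b == c) = false.
  by move=> ne; apply/eqP => eq_bc; rewrite eq_bc in ne.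
rewrite /model_form (model_colored ca) ev_extremal ?is_root_alpha //.
rewrite coefZ coef_ev ?is_root_alpha // eqxx mulr1; congr (_ * _).
rewrite /model coefD coefNa ?is_root_alpha // ht_neq ?heightN ?height_alpha //.
rewrite add0r /tail coefD.
have -> : coef (- alpha a) (pair_term i) = 0.
  rewrite /pair_term; case E: (out i) => [|a1 [|a2 [|? ?]]]; rewrite ?coef0 //.
  rewrite coefZ coefNa ?is_rootN ?(root_pair E) //.
  by rewrite ht_neq ?mulr0 // !heightN !heightD !height_alpha.
rewrite addr0.
have -> : coef (- alpha a) (\sum_(a0 <- out i) w a0 i *: ev (- alpha a0))
    = \sum_(a0 <- out i) w a0 i * (a0 == a)%:R.
  rewrite (big_morph _ (coefD (- alpha a)) (coef0 (- alpha a))).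
  apply: eq_bigr => a0 _; rewrite coefZ coefNa ?is_rootN ?is_root_alpha //.
  by rewrite eqr_opp (inj_eq (@alpha_inj P)).
rewrite (bigD1_seq a) ?uniq_out ?mem_out ?nci //= eqxx mulr1.
by rewrite big1 ?addr0 // => a0 /negPf->; rewrite mulr0.
Qed.

(** The filtration by height, with coroots in height 0. *)
Inductive below (d : int) : g -> Prop :=
| below0 : below d 0
| below_linear s u v of below d u & below d v : below d (s *: u + v)
| below_ev b of is_root b & height b <= d : below d (ev b)
| below_cv b of 0 <= d : below d (cv b).

Lemma belowZ (d : int) s u : below d u -> below d (s *: u).
Proof. by move=> bu; rewrite -[_ *: _]addr0; apply/below_linear/below0. Qed.

Lemma belowD (d : int) u v : below d u -> below d v -> below d (u + v).
Proof. by move=> bu bv; rewrite -[u]scale1r; apply: below_linear. Qed.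

Lemma below_le (d e : int) u : d <= e -> below d u -> below e u.
Proof.
move=> le_de; elim=> [|s {}u v _ bu _ bv|b rb hb|b d0]; first exact: below0.
- exact: below_linear.
- by apply: below_ev => //; apply: le_trans le_de.
- by apply: below_cv; apply: le_trans le_de.
Qed.

Lemma coef_below (d : int) b u : below d u -> d < height b -> coef b u = 0.
Proof.
move=> bu lt_db; elim: bu => [|s {}u v _ u0 _ v0|c rc hc|c _].
- exact: coef0.
- by rewrite coef_linear u0 v0 mulr0 addr0.
- have [rb|nrb] := boolP (is_root b).
    rewrite coef_ev //; case: eqP => // eq_bc.
    by rewrite eq_bc ltNge hc in lt_db.
  by rewrite /coef; case: insubP => // r; rewrite mem_root_seq (negPf nrb).
- exact: coef_cv.
Qed.

Lemma below_ad_ev (d : int) b u : is_root b -> below d u ->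
  below (d + height b) (lie (ev b) u).
Proof.
move=> rb; elim=> [|s {}u v _ bu _ bv|c rc hc|c d0].
- by rewrite lie0r; apply: below0.
- by rewrite lie_linearr; apply: below_linear.
- rewrite lie_ev //; case: eqP => [bc0|_].
    rewrite -scaleN1r; apply/belowZ/below_cv.
    have : height (b + c) = 0 by rewrite bc0 /height big1 // => i _; rewrite ffunE.
    by rewrite heightD; lia.
  have [rbc|nrbc] := boolP (is_root (b + c)); last first.
    by rewrite (ev_nonroot nrbc) scaler0; apply: below0.
  by apply/belowZ/below_ev => //; rewrite heightD; lia.
- rewrite lie_ev_cv -scaleNr; apply/belowZ/below_ev => //; lia.
Qed.

Lemma below_ad_tail (d : int) i u : below d u -> below d (lie (tail i) u).
Proof.
move=> bu; apply: (@tail_span (fun t => below d (lie t u))).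
- by rewrite lie0l; apply: below0.
- by move=> s v v' bv bv'; rewrite lie_linearl; apply: below_linear.
- move=> a _; apply: below_le (below_ad_ev _ bu); last by rewrite is_rootN is_root_alpha.
  by rewrite heightN height_alpha; lia.
- move=> a1 a2 /root_pair rp; apply: below_le (below_ad_ev _ bu); last by rewrite is_rootN.
  by rewrite heightN !heightD !height_alpha; lia.
Qed.

Notation mon := (root_monomial R model).

(** The leading term of the deformed generator at i is e_i, so a root monomial has
    the same leading term as the corresponding monomial in the e_i, which is a
    multiple of a root vector. *)
Lemma model_leading b : posroot b -> exists2 e : K, e != 0 &
  below (height b - 1) (mon b - e *: ev b).
Proof.
have [k] := ubnP `|height b|%N; elim: k b => // k IH b; rewrite ltnS => le_bk pb.
have [[i ->]|[n [j [pbj pb' hn hn' monb]]]] := posroot_simpleP K pb.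
  exists 1; rewrite ?oner_eq0 // root_monomial_alpha scale1r /model addrAC subrr add0r.
  rewrite height_alpha subrr.
  apply: (@tail_span (below 0)) => [||a _|a1 a2 /root_pair rp].
  - exact: below0.
  - exact: below_linear.
  - by apply: below_ev; rewrite ?is_rootN ?is_root_alpha // heightN height_alpha.
  - by apply: below_ev; rewrite ?is_rootN // heightN !heightD !height_alpha.
have [|//|e e0] := IH (b - alpha j); first by rewrite hn'; move: le_bk; rewrite hn.
rewrite hn' => br; exists (e * cocycle (alpha j) (b - alpha j)).
  by rewrite mulf_neq0 ?cocycle_neq0.
have bE : alpha j + (b - alpha j) = b by rewrite addrC subrK.
have evb : lie (ev (alpha j)) (ev (b - alpha j))
    = cocycle (alpha j) (b - alpha j) *: ev b.
  by rewrite lie_ev_add ?is_root_alpha ?(posroot_root pb') ?bE ?(posroot_root pb).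
rewrite monb; set u := mon _ in br *; set r := u - _ in br.
have -> : u = e *: ev (b - alpha j) + r by rewrite /r; lmod_over K.
rewrite lieDr lieZr /model lieDl evb hn.
set t1 := lie _ (ev _); set t2 := lie _ r.
have -> : e *: (cocycle (alpha j) (b - alpha j) *: ev b + t1) + t2
   - (e * cocycle (alpha j) (b - alpha j)) *: ev b = e *: t1 + t2 by lmod_over K.
apply: belowD.
  apply/belowZ/below_ad_tail/below_ev; first exact: posroot_root.
  by rewrite hn'; lia.
rewrite /t2 lieDl; apply: belowD.
  apply: below_le (below_ad_ev (is_root_alpha R j) br).
  by rewrite height_alpha; lia.
by apply: below_le (below_ad_tail _ br); lia.
Qed.

(** Look at the coordinate at a root of maximal height with nonzero coefficient. *)
Lemma model_indep N (b : 'I_N -> Q) : injective b -> (forall k, posroot (b k)) ->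
  lin_indep (fun k => mon (b k)).
Proof.
move=> b_inj pb t sum0 k; apply: contrapT => /eqP tk.
case: (@arg_maxnP _ k (fun k => t k != 0) (fun k => `|height (b k)|%N) tk) => m tm mmax.
have hm l : t l != 0 -> height (b l) <= height (b m).
  by move=> /mmax; have := height_gt0 (pb l); have := height_gt0 (pb m); lia.
have := congr1 (coef (b m)) sum0.
rewrite (big_morph _ (coefD (b m)) (coef0 (b m))) coef0 (bigD1 m) //= big1.
  have [e e0 be] := model_leading (pb m).
  have -> : mon (b m) = e *: ev (b m) + (mon (b m) - e *: ev (b m)) by lmod_over K.
  rewrite coefZ coef_linear coef_ev ?posroot_root // eqxx (coef_below be) ?gtrBl //.
  by rewrite !addr0 mulr1 => /eqP; rewrite mulf_eq0 (negPf tm) (negPf e0).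
move=> l ne_lm; rewrite coefZ; have [->|tl] := eqVneq (t l) 0; first by rewrite mul0r.
have [e e0 be] := model_leading (pb l).
have -> : mon (b l) = e *: ev (b l) + (mon (b l) - e *: ev (b l)) by lmod_over K.
rewrite coef_linear coef_ev ?posroot_root // (inj_eq b_inj) eq_sym (negPf ne_lm).
rewrite (coef_below be) ?mulr0 ?addr0 ?mulr0 //.
by have := hm l tl; lia.
Qed.

End Generators.
End Model.

(** * The algebras F and L(f) *)

Section Presentation.
Variables (P : finType) (adj : rel P) (K : fieldType).
Notation F := (liF adj K).
Notation gen := (gen adj K).
Implicit Types (f : point adj K).

Lemma liF_ind (S : F -> Prop) : (forall x, S (gen x)) -> S 0 ->
  (forall a y z, S y -> S z -> S (a *: y + z)) ->
  (forall y z, S y -> S z -> S (lie y z)) -> forall y, S y.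
Proof.
move=> Sgen S0 Slin Slie; elim/quot_ind; elim/free_ind.
elim=> [x||t1 IH1 t2 IH2|a t IH|t1 IH1 t2 IH2].
- exact: Sgen.
- by rewrite free_pi0 linear0.
- by rewrite free_piD quot_piD -[quot_pi _ (free_pi t1)]scale1r; apply: Slin.
- by rewrite free_piZ quot_piZ -[_ *: _]addr0; apply: Slin.
- by rewrite free_pi_lie quot_pi_lie; apply: Slie.
Qed.

Section Quotient.
Variable G : F -> Prop.
Notation pi := (quot_pi G).

Lemma quot_gen_ind (S : lie_quot G -> Prop) : (forall x, S (pi (gen x))) -> S 0 ->
  (forall a y z, S y -> S z -> S (a *: y + z)) ->
  (forall y z, S y -> S z -> S (lie y z)) -> forall y, S y.
Proof.
move=> Sgen S0 Slin Slie; elim/quot_ind.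
apply: (liF_ind (S := fun y => S (pi y))) => [x||a y z|y z].
- exact: Sgen.
- by rewrite linear0.
- by rewrite linearP; apply: Slin.
- by rewrite quot_pi_lie; apply: Slie.
Qed.

Lemma quot_pi0P y : pi y = 0 <-> ideal_gen G y.
Proof.
by rewrite -[y in ideal_gen _ y]subr0 -quot_piP linear0.
Qed.

Lemma quot_gen_comm (x y : P) : ~~ adj x y -> lie (pi (gen x)) (pi (gen y)) = 0.
Proof. by move=> nxy; rewrite -quot_pi_lie gen_comm // linear0. Qed.

End Quotient.

Lemma root_monomial_morph (R : rootData adj) (A B : lieType K) (h : A -> B)
    (x : P -> A) b : h 0 = 0 -> (forall y z, h (lie y z) = lie (h y) (h z)) ->
  root_monomial R (fun i => h (x i)) b = h (root_monomial R x b).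
Proof.
move=> h0 hlie; rewrite /root_monomial; move: (absz (height b)) => n.
elim: n b => //= n IH b.
case: pickP => // _; case: pickP => // j _.
by rewrite IH hlie.
Qed.

Lemma extremal_liL f x y :
  lie (quot_pi (extremal_rel f) (gen x))
    (lie (quot_pi (extremal_rel f) (gen x)) (quot_pi (extremal_rel f) y))
  = f x y *: quot_pi (extremal_rel f) (gen x).
Proof.
rewrite -(quot_pi_lie _ (gen x) y) -(quot_pi_lie _ (gen x)) -quot_piZ.
apply/quot_piP; apply: ideal_gen_incl; apply: ExtremalRel.
Qed.

Lemma idealI_ext f f' y : (forall x z, f x z = f' x z) -> idealI f y -> idealI f' y.
Proof.
move=> eq_ff; elim=> {y} [_ [x y]||a y z _ Iy _ Iz|y z _ Iz].
- by rewrite eq_ff; apply: ideal_gen_incl; apply: ExtremalRel.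
- exact: ideal_gen0.
- exact: ideal_gen_linear.
- exact: ideal_gen_lie.
Qed.

(** What the functionals f_x inherit from an invariant symmetric bilinear form B on
    L(f) with f_x = B(x, _). *)
Record form_like f : Prop := FormLike {
  form_ideal : forall x y, idealI f y -> f x y = 0;
  form_adj : forall x y z, adj x y -> f x (lie (gen y) z) = - f y (lie (gen x) z);
  form_nadj : forall x y z, ~~ adj x y -> f x (lie (gen y) z) = 0;
  form_sym : forall x y, adj x y -> f x (gen y) = f y (gen x);
  form_gen_nadj : forall x y, ~~ adj x y -> f x (gen y) = 0
}.

Lemma form_like0 : form_like (point0 adj K).
Proof. by split=> //= *; rewrite oppr0. Qed.

End Presentation.

(** * Invariance of the extremal form *)

Section InvariantForm.
Variables (K : fieldType) (L : lieType K) (x y : L).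
Hypothesis xy_neq0 : lie x y != 0.

(** Expand the bracket of y with [x,[x,y]] in two ways. *)
Lemma extremal_form_sym a b :
  lie x (lie x y) = a *: x -> lie y (lie y x) = b *: y -> a = b.
Proof.
move=> xxy yyx; have := lie_leibniz y x (lie x y).
rewrite xxy lieZr [lie (lie y x) _]lieC (lieC y x) lieNr liexx oppr0 oppr0 add0r.
have -> : lie y (lie x y) = - (b *: y) by rewrite (lieC x y) lieNr yyx.
rewrite lieNr lieZr scalerN => /oppr_inj/eqP.
by rewrite -subr_eq0 -scalerBl scaler_eq0 (negPf xy_neq0) orbF subr_eq0 => /eqP.
Qed.

(** Evaluate [x,[y,[x,[y,z]]]] in two ways by the second identity of Premet, once
    for x and once for y. *)
Lemma extremal_form_invariant z p a b c : (2%:R : K) != 0 ->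
  lie x (lie x y) = p *: x -> lie y (lie y x) = p *: y ->
  lie y (lie y z) = c *: y -> lie x (lie x (lie y z)) = a *: x ->
  lie y (lie y (lie x z)) = b *: y -> a = - b.
Proof.
move=> char2 xxy yyx yyz xxyz yyxz.
have xxyyz : lie x (lie x (lie y (lie y z))) = (c * p) *: x.
  by rewrite yyz !lieZr xxy scalerA.
have := premet_nested xxy xxyz xxyyz.
have := congr1 (lie x) (premet_nested yyx yyz yyxz).
rewrite lieZr => ->; rewrite !(lieDr, lieNr, lieZr) (lieC y x) lieNr xxy => /eqP.
rewrite -subr_eq0 => /eqP eq0; apply/eqP; rewrite -addr_eq0.
suff : (a + b) *: lie x y = 0.
  by move/eqP; rewrite scaler_eq0 (negPf xy_neq0) orbF.
by rewrite -eq0; lmod_over K.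
Qed.

End InvariantForm.

(** * Uniqueness of points of X *)

Section Points.
Variables (P : finType) (adj : rel P) (R : rootData adj) (K : fieldType).
Hypothesis char2 : (2%:R : K) != 0.
Notation F := (liF adj K).
Notation gen := (gen adj K).
Notation Q := {ffun P -> int}.
Notation posroot := (posroot R).
Notation mon := (root_monomial R gen).
Implicit Types (f : point adj K).

Lemma form_like_nonvanishing f :
  (forall x, ~ idealI f (gen x)) ->
  (forall x y, adj x y -> ~ idealI f (lie (gen x) (gen y))) -> form_like f.
Proof.
move=> gen_nz edge_nz; pose pi := quot_pi (extremal_rel f).
have pi_lie y z : pi (lie y z) = lie (pi y) (pi z) by apply: quot_pi_lie.
have gx x : pi (gen x) != 0 by apply/eqP => /quot_pi0P; apply: gen_nz.
have gxy x y : adj x y -> lie (pi (gen x)) (pi (gen y)) != 0.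
  by move=> axy; rewrite -pi_lie; apply/eqP => /quot_pi0P; apply: edge_nz.
have ext x y : lie (pi (gen x)) (lie (pi (gen x)) (pi y)) = f x y *: pi (gen x).
  exact: extremal_liL.
have f_eq0 x y : lie (pi (gen x)) (lie (pi (gen x)) (pi y)) = 0 -> f x y = 0.
  by rewrite ext => /eqP; rewrite scaler_eq0 (negPf (gx x)) orbF => /eqP.
have ext2 x y z : lie (pi (gen x)) (lie (pi (gen x)) (lie (pi (gen y)) (pi z)))
    = f x (lie (gen y) z) *: pi (gen x) by rewrite -pi_lie ext.
have sym x y : adj x y -> f x (gen y) = f y (gen x).
  by move=> axy; apply: (extremal_form_sym (gxy x y axy)).
split=> // [x y Iy|x y z axy|x y z nxy|x y nxy].
- by apply: f_eq0; have -> : pi y = 0; [apply/quot_pi0P | rewrite !lie0r].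
- apply: (extremal_form_invariant (gxy x y axy) char2 (ext x _) _ (ext y z)) => //.
  by rewrite ext (sym x y axy).
- apply: f_eq0; rewrite pi_lie.
  have xy0 : lie (pi (gen x)) (pi (gen y)) = 0 by apply: quot_gen_comm.
  rewrite (lie_comm _ xy0) (lie_comm _ xy0) ext lieZr (lieC (pi (gen y))) xy0.
  by rewrite oppr0 scaler0.
- by apply: f_eq0; rewrite [lie _ (pi (gen y))]quot_gen_comm // lie0r.
Qed.

(** In the quotient of F by the intersection of I(f) and I(f') the differences of
    the two forms satisfy the hypotheses of [invariant_family_zero]. *)
Lemma form_like_unique f f' : form_like f -> form_like f' ->
  (forall x y, adj x y -> colored R x -> f x (gen y) = f' x (gen y)) ->
  forall x y, f x y = f' x y.
Proof.
move=> [f_ideal f_adj f_nadj f_sym f_gen] [f'_ideal f'_adj f'_nadj f'_sym f'_gen] eq_edge.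
pose G y := idealI f y /\ idealI f' y.
have IG y : ideal_gen G y -> G y.
  elim=> // [|a {}y z _ [? ?] _ [? ?]|{}y z _ [? ?]]; split;
    by [apply: ideal_gen0 | apply: ideal_gen_linear | apply: ideal_gen_lie].
pose pi := quot_pi G.
have pi_lie y z : pi (lie y z) = lie (pi y) (pi z) by apply: quot_pi_lie.
pose D x (q : lie_quot G) := f x (repr q) - f' x (repr q).
have DE x y : D x (pi y) = f x y - f' x y.
  have /IG[I1 I2] := repr_quot_pi G y; rewrite /D -/pi.
  have := f_ideal x _ I1; have := f'_ideal x _ I2; rewrite !linearB.
  by move=> /eqP; rewrite subr_eq0 => /eqP -> /eqP; rewrite subr_eq0 => /eqP ->.
have edge x y : f x (gen y) = f' x (gen y).
  have [axy|nxy] := boolP (adj x y); last by rewrite f_gen // f'_gen.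
  have [cx|ncx] := boolP (colored R x); first exact: eq_edge.
  have ayx : adj y x by rewrite (adjC R).
  rewrite f_sym // f'_sym // eq_edge //.
  by move: axy => /(adj_col R); rewrite (negPf ncx); case: (colored R y).
suff [_ D0] : (forall q, exists d, low R (fun x => pi (gen x)) d q) /\
    (forall x q, D x q = 0).
  by move=> x y; apply/eqP; rewrite -subr_eq0 -DE D0.
apply: invariant_family_zero => //.
- by move=> x y nxy; apply: quot_gen_comm.
- exact: quot_gen_ind.
- move=> x a; elim/quot_ind => y; elim/quot_ind => z.
  by rewrite -/pi -linearP !DE !linearP /=; ring.
- move=> x y; elim/quot_ind => z axy.
  by rewrite -!pi_lie !DE f_adj // f'_adj //; ring.
- by move=> x y; elim/quot_ind => z nxy; rewrite -pi_lie DE f_nadj // f'_nadj // subr0.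
- by move=> x y; rewrite DE edge subrr.
- move=> x; elim/quot_ind => y; rewrite DE => /eqP; rewrite subr_eq0 => /eqP eq_xy.
  exists (f x y); rewrite -/pi -!pi_lie -[_ *: _]quot_piZ; apply/quot_piP.
  apply: ideal_gen_incl; split; apply: ideal_gen_incl; last rewrite eq_xy;
    exact: ExtremalRel.
Qed.

Definition posroots : seq Q := [seq b <- undup (root_seq R) | posroot b].
Definition nroots := size posroots.
Definition nth_posroot (k : 'I_nroots) : Q := nth 0 posroots k.

Lemma posroot_nth k : posroot (nth_posroot k).
Proof. by have := mem_nth 0 (ltn_ord k); rewrite mem_filter => /andP[]. Qed.

Lemma nth_posroot_inj : injective nth_posroot.
Proof.
move=> k l /eqP; rewrite nth_uniq ?filter_uniq ?undup_uniq // => /eqP.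
exact: val_inj.
Qed.

Lemma posrootP b : posroot b -> exists k, nth_posroot k = b.
Proof.
move=> pb; have bs : b \in posroots.
  by rewrite mem_filter pb mem_undup mem_root_seq posroot_root.
by exists (Ordinal (etrans (index_mem b posroots) bs)); apply: nth_index.
Qed.

Definition liL_mon f (k : 'I_nroots) : liL f :=
  quot_pi (extremal_rel f) (mon (nth_posroot k)).

Lemma spannedD n (V : lmodType K) (b : 'I_n -> V) a u v :
  spanned b u -> spanned b v -> spanned b (a *: u + v).
Proof.
move=> [c ->] [d ->]; exists (fun i => a * c i + d i).
rewrite scaler_sumr -big_split; apply: eq_bigr => i _ /=.
by rewrite scalerDl scalerA.
Qed.

Lemma spanned_self n (V : lmodType K) (b : 'I_n -> V) i : spanned b (b i).
Proof.
exists (fun j => (j == i)%:R); rewrite (bigD1 i) //= eqxx scale1r big1 ?addr0 //.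
by move=> j /negPf->; rewrite scale0r.
Qed.

(** The case D = 0 of [invariant_family_zero]. *)
Lemma liL_span f q : spanned (liL_mon f) q.
Proof.
pose x i := quot_pi (extremal_rel f) (gen i).
have [low_all _] : (forall q, exists d, low R x d q) /\
    (forall (i : P) (q : liL f), (0 : K) = 0).
  apply: (@invariant_family_zero _ _ R _ char2 _ x _ _ (fun _ _ => 0)) => //.
  - by move=> i j nij; apply: quot_gen_comm.
  - exact: quot_gen_ind.
  - by move=> *; rewrite mulr0 addr0.
  - by move=> *; rewrite oppr0.
  - by move=> i; elim/quot_ind => y _; exists (f i y); apply: extremal_liL.
have [d] := low_all q; elim=> [|a y z _ sy _ sz|b pb _].
- by exists (fun=> 0); rewrite big1 // => i _; rewrite scale0r.
- exact: spannedD.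
have [k <-] := posrootP pb; rewrite root_monomial_morph; first exact: spanned_self.
  by rewrite linear0.
by move=> y z; rewrite quot_pi_lie.
Qed.

Lemma liL_has_dim f :
  (forall c : 'I_nroots -> K,
     idealI f (\sum_k c k *: mon (nth_posroot k)) -> forall k, c k = 0) ->
  has_dim (liL f) nroots.
Proof.
move=> indep; exists (liL_mon f); split; last exact: liL_span.
move=> c sum0; apply: indep; apply/quot_pi0P; rewrite linear_sum -[RHS]sum0.
by apply: eq_bigr => k _; rewrite linearZ.
Qed.

(** The spanning root monomials are then independent, so neither a generator nor
    the bracket of two adjacent generators vanishes in L(f); both are root
    monomials up to sign. *)
Lemma full_dim_form_like f : has_dim (liL f) nroots -> form_like f.
Proof.
move=> /span_has_dim_indep/(_ (@liL_span f)) indep.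
have mon_nz b : posroot b -> ~ idealI f (mon b).
  move=> /posrootP[k <-] /quot_pi0P mon0.
  have := indep (fun l => (l == k)%:R); rewrite (bigD1 k) //= big1.
    rewrite eqxx scale1r addr0 => /(_ mon0 k)/eqP.
    by rewrite eqxx oner_eq0.
  by move=> l /negPf->; rewrite scale0r.
apply: form_like_nonvanishing => [x|x y axy].
  by rewrite -(root_monomial_alpha R gen); apply/mon_nz/posroot_alpha.
have pxy : posroot (alpha x + alpha y).
  apply: posrootD; first exact: posroot_alpha.
  exact: pairing_adj.
have [[i eq_i]|[n [j [pj pj' hn hn' monE]]]] := posroot_simpleP K pxy.
  have := height_alpha i; rewrite -eq_i heightD !height_alpha.
  by lia.
have [l El] : exists l, alpha x + alpha y - alpha j = alpha l.
  apply: height1 pj' _; move: hn hn'; rewrite !heightD !height_alpha => -[<-] ->.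
  by [].
move: (mon_nz _ pxy); rewrite monE El root_monomial_alpha.
have {}El : alpha x + alpha y = alpha j + alpha l by rewrite -El [RHS]addrC subrK.
have : (j == x) || (j == y).
  have := congr1 (fun b : Q => b j) El; rewrite !ffunE eqxx.
  by case: (j == x); case: (j == y) => //; case: (j == l).
case/orP=> /eqP eq_j; rewrite eq_j in El *.
  by move/addrI/alpha_inj: El => <-.
move/esym: El; rewrite addrC => /addIr/alpha_inj-> nz Ixy; apply: nz.
by rewrite lieC; apply: ideal_genN.
Qed.

End Points.

(** * The torus action *)

Section QuotientMap.
Variables (K : fieldType) (L L' : lieType K) (G : L -> Prop) (G' : L' -> Prop).
Variable h : {linear L -> L'}.
Hypothesis h_ideal : forall y, ideal_gen G y -> ideal_gen G' (h y).

Definition quot_map (q : lie_quot G) : lie_quot G' := quot_pi G' (h (repr q)).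

Lemma quot_mapE y : quot_map (quot_pi G y) = quot_pi G' (h y).
Proof. by apply/quot_piP; rewrite -linearB; apply/h_ideal/repr_quot_pi. Qed.

Lemma quot_map_linear : linear quot_map.
Proof.
move=> a; elim/quot_ind => y; elim/quot_ind => z.
by rewrite -linearP !quot_mapE !linearP.
Qed.

End QuotientMap.

Lemma quot_iso (K : fieldType) (L L' : lieType K) (G : L -> Prop) (G' : L' -> Prop)
    (h : {linear L -> L'}) (h' : {linear L' -> L}) :
  cancel h h' -> cancel h' h -> (forall y z, h (lie y z) = lie (h y) (h z)) ->
  (forall y, ideal_gen G y -> ideal_gen G' (h y)) ->
  (forall y, ideal_gen G' y -> ideal_gen G (h' y)) ->
  lie_iso (lie_quot G) (lie_quot G').
Proof.
move=> hK h'K hlie hI h'I.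
pose m := GRing.isLinear.Build K _ _ _ (@quot_map _ _ _ G G' h) (quot_map_linear hI).
pose H : {linear lie_quot G -> lie_quot G'} := HB.pack (@quot_map _ _ _ G G' h) m.
exists H; split.
  exists (@quot_map _ _ _ G' G h'); elim/quot_ind => y /=.
    by rewrite (quot_mapE hI) (quot_mapE h'I) hK.
  by rewrite (quot_mapE h'I) (quot_mapE hI) h'K.
elim/quot_ind => y; elim/quot_ind => z /=.
by rewrite -quot_pi_lie !(quot_mapE hI) hlie quot_pi_lie.
Qed.

Section TorusAction.
Variables (P : finType) (adj : rel P) (K : fieldType).
Notation gen := (gen adj K).
Implicit Types (f : point adj K) (t : P -> K).

Lemma torus_invK t : torus_inv (torus_inv t) = t.
Proof. by apply/funext => x; rewrite /torus_inv invrK. Qed.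

Lemma in_torus_inv t : in_torus t -> in_torus (torus_inv t).
Proof. by move=> tT x; rewrite invr_eq0. Qed.

Lemma torusFK t : in_torus t -> cancel (torusF (adj := adj) t) (torusF (torus_inv t)).
Proof.
move=> tT; elim/liF_ind => [x||a y z IHy IHz|y z IHy IHz].
- by rewrite torusF_gen linearZ /= torusF_gen scalerA mulfV // scale1r.
- by rewrite !linear0.
- by rewrite !linearP /= IHy IHz.
- by rewrite !torusF_lie IHy IHz.
Qed.

Lemma torusFVK t : in_torus t -> cancel (torusF (adj := adj) (torus_inv t)) (torusF t).
Proof. by move=> /in_torus_inv/torusFK; rewrite torus_invK. Qed.

Lemma torusXE t f x y : torusX t f x y = (t x)^-1 * f x (torusF (torus_inv t) y).
Proof. by []. Qed.

Lemma torusXK t f x y : in_torus t -> torusX (torus_inv t) (torusX t f) x y = f x y.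
Proof.
move=> tT; rewrite !torusXE torus_invK torusFK // /torus_inv invrK.
by rewrite mulrA mulfV // mul1r.
Qed.

(** The automorphism of F given by t turns the relation for f, x and y into a
    multiple of the relation for tf, x and ty. *)
Lemma idealI_torus t f y : in_torus t ->
  idealI f y -> idealI (torusX t f) (torusF t y).
Proof.
move=> tT; elim=> {y} [_ [x y]||a y z _ Iy _ Iz|y z _ Iz].
- have -> : torusF t (lie (gen x) (lie (gen x) y) - f x y *: gen x)
      = (t x * t x) *: (lie (gen x) (lie (gen x) (torusF t y))
                        - torusX t f x (torusF t y) *: gen x).
    rewrite linearB linearZ /= !torusF_lie torusF_gen !(lieZl, lieZr) torusXE torusFK //.
    by rewrite scalerBr !scalerA; congr (_ - _ *: _); field; apply: tT.
  by apply: ideal_genZ; apply: ideal_gen_incl; apply: ExtremalRel.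
- by rewrite linear0; apply: ideal_gen0.
- by rewrite linearP; apply: ideal_gen_linear.
- by rewrite torusF_lie; apply: ideal_gen_lie.
Qed.

Lemma torus_lie_iso t f f' : in_torus t -> (forall x y, f' x y = torusX t f x y) ->
  lie_iso (liL f) (liL f').
Proof.
move=> tT f'E.
apply: (quot_iso (torusFK tT) (torusFVK tT)) => [y z|y Iy|y Iy].
- exact: torusF_lie.
- by apply: idealI_ext (idealI_torus tT Iy) => x z; rewrite f'E.
- apply: idealI_ext (idealI_torus (in_torus_inv tT) (idealI_ext f'E Iy)) => x z.
  exact: torusXK.
Qed.

Lemma lie_iso_dim (A B : lieType K) n : lie_iso A B -> has_dim A n -> has_dim B n.
Proof. by move=> [h [h_bij _]]; apply: has_dim_bij h_bij. Qed.

Lemma inX_torus t f : in_torus t -> inX f -> inX (torusX t f).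
Proof.
move=> tT [n [dim0 dimf]]; exists n; split=> //.
exact: lie_iso_dim (torus_lie_iso tT (fun _ _ => erefl)) dimf.
Qed.

Lemma torusX_gen t f x y : torusX t f x (gen y) = (t x)^-1 * ((t y)^-1 * f x (gen y)).
Proof. by rewrite torusXE torusF_gen linearZ. Qed.

Lemma character_edge t (e : edge adj) x y : in_torus t -> x != y ->
  val e = [set x; y] -> character t (- alpha_edge e) = (t x * t y)^-1.
Proof.
move=> tT ne_xy eE.
have -> : alpha_edge e = alpha x + alpha y.
  by rewrite /alpha_edge eE big_setU1 ?inE //= big_set1.
rewrite /character invfM.
have charN z : \prod_u t u ^ (- alpha z) u = (t z)^-1.
  rewrite (bigD1 z) //= !ffunE eqxx big1 ?mulr1 ?exprN1 // => u ne_uz.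
  by rewrite !ffunE (negPf ne_uz) oppr0 expr0z.
rewrite -!charN -big_split; apply: eq_bigr => u _.
by rewrite opprD ffunE expfzDr.
Qed.

End TorusAction.

(** * Points with prescribed edge values *)

Section EdgeValues.
Variables (P : finType) (adj : rel P) (K : fieldType).

Definition edge_val (v : edge adj -> K) (x y : P) : K :=
  if insub [set x; y] is Some e then v e else 0.

Lemma edge_valC v x y : edge_val v x y = edge_val v y x.
Proof. by rewrite /edge_val setUC. Qed.

Lemma edge_valE v (e : edge adj) x y : val e = [set x; y] -> edge_val v x y = v e.
Proof. by rewrite /edge_val => <-; rewrite valK. Qed.

Lemma edge_val_adj v x y : adj x y -> exists2 e : edge adj,
  val e = [set x; y] & edge_val v x y = v e.
Proof.
move=> axy; have xyE : is_edge adj [set x; y].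
  by apply/existsP; exists x; apply/existsP; exists y; rewrite axy eqxx.
by exists (Sub [set x; y] xyE) => //; apply: edge_valE.
Qed.

End EdgeValues.

Section ModelPoint.
Variables (P : finType) (adj : rel P) (R : rootData adj) (K : fieldType).
Notation F := (liF adj K).
Notation gen := (gen adj K).
Variable v : edge adj -> K.

(** The extremal form of e_a takes the value 2 at e_-a. *)
Definition model_weight (a i : P) : K := 2%:R^-1 * edge_val v a i.

Notation X := (model R model_weight).

Definition model_map : F -> chevalley R K := liF_lift idfun X.

Lemma model_map_gen x : model_map (gen x) = X x.
Proof. by apply: liF_lift_gen; apply: model_comm. Qed.

Lemma model_map_linear : linear model_map.
Proof. by move=> a y z; apply: liF_lift_linear; apply: model_comm. Qed.

HB.instance Definition _ :=
  GRing.isLinear.Build K F (chevalley R K) _ model_map model_map_linear.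

Lemma model_map_lie y z : model_map (lie y z) = lie (model_map y) (model_map z).
Proof. by apply: liF_lift_lie; apply: model_comm. Qed.

Definition model_fun (x : P) (y : F) : K := model_form model_weight x (model_map y).

Lemma model_fun_scalar x : scalar (model_fun x).
Proof. by move=> a y z; rewrite /model_fun linearP model_form_linear. Qed.

HB.instance Definition _ x :=
  GRing.isLinear.Build K F K _ (model_fun x) (model_fun_scalar x).

Definition model_point : point adj K := model_fun.

Hypothesis char2 : (2%:R : K) != 0.

Lemma model_point_edge x y : adj x y -> colored R x ->
  model_point x (gen y) = edge_val v x y.
Proof.
move=> axy cx; rewrite /= /model_fun model_map_gen model_form_edge //.
by rewrite mulrA mulfV // mul1r.
Qed.

Lemma model_map_ideal y : idealI model_point y -> model_map y = 0.
Proof.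
elim=> {y} [_ [x y]||a y z _ y0 _ z0|y z _ z0].
- rewrite linearB linearZ /= !model_map_lie model_map_gen model_formE //.
  exact: subrr.
- exact: linear0.
- by rewrite linearP /= y0 z0 scaler0 addr0.
- by rewrite model_map_lie z0 lie0r.
Qed.

(** The model generators satisfy the relations of the model point, and the root
    monomials in them are independent. *)
Lemma model_point_indep (c : 'I_(nroots R) -> K) :
  idealI model_point (\sum_k c k *: root_monomial R gen (nth_posroot k)) ->
  forall k, c k = 0.
Proof.
move=> /model_map_ideal sum0.
apply: (@model_indep _ _ _ _ model_weight char2 _ _ (@nth_posroot_inj _ _ R) (@posroot_nth _ _ R) c).
rewrite -[RHS]sum0 linear_sum; apply: eq_bigr => k _; rewrite linearZ /=.
congr (_ *: _); rewrite -root_monomial_morph ?linear0 //; last exact: model_map_lie.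
by congr root_monomial; apply/funext => x; rewrite model_map_gen.
Qed.

Lemma model_point_form_like : form_like model_point.
Proof.
apply/(full_dim_form_like char2)/(liL_has_dim char2)/model_point_indep.
Qed.

End ModelPoint.

Section PointsOfX.
Variables (P : finType) (adj : rel P) (R : rootData adj) (K : fieldType).
Hypothesis char2 : (2%:R : K) != 0.
Notation gen := (gen adj K).

(** Both points are invariant and have zero edge values. That the relations of the
    zero point hold in the undeformed model, and hence the dimension of L(0), thus
    needs no computation. *)
Lemma model_point0 x y : model_point R (fun=> 0) x y = point0 adj K x y.
Proof.
apply: (form_like_unique (R := R) char2 (model_point_form_like R _ char2) (form_like0 _ _)).
move=> z t azt cz; rewrite model_point_edge //.
by have [e _ ->] := edge_val_adj (fun=> 0 : K) azt.
Qed.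

Lemma point0_has_dim : has_dim (liL (point0 adj K)) (nroots R).
Proof.
apply: (liL_has_dim char2) => c /idealI_ext Ic.
apply: (model_point_indep (v := fun=> 0) char2); apply: Ic => x y.
by rewrite model_point0.
Qed.

Lemma inXP (f : point adj K) : inX f <-> has_dim (liL f) (nroots R).
Proof.
split=> [[n [dim0 dimf]]|dimf]; last by exists (nroots R); split=> //; apply: point0_has_dim.
by rewrite (has_dim_uniq point0_has_dim dim0).
Qed.

Lemma model_point_inX (v : edge adj -> K) : inX (model_point R v).
Proof. by apply/inXP/(liL_has_dim char2)/model_point_indep. Qed.

Lemma inX_form_like (f : point adj K) : inX f -> form_like f.
Proof. by move=> /inXP; apply: full_dim_form_like. Qed.

Lemma inX_model (f : point adj K) (v : edge adj -> K) : inX f ->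
  (forall x y, adj x y -> colored R x -> f x (gen y) = edge_val v x y) ->
  forall x y, f x y = model_point R v x y.
Proof.
move=> /inX_form_like fX fv.
apply: (form_like_unique (R := R) char2 fX (model_point_form_like R v char2)) => x y axy cx.
by rewrite fv // model_point_edge.
Qed.

End PointsOfX.

(** * Polynomial dependence on the edge values *)

Section PolyEval.
Variables (K K' : fieldType) (s : {rmorphism K -> K'}) (I : finType).
Implicit Types (p q : {mpoly K[#|I|]}) (v : I -> K').

Lemma poly_evalD p q v : poly_eval s (p + q) v = poly_eval s p v + poly_eval s q v.
Proof. by rewrite /poly_eval rmorphD mevalD. Qed.

Lemma poly_evalM p q v : poly_eval s (p * q) v = poly_eval s p v * poly_eval s q v.
Proof. by rewrite /poly_eval rmorphM mevalM. Qed.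

Lemma poly_evalC a v : poly_eval s a%:MP v = s a.
Proof. by rewrite /poly_eval map_mpolyC mevalC. Qed.

Lemma poly_evalX i v : poly_eval s 'X_(enum_rank i) v = v i.
Proof. by rewrite /poly_eval map_mpolyX mevalXU enum_rankK. Qed.

End PolyEval.

Section PolynomialFamilies.
Variables (P : finType) (adj : rel P) (K : fieldType).

(** One polynomial over the base field must serve all extension fields: this is
    regularity over K, also when K is finite. *)
Definition polynomial_family
    (c : forall K' : fieldType, {rmorphism K -> K'} -> (edge adj -> K') -> K') : Prop :=
  exists q : {mpoly K[#|edge adj|]},
  forall (K' : fieldType) (s : {rmorphism K -> K'}) (v : edge adj -> K'),
    c K' s v = poly_eval s q v.

Lemma polynomial_const a : polynomial_family (fun _ s _ => s a).
Proof. by exists a%:MP => K' s v; rewrite poly_evalC. Qed.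

Lemma polynomialD c d : polynomial_family c -> polynomial_family d ->
  polynomial_family (fun K' s v => c K' s v + d K' s v).
Proof. by move=> [p pE] [q qE]; exists (p + q) => K' s v; rewrite poly_evalD pE qE. Qed.

Lemma polynomialM c d : polynomial_family c -> polynomial_family d ->
  polynomial_family (fun K' s v => c K' s v * d K' s v).
Proof. by move=> [p pE] [q qE]; exists (p * q) => K' s v; rewrite poly_evalM pE qE. Qed.

Lemma polynomial_ext c d : (forall K' s v, c K' s v = d K' s v) ->
  polynomial_family c -> polynomial_family d.
Proof. by move=> eq_cd [q qE]; exists q => K' s v; rewrite -eq_cd. Qed.

Lemma polynomial0 : polynomial_family (fun _ _ _ => 0).
Proof. by apply: polynomial_ext (polynomial_const 0) => K' s v; rewrite rmorph0. Qed.

Lemma polynomial_edge_val x y : polynomial_family (fun _ _ v => edge_val v x y).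
Proof.
rewrite /edge_val; case: insub => [e|]; last exact: polynomial0.
by exists 'X_(enum_rank e) => K' s v; rewrite poly_evalX.
Qed.

Variable R : rootData adj.
Notation index := (seq_sub (root_seq R) + P)%type.

Definition polynomial_vector
    (u : forall K' : fieldType, {rmorphism K -> K'} -> (edge adj -> K') ->
       chevalley R K') :=
  forall k : index, polynomial_family (fun K' s v => (u K' s v : {ffun index -> K'^o}) k).

Lemma polynomial_vectorD u u' : polynomial_vector u -> polynomial_vector u' ->
  polynomial_vector (fun K' s v => u K' s v + u' K' s v).
Proof.
move=> uP u'P k; apply: polynomial_ext (polynomialD (uP k) (u'P k)) => K' s v.
by rewrite [RHS]ffunE.
Qed.

Lemma polynomial_vectorZ c u : polynomial_family c -> polynomial_vector u ->
  polynomial_vector (fun K' s v => c K' s v *: u K' s v).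
Proof.
move=> cP uP k; apply: polynomial_ext (polynomialM cP (uP k)) => K' s v.
by rewrite [RHS]ffunE.
Qed.

Lemma polynomial_vector0 : polynomial_vector (fun _ _ _ => 0).
Proof. by move=> k; apply: polynomial_ext polynomial0 => K' s v; rewrite [RHS]ffunE. Qed.

Lemma polynomial_vector_sum (I : Type) (r : seq I) u :
  (forall i, polynomial_vector (u i)) ->
  polynomial_vector (fun K' s v => \sum_(i <- r) u i K' s v).
Proof.
move=> uP; elim: r => [|i r IH] k.
  by apply: polynomial_ext (polynomial_vector0 k) => K' s v; rewrite big_nil.
by apply: polynomial_ext (polynomial_vectorD (uP i) IH k) => K' s v; rewrite big_cons.
Qed.

Lemma polynomial_ev b : polynomial_vector (fun K' _ _ => ev R K' b).
Proof.
move=> [r|x].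
  apply: polynomial_ext (polynomial_const (ssval r == b)%:R) => K' s v.
  by rewrite rmorph_nat /ev /root_vector [RHS]ffunE.
by apply: polynomial_ext polynomial0 => K' s v; rewrite /ev /root_vector [RHS]ffunE.
Qed.

Lemma polynomial_cv b : polynomial_vector (fun K' _ _ => cv R K' b).
Proof.
move=> [r|x].
  by apply: polynomial_ext polynomial0 => K' s v; rewrite /cv /coroot [RHS]ffunE.
apply: polynomial_ext (polynomial_const (b x)%:~R) => K' s v.
by rewrite rmorph_int /cv /coroot [RHS]ffunE.
Qed.

Lemma polynomial_cocycle b c : polynomial_family (fun K' _ _ => cocycle R K' b c).
Proof.
apply: polynomial_ext (polynomial_const (cocycle R K b c)) => K' s v.
by rewrite /cocycle fmorphXz rmorphN1.
Qed.

Lemma polynomial_int (n : int) : polynomial_family (fun K' _ _ => n%:~R).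
Proof.
by apply: polynomial_ext (polynomial_const n%:~R) => K' s v; rewrite rmorph_int.
Qed.

Lemma polynomial_vectorN u : polynomial_vector u ->
  polynomial_vector (fun K' s v => - u K' s v).
Proof.
move=> uP k; apply: polynomial_ext (polynomial_vectorZ (polynomial_int (-1)) uP k) => K' s v.
by rewrite mulrN1z scaleN1r.
Qed.

Lemma polynomial_table (i j : index) :
  polynomial_vector (fun K' _ _ => chevalley_table K' i j : chevalley R K').
Proof.
case: i j => [r|x] [r'|y] /=.
- case: (_ + _ == 0); first exact: polynomial_vectorN (polynomial_cv _).
  exact: polynomial_vectorZ (polynomial_cocycle _ _) (polynomial_ev _).
- exact/polynomial_vectorN/polynomial_vectorZ/polynomial_ev/polynomial_int.
- exact: polynomial_vectorZ (polynomial_int _) (polynomial_ev _).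
- exact: polynomial_vector0.
Qed.

Lemma polynomial_lie u u' : polynomial_vector u -> polynomial_vector u' ->
  polynomial_vector (fun K' s v => lie (u K' s v) (u' K' s v)).
Proof.
move=> uP u'P; rewrite /lie /= /sc_bracket.
apply: polynomial_vector_sum => i; apply: polynomial_vector_sum => j.
by apply: polynomial_vectorZ; [apply: polynomialM | apply: polynomial_table].
Qed.

Lemma polynomial_coef b u : polynomial_vector u ->
  polynomial_family (fun K' s v => coef b (u K' s v)).
Proof. by rewrite /coef; case: insubP => [r _ _|_] uP; [apply: uP | apply: polynomial0]. Qed.

Lemma polynomial_weight a i : polynomial_family (fun _ _ v => model_weight v a i).
Proof.
apply: polynomial_ext (polynomialM (polynomial_const 2%:R^-1) (polynomial_edge_val a i)).
by move=> K' s v; rewrite fmorphV rmorph_nat.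
Qed.

Lemma polynomial_model i : polynomial_vector (fun _ _ v => model R (model_weight v) i).
Proof.
apply: polynomial_vectorD; first exact: polynomial_ev.
apply: polynomial_vectorD.
  by apply: polynomial_vector_sum => a; apply: polynomial_vectorZ (polynomial_ev _);
    apply: polynomial_weight.
rewrite /pair_term; case: (out R i) => [|a1 [|a2 [|? ?]]];
  try exact: polynomial_vector0.
apply: polynomial_vectorZ (polynomial_ev _).
apply: polynomialM; last exact: polynomial_weight.
by apply: polynomialM; [apply: polynomial_cocycle | apply: polynomial_weight].
Qed.

(** The structure constants of the Chevalley algebra are integers and the
    coordinates of the deformed generators are polynomials in the edge values. *)
Lemma polynomial_model_point (y : liF adj K) x :
  polynomial_family (fun K' s v => model_point R v x (liF_ext s y)).
Proof.
rewrite /= /model_fun /model_form.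
suff yP : polynomial_vector (fun K' s v => model_map R v (liF_ext s y)).
  by apply: polynomial_coef; do 2![apply: polynomial_lie; first exact: polynomial_model].
elim/liF_ind: y => [i||a y z yP zP|y z yP zP] k.
- apply: polynomial_ext (polynomial_model i k) => K' s v.
  by rewrite liF_ext_gen model_map_gen.
- apply: polynomial_ext polynomial0 => K' s v.
  have -> : liF_ext s (0 : liF adj K) = 0.
    have := liF_ext_linear s (-1) (0 : liF adj K) 0.
    by rewrite scaler0 addr0 rmorphN1 scaleN1r addNr.
  by rewrite linear0 [RHS]ffunE.
- apply: polynomial_ext (polynomial_vectorD (polynomial_vectorZ (polynomial_const a) yP) zP k).
  by move=> K' s v; rewrite liF_ext_linear linearP.
- apply: polynomial_ext (polynomial_lie yP zP k) => K' s v.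
  by rewrite liF_ext_lie model_map_lie.
Qed.

End PolynomialFamilies.

(** * The degree one part of F *)

Section DegreeOne.
Variables (P : finType) (adj : rel P) (K : fieldType).
Notation F := (liF adj K).
Notation gen := (gen adj K).

(** The abelian Lie algebra on the vertices, which detects the degree one part. *)
Definition abelian_lie : Type := {ffun P -> K^o}.
HB.instance Definition _ := GRing.Lmodule.on abelian_lie.
HB.instance Definition _ := Lmodule_isLie.Build K abelian_lie
  (lie := fun _ _ => 0)
  (fun a _ _ _ => esym (etrans (addr0 _) (scaler0 _ a)))
  (fun a _ _ _ => esym (etrans (addr0 _) (scaler0 _ a)))
  (fun _ => erefl) (fun _ _ _ => etrans (addr0 _) (addr0 0)).

Definition unit_vector (x : P) : abelian_lie := basis_vector K x.

Definition abelianize : F -> abelian_lie := liF_lift idfun unit_vector.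

Let abelianize_comm x y :
  ~~ adj x y -> lie (unit_vector x) (unit_vector y) = 0.
Proof. by []. Qed.

Lemma abelianize_linear : linear abelianize.
Proof. by move=> a y z; apply: liF_lift_linear. Qed.

HB.instance Definition _ :=
  GRing.isLinear.Build K F abelian_lie _ abelianize abelianize_linear.

Lemma abelianize_gen x : abelianize (gen x) = unit_vector x.
Proof. exact: liF_lift_gen. Qed.

Lemma abelianize_lie y z : abelianize (lie y z) = 0.
Proof. by rewrite [LHS]liF_lift_lie. Qed.

Lemma abelianize_ideal0 y : idealI (point0 adj K) y -> abelianize y = 0.
Proof.
elim=> {y} [_ [x y]||a y z _ y0 _ z0|y z _ z0].
- by rewrite /= scale0r subr0 abelianize_lie.
- exact: linear0.
- by rewrite linearP /= y0 z0 scaler0 addr0.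
- exact: abelianize_lie.
Qed.

Lemma homogeneous0 d (y : F) : homogeneous d y -> d = 0%N -> y = 0.
Proof.
elim=> {d y} // [d e y z _ y0 _ _|d a y z _ y0 _ z0 d0].
  by move/eqP; rewrite addn_eq0 => /andP[/eqP/y0-> _]; rewrite lie0l.
by rewrite y0 // z0 // scaler0 addr0.
Qed.

Lemma homogeneous1 d (y : F) : homogeneous d y -> d = 1%N ->
  exists c : P -> K, y = \sum_x c x *: gen x.
Proof.
have zero : exists c : P -> K, 0 = \sum_x c x *: gen x.
  by exists (fun=> 0); rewrite big1 // => x _; rewrite scale0r.
elim=> {d y} [x _|[|[|d]] [|[|e]] y z hy _ hz _ //|d|d a y z _ IHy _ IHz d1].
- exists (fun z => (z == x)%:R); rewrite (bigD1 x) //= eqxx scale1r big1 ?addr0 //.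
  by move=> z /negPf->; rewrite scale0r.
- by rewrite (homogeneous0 hy) // lie0l.
- by rewrite (homogeneous0 hz) // lie0r.
- by [].
have [c ->] := IHy d1; have [c' ->] := IHz d1; exists (fun x => a * c x + c' x).
by rewrite scaler_sumr -big_split; apply: eq_bigr => x _; rewrite scalerA scalerDl.
Qed.

Lemma abelianize_homogeneous d (y : F) : homogeneous d y -> d <> 1%N -> abelianize y = 0.
Proof.
elim=> {d y} // [d e y z *|d _|d a y z _ y0 _ z0 d1].
- exact: abelianize_lie.
- exact: linear0.
- by rewrite linearP /= y0 // z0 // scaler0 addr0.
Qed.

(** The generators span the degree one part of F, and I(0) starts in degree two. *)
Lemma admissible_gen m (u : 'I_m -> F) x : admissible u -> spanned u (gen x).
Proof.
move=> [_ homU /(_ (gen x))[v [z [vU z0 genE]]]].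
have [n [y [yP vE]]] := homU v vU.
have ab_gen : unit_vector x = \sum_(d < n) abelianize (y d).
  rewrite -abelianize_gen genE linearD /= (abelianize_ideal0 z0) addr0 vE.
  by rewrite linear_sum.
have ab_y d : d <> 1%N -> abelianize (y d) = 0.
  by apply: abelianize_homogeneous; apply: (yP d).1.
have ab1 : unit_vector x = abelianize (y 1%N).
  have [lt_1n|le_n1] := ltnP 1 n.
    rewrite ab_gen (bigD1 (Ordinal lt_1n)) //= big1 ?addr0 // => d ne_d1.
    by apply: ab_y => d1; case/eqP: ne_d1; apply: val_inj.
  have : (unit_vector x : {ffun P -> K^o}) x = 0.
    rewrite ab_gen big1 ?ffunE // => d _; apply: ab_y => d1.
    by have := leq_trans (ltn_ord d) le_n1; rewrite d1.
  by rewrite ffunE eqxx => /eqP; rewrite oner_eq0.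
have [c yE] := homogeneous1 (yP 1%N).1 (erefl _).
suff -> : gen x = y 1%N by apply: (yP 1%N).2.
have cE z' : c z' = (z' == x)%:R.
  have := congr1 (fun w : {ffun P -> K^o} => w z') ab1.
  rewrite yE linear_sum ffunE => ->; under eq_bigr do rewrite linearZ /= abelianize_gen.
  rewrite sum_ffunE (bigD1 z') //= big1 ?addr0 => [|t ne_t].
    by rewrite !ffunE eqxx [RHS]mulr1.
  by rewrite !ffunE eq_sym (negPf ne_t) scaler0.
rewrite yE (bigD1 x) //= cE eqxx scale1r big1 ?addr0 // => z' ne_z'.
by rewrite cE (negPf ne_z') scale0r.
Qed.

End DegreeOne.

(** * Edge coordinates on X *)

(** Evaluate at the generic point, whose coordinates are the variables in the field
    of rational functions. A larger field is needed when the base field is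
    finite. *)
Lemma open_torus_denseP (P : finType) (adj : rel P) (K : fieldType) :
  open_torus_dense adj K.
Proof.
move=> p p0; pose n := #|edge adj|.
pose K' : fieldType := {fraction {mpoly K[n]}}.
pose s : {rmorphism K -> K'} := @tofrac _ \o @mpolyC n K.
pose v (e : edge adj) : K' := tofrac 'X_(enum_rank e).
have eval_v q : poly_eval s q v = tofrac q.
  elim/mpolyind: q => [|c m q _ _ IH].
    by rewrite -[0]/(0%:MP) poly_evalC.
  rewrite poly_evalD IH rmorphD /=; congr (_ + _).
  rewrite -mul_mpolyC poly_evalM poly_evalC rmorphM /=; congr (_ * _).
  rewrite /poly_eval map_mpolyX mevalX [in RHS]mpolyXE_id rmorph_prod /=.
  by apply: eq_bigr => i _; rewrite /v enum_valK rmorphXn.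
have := p0 K' s v; rewrite eval_v => /(_ _)/eqP; rewrite tofrac_eq0 => p_eq0.
by apply/eqP/p_eq0 => e; rewrite tofrac_eq0 -msupp_eq0 msuppX.
Qed.

(** True for trees: choose t at a root and propagate along the edges. *)
Definition edge_product_surjective (P : finType) (adj : rel P) : Prop :=
  forall (K : fieldType) (r : P -> P -> K), (forall x y, r x y = r y x) ->
  (forall x y, adj x y -> r x y != 0) ->
  exists2 t : P -> K, in_torus t & forall x y, adj x y -> t x * t y = r x y.

Section Assembly.
Variables (P : finType) (adj : rel P) (R : rootData adj).

Lemma edge_ends (e : edge adj) : exists xy : P * P,
  [/\ adj xy.1 xy.2, colored R xy.1 & val e = [set xy.1; xy.2]].
Proof.
have /existsP[x /existsP[y /andP[axy /eqP eE]]] := valP e.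
have [cx|ncx] := boolP (colored R x); first by exists (x, y).
exists (y, x); split=> /=; rewrite ?(adjC R y) // 1?setUC //.
by move: (adj_col R axy); rewrite (negPf ncx); case: (colored R y).
Qed.

Definition edge_pair (e : edge adj) : P * P := projT1 (cid (edge_ends e)).
Definition edge_head e : P := (edge_pair e).1.
Definition edge_tail e : P := (edge_pair e).2.

Lemma edge_pairP e : [/\ adj (edge_head e) (edge_tail e), colored R (edge_head e)
  & val e = [set edge_head e; edge_tail e]].
Proof. by rewrite /edge_head /edge_tail /edge_pair; case: cid. Qed.

Lemma edge_ends_neq e : edge_head e != edge_tail e.
Proof.
by have [a _ _] := edge_pairP e; apply: contraTneq a => ->; rewrite (adj_irr R).
Qed.

Lemma edge_pair_uniq e x y : adj x y -> colored R x -> val e = [set x; y] ->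
  edge_head e = x /\ edge_tail e = y.
Proof.
move=> axy cx eE; have [aht ch eE'] := edge_pairP e; rewrite eE in eE'.
have ncy : ~~ colored R y by move: (adj_col R axy); rewrite cx; case: (colored R y).
have nct : ~~ colored R (edge_tail e).
  by move: (adj_col R aht); rewrite ch; case: (colored R (edge_tail e)).
have hx : edge_head e = x.
  have : edge_head e \in [set x; y] by rewrite eE' set21.
  by rewrite !inE => /orP[/eqP//|/eqP hy]; rewrite -hy ch in ncy.
split=> //; have : edge_tail e \in [set x; y] by rewrite eE' set22.
by rewrite !inE => /orP[/eqP tx|/eqP//]; rewrite tx cx in nct.
Qed.

Lemma edge_val_pair (K : fieldType) (v : edge adj -> K) e :
  edge_val v (edge_head e) (edge_tail e) = v e.
Proof. by apply: edge_valE; have [] := edge_pairP e. Qed.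

(** By invariance either end of an edge could be used to read its value. In the
    model the coloured end is the convenient one, since its generator is a plain
    root vector. *)
Definition edge_coordinates (K : fieldType) : map_family adj K :=
  fun K' _ f e => f (edge_head e) (gen adj K' (edge_tail e)).

Section Field.
Variable K : fieldType.
Hypothesis char2 : (2%:R : K) != 0.
Notation phi := (@edge_coordinates K).

Let char2' (K' : fieldType) (s : {rmorphism K -> K'}) : (2%:R : K') != 0.
Proof. by rewrite -(rmorph_nat s) fmorph_eq0. Qed.

Lemma point_modelE (K' : fieldType) (s : {rmorphism K -> K'}) (f : point adj K') :
  inX f -> forall x y, f x y = model_point R (phi s f) x y.
Proof.
move=> fX; apply: (inX_model (char2' s) fX) => x y axy cx.
have [e eE ->] := edge_val_adj (phi s f) axy.
by have [hx ty] := edge_pair_uniq axy cx eE; rewrite /edge_coordinates hx ty.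
Qed.

Lemma coordinates_model (K' : fieldType) (s : {rmorphism K -> K'}) (v : edge adj -> K') :
  phi s (model_point R v) =1 v.
Proof.
move=> e; have [a c _] := edge_pairP e.
by rewrite /edge_coordinates (model_point_edge v (char2' s) a c) edge_val_pair.
Qed.

Lemma coordinates_inj (K' : fieldType) (s : {rmorphism K -> K'}) (f f' : point adj K') :
  inX f -> inX f' -> phi s f =1 phi s f' -> forall x, f x =1 f' x.
Proof.
move=> fX f'X /funext eq_phi x y.
by rewrite (point_modelE s fX) (point_modelE s f'X) eq_phi.
Qed.

Lemma liF_ext_sum (K' : fieldType) (s : {rmorphism K -> K'}) m
    (u : 'I_m -> liF adj K) (c : 'I_m -> K) :
  liF_ext s (\sum_i c i *: u i) = \sum_i s (c i) *: liF_ext s (u i).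
Proof.
have ext0 : liF_ext s (0 : liF adj K) = 0.
  have := liF_ext_linear s (-1) (0 : liF adj K) 0.
  by rewrite scaler0 addr0 rmorphN1 scaleN1r addNr.
have extD : {morph @liF_ext P adj K K' s : y z / y + z >-> y + z}.
  by move=> y z; have := liF_ext_linear s 1 y z; rewrite rmorph1 !scale1r.
rewrite (big_morph _ extD ext0); apply: eq_bigr => i _.
by have := liF_ext_linear s (c i) (u i) 0; rewrite ext0 !addr0.
Qed.

(** Bijectivity and regularity of the inverse come from [model_point]; the map itself
    is linear in the coordinates of f, since the generators lie in the span
    of any admissible family. *)
Lemma edge_coordinates_iso : variety_iso phi.
Proof.
split=> [K' s|m u uA|m u uA].
- split=> [f g|v]; first exact: coordinates_inj.
  by exists (model_point R v); [apply: model_point_inX (char2' s) _ | apply: coordinates_model].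
- have /choice[c cE] e : exists c : 'I_m -> K,
      gen adj K (edge_tail e) = \sum_i c i *: u i.
    exact: admissible_gen uA.
  exists (fun e => \sum_i (c e i)%:MP * 'X_(enum_rank (edge_head e, i))) => K' s f _ e.
  rewrite /edge_coordinates -(liF_ext_gen adj s) cE liF_ext_sum linear_sum.
  have poly_eval_sum : {morph (fun q => poly_eval s q (restr s u f)) :
      q q' / q + q' >-> q + q'}.
    by move=> q q'; apply: poly_evalD.
  rewrite (big_morph _ poly_eval_sum (id1 := 0)); last first.
    by rewrite -[0]/(0%:MP) poly_evalC rmorph0.
  by apply: eq_bigr => i _; rewrite linearZ poly_evalM poly_evalC poly_evalX.
have /choice[q qE] (xi : P * 'I_m) :=
  polynomial_model_point R (u xi.2) xi.1.
exists q => K' s f fX xi.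
by rewrite /restr (point_modelE s fX) qE.
Qed.

Lemma edge_coordinates_equivariant : torus_equivariant phi.
Proof.
move=> K' s t f tT fX; split; first exact: inX_torus.
move=> e; have [_ _ eE] := edge_pairP e.
rewrite /torusV (character_edge tT (edge_ends_neq e) eE) invfM -mulrA.
exact: torusX_gen.
Qed.

Hypothesis solve_edges : edge_product_surjective adj.

Lemma open_torus_orbit : open_torus_is_orbit adj K.
Proof.
move=> K' s v w v0; split=> [w0|[t tT wE] e].
  have nz (u : edge adj -> K') x y : in_open_torus u -> adj x y -> edge_val u x y != 0.
    by move=> u0 /(edge_val_adj u)[e _ ->].
  have [x y|x y axy|t tT tE] :=
    solve_edges (r := fun x y => edge_val v x y / edge_val w x y).
  - by rewrite !(edge_valC _ x).
  - by rewrite mulf_neq0 ?invr_eq0 ?nz.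
  exists t => // e; have [a _ eE] := edge_pairP e.
  rewrite /torusV (character_edge tT (edge_ends_neq e) eE) tE // !edge_val_pair.
  by rewrite invf_div divfK.
have [_ _ eE] := edge_pairP e.
rewrite wE /torusV (character_edge tT (edge_ends_neq e) eE).
by rewrite mulf_neq0 // invr_eq0 mulf_neq0.
Qed.

(** All points with nonzero edge values are translates of the one with all edge
    values 1. *)
Lemma open_torus_iso : exists g : lieType K, forall f : point adj K, inX f ->
  in_open_torus (phi idfun f) -> lie_iso (liL f) g.
Proof.
pose f1 : point adj K := model_point R (fun=> 1).
have f1X : inX f1 by apply: model_point_inX char2 _.
exists (liL f1) => f fX f0.
have one0 : in_open_torus (fun _ : edge adj => 1 : K) by move=> e; apply: oner_neq0.
have [t tT fE] := (open_torus_orbit idfun _ one0).1 f0.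
have tf1X := inX_torus tT f1X.
have eq_f : forall x, f x =1 torusX t f1 x.
  apply: (coordinates_inj (s := idfun) fX tf1X) => e; rewrite fE.
  have [_ ->] := edge_coordinates_equivariant idfun tT f1X.
  by rewrite /torusV coordinates_model.
apply: (torus_lie_iso (in_torus_inv tT)) => x y.
by rewrite -(torusXK f1 x y tT) torusXE [in RHS]torusXE eq_f.
Qed.

End Field.
End Assembly.

(** * Positive definiteness *)

Section Superharmonic.
Variables (P : finType) (adj : rel P) (col : pred P).
Hypothesis adjC : symmetric adj.
Hypothesis adj_col : forall x y, adj x y -> col x != col y.
Variable d : P -> rat.
Hypothesis d_gt0 : forall x, 0 < d x.
Hypothesis d_super : forall x, \sum_(y | adj x y) d y <= 2%:R * d x.
Variable x0 : P.
Hypothesis d_strict : \sum_(y | adj x0 y) d y < 2%:R * d x0.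
Hypothesis connected : forall f : P -> rat,
  (forall x y, adj x y -> f x = f y) -> forall x y, f x = f y.

(** Completing squares along a superharmonic function d, with r = b / d: the vertex
    terms measure the defect of harmonicity and the edge terms the variation of
    r. *)
Lemma superharmonic_square (r : P -> rat) :
  2%:R * (\sum_x (d x * r x) ^+ 2
    - \sum_x \sum_(y | adj x y && col x) (d x * r x) * (d y * r y))
  = \sum_x (2%:R * d x - \sum_(y | adj x y) d y) * (d x * r x ^+ 2)
    + \sum_x \sum_(y | adj x y && col x) d x * d y * (r x - r y) ^+ 2.
Proof.
have split_adj : \sum_x (\sum_(y | adj x y) d y) * (d x * r x ^+ 2) =
    \sum_x \sum_(y | adj x y && col x) d x * d y * (r x ^+ 2 + r y ^+ 2).
  under [RHS]eq_bigr do under eq_bigr do rewrite mulrDr.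
  under [RHS]eq_bigr do rewrite big_split /=.
  under [LHS]eq_bigr do rewrite (bigID col) /= mulrDl addrC.
  rewrite !big_split /=; congr (_ + _).
    apply: eq_bigr => x _; rewrite mulr_suml.
    apply: eq_big => [y|y _]; last by ring.
    by have [/adj_col|] := boolP (adj x y); case: (col x) (col y) => [] [].
  rewrite [RHS](exchange_big_dep predT) //=; apply: eq_bigr => x _.
  rewrite mulr_suml; apply: eq_big => [y|y _]; last by ring.
  by rewrite adjC.
under [X in _ = X + _]eq_bigr do rewrite mulrBl.
rewrite sumrB split_adj mulrBr !mulr_sumr -addrA; congr (_ + _).
  by apply: eq_bigr => x _; ring.
rewrite addrC -sumrB -sumrN; apply: eq_bigr => x _.
rewrite -sumrB mulr_sumr -sumrN; apply: eq_bigr => y _.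
by ring.
Qed.

(** If the norm of b is not positive, then r = b / d is constant along edges and
    vanishes where d is not harmonic. *)
Lemma superharmonic_posdef b : b != 0 -> 0 < euler_form adj col b b.
Proof.
move=> b_neq0; rewrite ltNge; apply: contra b_neq0 => le0.
pose r x : rat := (b x)%:~R / d x.
have d0 x : d x != 0 by rewrite gt_eqF.
have drE x : d x * r x = (b x)%:~R by rewrite mulrC divfK.
pose A x := (2%:R * d x - \sum_(y | adj x y) d y) * (d x * r x ^+ 2).
pose B x y := d x * d y * (r x - r y) ^+ 2.
have A_ge0 x : 0 <= A x.
  by rewrite mulr_ge0 ?subr_ge0 // mulr_ge0 ?sqr_ge0 // ltW.
have B_ge0 x y : 0 <= B x y by rewrite mulr_ge0 ?sqr_ge0 // mulr_ge0 // ltW.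
have SB_ge0 x : 0 <= \sum_(y | adj x y && col x) B x y by apply: sumr_ge0.
have sum_le0 : \sum_x A x + \sum_x \sum_(y | adj x y && col x) B x y <= 0.
  rewrite -superharmonic_square pmulr_rle0 //.
  suff -> : \sum_x (d x * r x) ^+ 2
      - \sum_x \sum_(y | adj x y && col x) (d x * r x) * (d y * r y)
      = (euler_form adj col b b)%:~R by rewrite lerz0.
  rewrite rmorphB !rmorph_sum /=; congr (_ - _).
    by apply: eq_bigr => x _; rewrite drE rmorphM.
  apply: eq_bigr => x _; rewrite rmorph_sum /=.
  by apply: eq_bigr => y _; rewrite !drE rmorphM.
have A_sum_ge0 : 0 <= \sum_x A x by apply: sumr_ge0 => x _; apply: A_ge0.
have B_sum_ge0 : 0 <= \sum_x \sum_(y | adj x y && col x) B x y.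
  by apply: sumr_ge0 => x _; apply: SB_ge0.
have A_sum : \sum_x A x = 0.
  by apply/eqP; rewrite eq_le A_sum_ge0 (le_trans _ sum_le0) // lerDl.
have B_sum : \sum_x \sum_(y | adj x y && col x) B x y = 0.
  by apply/eqP; rewrite eq_le B_sum_ge0 (le_trans _ sum_le0) // lerDr.
have r_x0 : r x0 = 0.
  have /eqP := @psumr_eq0P _ _ predT A (fun x _ => A_ge0 x) A_sum x0 isT.
  rewrite /A mulf_eq0 subr_eq0 gt_eqF //= mulf_eq0 (negPf (d0 x0)) /=.
  by rewrite sqrf_eq0 => /eqP.
have r_adj x y : adj x y -> r x = r y.
  have r_col u v : adj u v -> col u -> r u = r v.
    move=> auv cu.
    have SBu := psumr_eq0P (fun x _ => SB_ge0 x) B_sum (i := u) isT.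
    have Buv := psumr_eq0P (fun y _ => B_ge0 u y) SBu (i := v).
    have /eqP := Buv (introT andP (conj auv cu)).
    by rewrite /B 2!mulf_eq0 !(negPf (d0 _)) /= sqrf_eq0 subr_eq0 => /eqP.
  move=> axy; have [cx|ncx] := boolP (col x); first exact: r_col.
  apply/esym/r_col; first by rewrite adjC.
  by move: (adj_col axy); rewrite (negPf ncx); case: (col y).
apply/eqP/ffunP => x; rewrite [RHS]ffunE; apply/eqP.
by rewrite -(intr_eq0 rat) -drE (connected r_adj x x0) r_x0 mulr0.
Qed.

End Superharmonic.

(** * Diagrams that are a chain with a branch *)

Section ChainWithBranch.
Variables (n l b : nat).
Hypotheses (lt_bl : (b < l)%N) (le_ln : (l <= n)%N) (le_nl : (n <= l.+1)%N).

Definition parent (j : nat) : nat := if (j < l)%N then j.-1 else b.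

Lemma parent_lt j : (0 < j)%N -> (parent j < j)%N.
Proof. by rewrite /parent; case: ifP; lia. Qed.

Lemma chain_parent i j : chain_with_branch l b i j
  = [&& 0 < j & i == parent j]%N || [&& 0 < i & j == parent i]%N.
Proof. by rewrite /chain_with_branch /parent; case: ifP; case: ifP; lia. Qed.

Definition chain_neighbours (i : nat) : seq nat :=
  (if 0 < i then [:: parent i] else [::])%N
  ++ (if i.+1 < l then [:: i.+1] else [::])%N
  ++ (if (i == b) && (l < n)%N then [:: l] else [::]).

Lemma chain_neighboursP i j : (i < n)%N -> (j < n)%N ->
  chain_with_branch l b i j -> j \in chain_neighbours i.
Proof.
move=> lt_in lt_jn; rewrite chain_parent /chain_neighbours !mem_cat.
move=> /orP[/andP[j0 /eqP iE]|/andP[-> /eqP->]]; last by rewrite inE eqxx.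
move: iE; rewrite /parent; case: ifP => [lt_jl iE|ge_jl iE].
  have -> : j = i.+1 by lia.
  by rewrite (_ : i.+1 < l)%N ?inE ?eqxx ?orbT //; lia.
have -> : j = l by lia.
by rewrite iE eqxx (_ : l < n)%N ?inE ?eqxx ?orbT //; lia.
Qed.

Lemma sum_chain_neighbours (d : nat -> nat) i :
  (\sum_(k <- chain_neighbours i) d k =
   (if 0 < i then d (parent i) else 0) + ((if i.+1 < l then d i.+1 else 0)
     + (if (i == b) && (l < n) then d l else 0)))%N.
Proof.
rewrite /chain_neighbours !big_cat /=.
by congr (_ + (_ + _))%N; case: ifP => _; rewrite ?big_seq1 ?big_nil.
Qed.

Lemma sum_mem_leq (Q : pred 'I_n) (s : seq nat) (d : nat -> nat) :
  (forall j : 'I_n, Q j -> (j : nat) \in s) ->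
  (\sum_(j < n | Q j) d j <= \sum_(k <- s) d k)%N.
Proof.
elim: s Q => [|k s IH] Q Qs.
  by rewrite big_nil big_pred0 // => j; apply/negP => /Qs.
rewrite big_cons (bigID (fun j : 'I_n => (j : nat) == k)) /= leq_add //.
  case: (ltnP k n) => [lt_kn|le_nk].
    rewrite (leq_trans (n := (\sum_(j < n | j == Ordinal lt_kn) d j)%N)) //.
      rewrite big_mkcond [leqRHS]big_mkcond /=; apply: leq_sum => j _.
      by rewrite -val_eqE /=; case: (Q j); case: (_ == k).
    by rewrite big_pred1_eq.
  by rewrite big_pred0 // => j; apply/negP => /andP[_ /eqP jk]; have := ltn_ord j; lia.
by apply: IH => j /andP[/Qs]; rewrite inE => /orP[->|].
Qed.

Section Labelling.
Variables (P : finType) (adj : rel P) (h : P -> 'I_n).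
Hypothesis h_bij : bijective h.
Hypothesis adjE : forall x y, adj x y = chain_with_branch l b (h x) (h y).

(** Vertices at even distance from the branch vertex, which is therefore itself
    coloured. The vertex l, if present, is a neighbour of the branch vertex. *)
Definition even_distance x : bool := (h x < l)%N && (odd (h x) == odd b).

Lemma chain_adjC : symmetric adj.
Proof. by move=> x y; rewrite !adjE /chain_with_branch orbC. Qed.

Lemma chain_adj_col x y : adj x y -> even_distance x != even_distance y.
Proof.
rewrite adjE chain_parent /even_distance /parent.
case: (h x) (h y) => [i lt_in] [j lt_jn] /=.
by case: (ltnP j l); case: (ltnP i l); lia.
Qed.

Lemma chain_uncolored_deg x : ~~ even_distance x -> (#|[pred y | adj y x]| <= 2)%N.
Proof.
move=> ncx; have ne_xb : (h x : nat) != b.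
  by apply: contraNneq ncx => hx; rewrite /even_distance hx lt_bl eqxx.
have size_s : (size (chain_neighbours (h x)) <= 2)%N.
  rewrite /chain_neighbours (negPf ne_xb) /= cats0 size_cat.
  by case: ifP; case: ifP.
rewrite cardE -(size_map (fun y => h y : nat)); apply: leq_trans size_s.
apply: uniq_leq_size.
  by rewrite map_inj_uniq ?enum_uniq // => y z /val_inj/(bij_inj h_bij).
move=> _ /mapP[y + ->]; rewrite mem_enum inE => ayx.
by apply: chain_neighboursP; rewrite -?adjE ?ltn_ord // chain_adjC.
Qed.

Lemma chain_connected (T : Type) (f : P -> T) :
  (forall x y, adj x y -> f x = f y) -> forall x y, f x = f y.
Proof.
move=> f_adj; have [g hK gK] := h_bij.
suff f0 k : forall x y, (h x <= k)%N -> (h y : nat) = 0%N -> f x = f y.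
  move=> x y; have n0 : (0 < n)%N by apply: leq_ltn_trans (ltn_ord (h x)).
  pose z := g (Ordinal n0); have hz : (h z : nat) = 0%N by rewrite gK.
  by rewrite (f0 _ x z (leqnn _) hz) (f0 _ y z (leqnn _) hz).
elim: k => [|k IH] x y hx hy.
  by congr f; apply: (bij_inj h_bij); apply: val_inj => /=; lia.
have [x0|x0] := posnP (h x); first by apply: IH; rewrite ?x0.
have lt_p : (parent (h x) < n)%N.
  by apply: ltn_trans (parent_lt x0) _; apply: ltn_ord.
pose z := g (Ordinal lt_p); have hz : (h z : nat) = parent (h x) by rewrite gK.
have /f_adj -> : adj x z by rewrite adjE chain_parent hz eqxx x0 orbT.
by apply: IH => //; rewrite hz; have := parent_lt x0; lia.
Qed.

Section Products.
Variables (K : fieldType) (r : P -> P -> K).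
Hypotheses (rC : forall x y, r x y = r y x) (r0 : forall x y, adj x y -> r x y != 0).

Definition parent_vertex x : P :=
  odflt x [pick y | (0 < h x)%N && ((h y : nat) == parent (h x))].

Lemma parent_vertexE x : (0 < h x)%N -> (h (parent_vertex x) : nat) = parent (h x).
Proof.
move=> x0; rewrite /parent_vertex; case: pickP => [y /andP[_ /eqP]//|none].
have lt_p : (parent (h x) < n)%N.
  by apply: ltn_trans (parent_lt x0) _; apply: ltn_ord.
have [g _ gK] := h_bij.
by have := none (g (Ordinal lt_p)); rewrite x0 gK eqxx.
Qed.

Fixpoint solve_rec k x : K :=
  if k is k'.+1 then
    if (0 < h x)%N then r (parent_vertex x) x / solve_rec k' (parent_vertex x) else 1
  else 1.

Definition solve x : K := solve_rec (h x).+1 x.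

Lemma solve_stable k x : (h x < k)%N -> solve_rec k x = solve x.
Proof.
rewrite /solve; have [m] := ubnP (h x); elim: m k x => // m IH [|k] x // lt_xm lt_xk /=.
case: ifP => // x0; have lt_p := parent_lt x0.
have hp := parent_vertexE x0.
by rewrite !IH // hp; lia.
Qed.

Lemma solveE x : (0 < h x)%N -> solve x = r (parent_vertex x) x / solve (parent_vertex x).
Proof.
move=> x0; rewrite {1}/solve /= x0 solve_stable // (parent_vertexE x0).
exact: parent_lt.
Qed.

Lemma adj_parent x : (0 < h x)%N -> adj (parent_vertex x) x.
Proof. by move=> x0; rewrite adjE chain_parent (parent_vertexE x0) x0 eqxx. Qed.

Lemma solve_neq0 x : solve x != 0.
Proof.
have [m] := ubnP (h x); elim: m x => // m IH x lt_xm.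
have [x0|x0] := posnP (h x); first by rewrite /solve x0 /= x0 oner_neq0.
rewrite solveE // mulf_neq0 ?invr_eq0 ?r0 ?adj_parent // IH //.
by rewrite (parent_vertexE x0); have := parent_lt x0; lia.
Qed.

Lemma solve_prod x y : adj x y -> solve x * solve y = r x y.
Proof.
suff up u v : (0 < h v)%N -> (h u : nat) = parent (h v) -> solve u * solve v = r u v.
  rewrite adjE chain_parent => /orP[/andP[y0 /eqP xE]|/andP[x0 /eqP yE]].
    exact: up.
  by rewrite mulrC rC; apply: up.
move=> v0 uE; have -> : u = parent_vertex v.
  by apply: (bij_inj h_bij); apply: val_inj; rewrite /= uE parent_vertexE.
by rewrite (solveE v0) mulrC divfK ?solve_neq0.
Qed.

End Products.

Lemma chain_edge_products : edge_product_surjective adj.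
Proof.
move=> K r rC r0; exists (solve r) => [x|x y axy]; first exact: solve_neq0.
exact: solve_prod.
Qed.

Variable d : nat -> nat.
Hypothesis d_gt0 : forall i, (i < n)%N -> (0 < d i)%N.
Hypothesis d_super : forall i, (i < n)%N ->
  (\sum_(k <- chain_neighbours i) d k <= 2 * d i)%N.
Variable i0 : nat.
Hypothesis lt_i0n : (i0 < n)%N.
Hypothesis d_strict : (\sum_(k <- chain_neighbours i0) d k < 2 * d i0)%N.

Lemma chain_sum_neighbours x :
  (\sum_(y | adj x y) d (h y) <= \sum_(k <- chain_neighbours (h x)) d k)%N.
Proof.
apply: leq_trans (@sum_mem_leq (fun j => chain_with_branch l b (h x) j) _ d _);
  last by move=> j; apply: chain_neighboursP.
rewrite (reindex h) /=; last exact: onW_bij.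
by rewrite leq_eqVlt; apply/orP; left; apply/eqP/eq_bigl => y; rewrite adjE.
Qed.

Lemma chain_posdef c : c != 0 -> 0 < euler_form adj even_distance c c.
Proof.
have [g hK gK] := h_bij.
apply: (@superharmonic_posdef _ _ _ chain_adjC chain_adj_col
  (fun x => (d (h x))%:R) _ _ (g (Ordinal lt_i0n))).
- by move=> x; rewrite ltr0n d_gt0.
- move=> x; rewrite -natr_sum -natrM ler_nat.
  by apply: leq_trans (chain_sum_neighbours x) (d_super _).
- rewrite -natr_sum -natrM ltr_nat; apply: leq_ltn_trans (chain_sum_neighbours _) _.
  by rewrite gK.
- exact: chain_connected.
Qed.

Lemma chain_rootData : inhabited (rootData adj).
Proof.
exact: inhabits (RootData chain_adjC chain_adj_col chain_posdef chain_uncolored_deg).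
Qed.

End Labelling.
End ChainWithBranch.

(** The superharmonic functions are the marks of an affine diagram that contains the
    given one, restricted to it; they fail to be harmonic next to the removed
    vertices. *)
Lemma simply_laced_finite_data (P : finType) (adj : rel P) :
  simply_laced_finite adj -> inhabited (rootData adj) /\ edge_product_surjective adj.
Proof.
suff chain n l b (d : nat -> nat) i0 (h : P -> 'I_n) :
    [&& b < l, l <= n & n <= l.+1]%N -> bijective h ->
    (forall x y, adj x y = chain_with_branch l b (h x) (h y)) ->
    (forall i, (i < n)%N -> (0 < d i)%N) ->
    (forall i, (i < n)%N -> (\sum_(k <- chain_neighbours n l b i) d k <= 2 * d i)%N) ->
    (i0 < n)%N -> (\sum_(k <- chain_neighbours n l b i0) d k < 2 * d i0)%N ->
    inhabited (rootData adj) /\ edge_product_surjective adj.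
  move=> [[n|n|n] [/= valid [h h_bij adjE]]].
  - apply: (chain n n 0 (fun=> 1) 0 h)%N => //.
    + by lia.
    + move=> i lt_in; rewrite sum_chain_neighbours ltnn andbF.
      by case: ifP; case: ifP.
    + by lia.
    + by rewrite sum_chain_neighbours !ltnn andbF; case: ifP.
  - apply: (chain n n.-1 (n - 3) (fun i => if i < n - 2 then 2 else 1) 0 h)%N => //.
    + by lia.
    + by move=> i _; case: ifP.
    + move=> i lt_in; rewrite sum_chain_neighbours /parent.
      by do ![case: ifP]; lia.
    + by lia.
    + rewrite sum_chain_neighbours /parent ltnn.
      by do ![case: ifP]; lia.
  (* Marks of affine E8 without the vertex of mark 1; n.-1 is the short arm. *)
  pose d n i := (if i == n.-1 then 3 else nth 0 [:: 2; 4; 6; 5; 4; 3; 2] i)%N.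
  have {valid} : [|| n == 6, n == 7 | n == 8]%N by lia.
  case/or3P => /eqP n_eq; rewrite n_eq in h h_bij adjE *.
  - apply: (chain 6 5 2 (d 6) 4 h)%N => //.
    + by do 6![case=> //].
    + by move=> i; rewrite sum_chain_neighbours; move: i; do 6![case=> //].
    + by rewrite sum_chain_neighbours.
  - apply: (chain 7 6 2 (d 7) 5 h)%N => //.
    + by do 7![case=> //].
    + by move=> i; rewrite sum_chain_neighbours; move: i; do 7![case=> //].
    + by rewrite sum_chain_neighbours.
  - apply: (chain 8 7 2 (d 8) 6 h)%N => //.
    + by do 8![case=> //].
    + by move=> i; rewrite sum_chain_neighbours; move: i; do 8![case=> //].
    + by rewrite sum_chain_neighbours.
move=> /and3P[lt_bl le_ln le_nl] h_bij adjE d_gt0 d_super lt_i0 d_strict; split.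
  exact: (chain_rootData lt_bl le_ln le_nl h_bij adjE d_gt0 d_super lt_i0 d_strict).
exact (chain_edge_products lt_bl le_ln le_nl h_bij adjE).
Qed.

Theorem theorem19 (K : fieldType) (hK : 2%N \notin [pchar K])
    (P : finType) (adj : rel P) (hP : simply_laced_finite adj) :
  exists phi : map_family adj K,
    [/\ variety_iso phi,
        torus_equivariant phi,
        open_torus_is_orbit adj K,
        open_torus_dense adj K
      & exists g : lieType K, forall f : point adj K, inX f ->
          in_open_torus (phi K idfun f) -> lie_iso (liL f) g].
Proof.
have [[R] solve_edges] := simply_laced_finite_data hP.
have char2 : (2%:R : K) != 0 by move: hK; rewrite inE.
exists (@edge_coordinates P adj R K); split.
- exact: edge_coordinates_iso char2.
- exact: edge_coordinates_equivariant.
- exact: open_torus_orbit R K solve_edges.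
- exact: open_torus_denseP.
- exact: open_torus_iso char2 solve_edges.
Qed.
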